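(* Let $g$ be an entire function of order $\rho$ with $0<\rho<\infty$ and let $\tau\in[0,\infty]$ be its type. For $z\in\mathbb{C}$ and $n\ge 0$ put $a_n(z)=g^{(n)}(z)/n!$ and $$\tau_0(z)=\frac{1}{e\rho}\limsup_k 2k\,|a_{2k}(z)|^{\rho/(2k)},\qquad \tau_1(z)=\frac{1}{e\rho}\limsup_k (2k+1)\,|a_{2k+1}(z)|^{\rho/(2k+1)} .$$ (i) If $\tau<\infty$, then $\tau_0(z)=\tau$ and $\tau_1(z)=\tau$ for almost every $z\in\mathbb{C}$ (with respect to Lebesgue area measure). (ii) If $\tau=\infty$, then there exists a dense $G_\delta$ (therefore uncountable) subset $\mathcal{U}_\infty$ of $\mathbb{C}$ such that $\tau_0(z)=\infty$ and $\tau_1(z)=\infty$ for all $z\in\mathcal{U}_\infty$.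
   Context: With $M(r)=\max_{|z|=r}|g(z)|$, the order of an entire function $g$ is $\rho=\limsup_{r\to\infty}\frac{\ln\ln M(r)}{\ln r}$, and, when $0<\rho<\infty$, the type of $g$ is $\tau=\limsup_{r\to\infty}\frac{\ln M(r)}{r^\rho}\in[0,\infty]$. Equivalently, $\tau=\frac{1}{e\rho}\limsup_n n|a_n(z)|^{\rho/n}$ for any $z\in\mathbb{C}$. *)

(* Defs.v *)
From mathcomp Require Import all_boot all_order all_algebra.
From mathcomp Require Import all_classical all_reals all_analysis.
From mathcomp Require Import complex.

Set Implicit Arguments.
Unset Strict Implicit.
Unset Printing Implicit Defensive.

Import Order.TTheory GRing.Theory Num.Theory.
Import numFieldNormedType.Exports.

Local Open Scope classical_set_scope.
Local Open Scope ring_scope.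

(* The complex plane is [R[i]^o]: the [^o] makes [R[i]] a normed module over
   itself, which gives it its usual topology and makes [derivable] and
   [derive1n] complex differentiation.  As the library norm [`|z|] takes its
   values in [R[i]], moduli are written with the [R]-valued [Normc.normc]. *)

Definition entire (R : realType) (g : R[i]^o -> R[i]^o) : Prop :=
  forall z : R[i]^o, derivable g z 1.

Definition max_modulus (R : realType) (g : R[i]^o -> R[i]^o) (r : R) : R :=
  sup [set Normc.normc (g z) | z in [set z : R[i]^o | Normc.normc z = r]].

(* Only the values at large [r] matter, so the convention that [ln] vanishes on
   nonpositive reals can only play a role for constant [g], which get order 0. *)
Definition entire_order (R : realType) (g : R[i]^o -> R[i]^o) : \bar R :=
  limf_esup (fun r : R => (ln (ln (max_modulus g r)) / ln r)%:E) +oo%R.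

Definition entire_type (R : realType) (g : R[i]^o -> R[i]^o) (rho : R) : \bar R :=
  limf_esup (fun r : R => (ln (max_modulus g r) / r `^ rho)%:E) +oo%R.

Definition taylor_coef (R : realType) (g : R[i]^o -> R[i]^o) (n : nat)
    (z : R[i]^o) : R[i] :=
  derive1n n g z / (n`!)%:R.

(* At [n = 0] the factor [n%:R] makes this 0, whatever [rho / 0] is. *)
Definition type_term (R : realType) (g : R[i]^o -> R[i]^o) (rho : R)
    (z : R[i]^o) (n : nat) : \bar R :=
  (n%:R * Normc.normc (taylor_coef g n z) `^ (rho / n%:R))%:E.

Definition tau0 (R : realType) (g : R[i]^o -> R[i]^o) (rho : R)
    (z : R[i]^o) : \bar R :=
  ((expR 1 * rho)^-1%:E * limn_esup (fun k => type_term g rho z (2 * k)))%E.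

Definition tau1 (R : realType) (g : R[i]^o -> R[i]^o) (rho : R)
    (z : R[i]^o) : \bar R :=
  ((expR 1 * rho)^-1%:E * limn_esup (fun k => type_term g rho z (2 * k + 1)))%E.

(* [P] holds almost everywhere for Lebesgue area measure, transported from
   [R * R] along (x, y) |-> x + iy. *)
Definition ae_area (R : realType) (P : R[i]^o -> Prop) : Prop :=
  {ae (@lebesgue_measure R \x @lebesgue_measure R)%E,
    forall p, P (Complex p.1 p.2)}.

(* Main.v *)
Require Import Defs.
From mathcomp Require Import all_boot all_order all_algebra.
From mathcomp Require Import all_classical all_reals all_analysis.
From mathcomp Require Import measurable_realfun borel_hierarchy complex.
From mathcomp Require Import qpoly cyclic separable cyclotomic.
From mathcomp Require Import ring lra zify.

Set Implicit Arguments.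
Unset Strict Implicit.
Unset Printing Implicit Defensive.

Import Order.TTheory GRing.Theory Num.Theory.
Import numFieldNormedType.Exports.
Import Normc.

Local Open Scope classical_set_scope.
Local Open Scope ring_scope.

Local Notation Re := complex.Re.
Local Notation Im := complex.Im.

(** Let [L = e * rho * tau]. By Cauchy's estimates and summation of the Taylor
    series, a growth bound [exp (T * r ^ rho)] of [g] amounts to a bound
    [(A / n) ^ (n / rho)] of its Taylor coefficients [a_n(z)] at any one point
    [z], with [A] as close to [e * rho * T] as desired ([growth_coef],
    [coef_growth]). Hence [n * |a_n(z)| ^ (rho / n)] has upper limit [L] at every
    [z], and both partial types are at most [tau]. It remains to see where
    the coefficients of one parity can be too small. The link between the two
    parities is that [(n + 1) * a_(n + 1)] is the derivative of [a_n]: if [a_n] is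
    small on a disc for all even [n], then at the centre all coefficients are
    small ([consecutive_growth]).

    For infinite type, the set of points at which the coefficients of index
    [n >= K] of one parity are at most [(A / n) ^ (n / rho)] is closed, and it has
    no interior, for otherwise the type would be finite
    ([small_coefs_nowhere_dense]). The complement of the union of these countably
    many sets is the required set, by Baire's theorem.

    For finite type, let [A < L]. It is enough that the same closed set meets every
    vertical line in a null set ([small_coef_line_null]), by Tonelli's theorem. A
    set of positive measure on a line contains, for each [N], [N + 1] points with
    gaps of order [1 / N]; Lagrange interpolation at them bounds the coefficients
    of a polynomial of degree [N] by [Q ^ N] times its maximum at the nodes, where
    [Q] does not depend on [N] ([interpolation_coef_spaced]). Apply this to the
    Taylor polynomial of degree [N], a small fraction of [n], of the entire function
    [a_n]. The factor [Q ^ N] costs an arbitrarily small part of the gap between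
    [A] and [L]. The remainder of the Taylor polynomial is harmless, because
    [a_n] is bounded by [(B / n) ^ (n / rho)] on discs of any fixed radius, for one
    constant [B]: a large radius makes the remainder smaller by any factor
    [q ^ N]. Therefore [a_n(0)] and [a_(n + 1)(0)] are too small for all large [n]
    of the given parity, and the type would be smaller than [tau]
    ([spread_from_line]).

    All this uses that an entire function, assumed differentiable only, has a
    power series. Goursat's bisection argument gives Cauchy's formula on the unit
    square, hence a power series in the unit disc, and rescaling gives one in the
    plane ([entire_has_series]). Cauchy's estimate is then purely algebraic, by
    averages over roots of unity ([cauchy_estimate_series]). *)

(** * Moduli of complex numbers *)

Section Moduli.
Variable R : realType.
Implicit Types (x y z : R[i]) (a b : R).

Lemma normc_ge0 z : 0 <= normc z.
Proof. by case: z => a b /=; exact: sqrtr_ge0. Qed.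

Lemma norm_normc z : `|z| = (normc z)%:C%C.
Proof. by case: z. Qed.

Lemma normc_real a : normc (a%:C%C) = `|a|.
Proof. by rewrite /= expr0n addr0 sqrtr_sqr. Qed.

Lemma normc_nat n : normc (n%:R : R[i]) = n%:R.
Proof. by rewrite normcMn normc1. Qed.

Lemma normcD x y : normc (x + y) <= normc x + normc y.
Proof. exact: le_normcD. Qed.

Lemma normcB x y : normc (x - y) <= normc x + normc y.
Proof. by rewrite (le_trans (normcD _ _)) // normcN. Qed.

Lemma normc_distC x y : normc (x - y) = normc (y - x).
Proof. by rewrite -normcN opprB. Qed.

Lemma normc_lerB x y : normc x - normc y <= normc (x - y).
Proof. by rewrite lerBlDr (le_trans _ (normcD _ _)) // subrK. Qed.

Lemma normcX z n : normc (z ^+ n) = normc z ^+ n.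
Proof. by elim: n => [|n IH]; rewrite ?expr0 ?normc1 // !exprS normcM IH. Qed.

Lemma normc_sum (I : Type) (s : seq I) (P : pred I) (F : I -> R[i]) :
  normc (\sum_(i <- s | P i) F i) <= \sum_(i <- s | P i) normc (F i).
Proof.
elim/big_ind2: _ => [|x a y b xa yb|//]; first by rewrite normc0.
by rewrite (le_trans (normcD _ _)) // lerD.
Qed.

Lemma normc_prod (I : Type) (s : seq I) (P : pred I) (F : I -> R[i]) :
  normc (\prod_(i <- s | P i) F i) = \prod_(i <- s | P i) normc (F i).
Proof.
by elim/big_rec2: _ => [|i y z _ <-]; rewrite ?normc1 // normcM.
Qed.

Lemma ler_Re_normc z : `|Re z| <= normc z.
Proof. by case: z => a b /=; rewrite -sqrtr_sqr ler_wsqrtr // lerDl sqr_ge0. Qed.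

Lemma ler_Im_normc z : `|Im z| <= normc z.
Proof. by case: z => a b /=; rewrite -sqrtr_sqr ler_wsqrtr // lerDr sqr_ge0. Qed.

Lemma normc_i : normc ('i%C : R[i]) = 1.
Proof. by rewrite /= expr0n add0r expr1n sqrtr1. Qed.

Lemma normc_le_ReIm z : normc z <= `|Re z| + `|Im z|.
Proof.
rewrite {1}[z]complexE (le_trans (normcD _ _)) // normcM normc_i mul1r.
by rewrite !normc_real.
Qed.

Lemma normc_gt0 z : (0 < normc z) = (z != 0).
Proof.
rewrite lt_def normc_ge0 andbT; congr negb; apply/eqP/eqP => [|->].
  exact: eq0_normc.
exact: normc0.
Qed.

Lemma ReD x y : Re (x + y) = Re x + Re y. Proof. by case: x y => ? ? []. Qed.
Lemma ImD x y : Im (x + y) = Im x + Im y. Proof. by case: x y => ? ? []. Qed.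
Lemma ReB x y : Re (x - y) = Re x - Re y. Proof. by case: x y => ? ? []. Qed.
Lemma ImB x y : Im (x - y) = Im x - Im y. Proof. by case: x y => ? ? []. Qed.
Lemma ReM x y : Re (x * y) = Re x * Re y - Im x * Im y.
Proof. by case: x y => ? ? []. Qed.
Lemma ImM x y : Im (x * y) = Re x * Im y + Im x * Re y.
Proof. by case: x y => ? ? []. Qed.

Lemma posC_real (e : R[i]) : 0 < e -> exists2 a, 0 < a & e = a%:C%C.
Proof.
case: e => a b; rewrite ltcE /= => /andP[/eqP -> a0].
by exists a.
Qed.

End Moduli.

(** * Complex derivatives and continuity in terms of moduli *)

Section EpsilonDelta.
Variable R : realType.
Notation C := (R[i]^o).

(** The derivative in terms of the real-valued modulus, which spares the
    comparison of complex numbers in the estimates. *)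
Definition cdiff (f : C -> C) (z d : C) :=
  forall e : R, 0 < e -> exists2 r : R, 0 < r & forall h : C,
    normc h <= r -> normc (f (z + h) - f z - d * h) <= e * normc h.

Lemma cvgcP (T : Type) (F : set_system T) (FF : Filter F) (f : T -> C) (l : C) :
  (f x @[x --> F] --> l) <->
  (forall e : R, 0 < e -> \forall x \near F, normc (l - f x) <= e).
Proof.
split.
  move/cvgrPdist_le => H e e0.
  have : \forall x \near F, `|l - f x| <= e%:C%C.
    by apply: H; rewrite ltcR.
  by apply: filterS => x; rewrite norm_normc lecR.
move=> H; apply/cvgrPdist_le => e /posC_real[a a0 ->].
by have := H a a0; apply: filterS => x; rewrite norm_normc lecR.
Qed.

Lemma nbhscP (z : C) (P : set C) :
  nbhs z P <-> exists2 r : R, 0 < r & forall w, normc (z - w) < r -> P w.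
Proof.
split.
  move/nbhs_ballP => [e /= /posC_real[a a0 ->]] H; exists a => // w zw.
  by apply: H; rewrite /ball /= norm_normc ltcR.
move=> [r r0 H]; apply/nbhs_ballP; exists r%:C%C; first by rewrite /= ltcR.
by move=> w; rewrite /ball /= norm_normc ltcR; exact: H.
Qed.

Lemma continuouscP (f : C -> C) (z : C) : {for z, continuous f} <->
  (forall e : R, 0 < e -> exists2 r : R, 0 < r &
    forall w, normc (z - w) < r -> normc (f z - f w) <= e).
Proof.
split.
  by move=> H e e0; apply/nbhscP; exact: ((cvgcP (nbhs_filter z) f (f z)).1 H e e0).
move=> H; apply/(cvgcP (nbhs_filter z) f (f z)) => e e0.
by apply/nbhscP; exact: H.
Qed.

Lemma cdiffP (f : C -> C) (z d : C) : cdiff f z d <-> is_derive z 1 f d.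
Proof.
have key : (fun h : C => h^-1 *: (f (h *: 1 + z) - f z)) h @[h --> 0^'] --> d
    <-> cdiff f z d.
  have E h : h != 0 -> normc (d - h^-1 *: (f (h *: 1 + z) - f z)) * normc h
      = normc (f (z + h) - f z - d * h).
    move=> h0; rewrite -normcM -normcN; congr normc.
    rewrite -[h *: 1]/(h * 1) mulr1 -[_ *: _]/(_ * _) [h + z]addrC.
    by field.
  split.
    move/cvgcP => H e e0.
    have /nbhscP[r r0 {}H] := H e e0.
    exists (r / 2); first by rewrite divr_gt0.
    move=> h hr; have [->|h0] := eqVneq h 0.
      by rewrite addr0 subrr mulr0 subrr normc0 mulr0.
    rewrite -E // ler_wpM2r ?normc_ge0 //; apply: H => //.
    by rewrite sub0r normcN (le_lt_trans hr) // ltr_pdivrMr // ltr_pMr // ltr1n.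
  move=> H; apply/cvgcP => e e0; apply/nbhscP.
  have [r r0 {}H] := H e e0; exists r => // h.
  rewrite sub0r normcN => hr h0.
  rewrite -(@ler_pM2r _ (normc h)) ?normc_gt0 // E //.
  by apply: H; exact: ltW.
rewrite -key; split => [H|[]].
  split; first by apply/cvg_ex; exists d.
  by apply: cvg_lim.
by move=> H1 <-; exact: H1.
Qed.

Lemma cdiff_derivable (f : C -> C) (z d : C) : cdiff f z d -> derivable f z 1.
Proof. by move/cdiffP => []. Qed.

Lemma cdiff_derive1 (f : C -> C) (z d : C) : cdiff f z d -> derive1 f z = d.
Proof. by move/cdiffP => H; rewrite derive1E derive_val. Qed.

Lemma derivable_cdiff (f : C -> C) (z : C) :
  derivable f z 1 -> cdiff f z (derive1 f z).
Proof.
by move=> H; apply/cdiffP; rewrite derive1E; apply: DeriveDef.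
Qed.

Lemma entire_continuous (f : C -> C) : entire f -> continuous f.
Proof. by move=> H z; apply/differentiable_continuous/derivable1_diffP. Qed.

Lemma continuous_Re (u : R -> C) : continuous u -> continuous (fun t => Re (u t)).
Proof.
move=> H t; apply/cvgrPdist_le => e e0.
have /cvgcP/(_ e e0) := H t; apply: filterS => s /=.
by rewrite -ReB; exact/le_trans/ler_Re_normc.
Qed.

Lemma continuous_Im (u : R -> C) : continuous u -> continuous (fun t => Im (u t)).
Proof.
move=> H t; apply/cvgrPdist_le => e e0.
have /cvgcP/(_ e e0) := H t; apply: filterS => s /=.
by rewrite -ImB; exact/le_trans/ler_Im_normc.
Qed.

End EpsilonDelta.

(** * Integrals of continuous functions, through primitives *)

Section RealIntegral.
Variable R : realType.
Implicit Types (u v F : R -> R) (a b x : R).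

Let mu := @lebesgue_measure R.

Let loc u (c x : R) : R := \int[mu]_(t in `[c, x]) u t.

Let loc_derive u c x : continuous u -> c < x -> is_derive x 1 (loc u c) (u x).
Proof.
move=> cu cx.
have xx1 : x < x + 1 by rewrite ltrDl.
have int : mu.-integrable `[c, x + 1] (EFin \o u).
  apply: continuous_compact_integrable; first exact: segment_compact.
  exact: continuous_subspaceT.
have [dF <-] := continuous_FTC1_closed xx1 int cx (cu x).
by rewrite derive1E; exact: DeriveDef.
Qed.

(** By the mean value theorem. The derivatives concern the interval only, so that
    a primitive with singularities elsewhere qualifies. *)
Lemma derive_unique (F G u : R -> R) a b : a <= b ->
  (forall x, a <= x <= b -> is_derive x 1 F (u x)) ->
  (forall x, a <= x <= b -> is_derive x 1 G (u x)) ->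
  F b - F a = G b - G a.
Proof.
move=> ab dF dG; apply/eqP; rewrite -subr_eq0.
have dH x : a <= x <= b -> is_derive x 1 (F - G) ((fun=> 0) x).
  move=> xab; have h1 := dF x xab; have h2 := dG x xab.
  by apply: is_derive_eq; rewrite subrr.
have [||c _] := @MVT_segment R (F - G) (fun=> 0) a b ab.
- by move=> x; rewrite in_itv /= => /andP[ax xb]; apply: dH; rewrite !ltW.
- apply: derivable_within_continuous => x; rewrite in_itv /= => xab.
  by have [] := dH x xab.
rewrite mul0r -![(_ - _ : R -> R) _]/(_ - _) => H.
by apply/eqP; rewrite -[RHS]H; ring.
Qed.

(** On each half-line the integral from its end is a primitive; those that vanish
    at 0 agree with each other and can be glued. *)
Lemma primitive_exists u : continuous u ->
  exists F, forall x, is_derive x 1 F (u x).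
Proof.
move=> cu.
have locE (c c' x : R) : c < 0 -> c' < 0 -> c < x -> c' < x ->
    loc u c x - loc u c 0 = loc u c' x - loc u c' 0.
  move=> c0 c0' cx cx'; have [x0|x0] := leP 0 x.
    apply: (derive_unique (u := u)) => // t /andP[t0 _].
    - by apply: loc_derive => //; exact: lt_le_trans t0.
    - by apply: loc_derive => //; exact: lt_le_trans t0.
  apply: oppr_inj; rewrite !opprB.
  apply: (derive_unique (u := u)); first exact: ltW.
  - by move=> t /andP[t0 _]; apply: loc_derive => //; exact: lt_le_trans t0.
  - by move=> t /andP[t0 _]; apply: loc_derive => //; exact: lt_le_trans t0.
pose F x := loc u (- (`|x| + 1)) x - loc u (- (`|x| + 1)) 0.
exists F => x.
have big (t : R) : - (`|t| + 1) < t /\ - (`|t| + 1) < 0.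
  split; last by rewrite oppr_lt0 ltr_wpDl.
  by rewrite ltrNl (le_lt_trans (ler_norm _)) // normrN ltrDl.
pose c := - (`|x| + 2).
have cx : c < x.
  by rewrite /c ltrNl (le_lt_trans (ler_norm _)) // normrN ltrDl.
have c0 : c < 0 by rewrite /c oppr_lt0 ltr_wpDl.
have dG : is_derive x 1 (loc u c - cst (loc u c 0)) (u x).
  have h := loc_derive cu cx.
  by apply: is_derive_eq; rewrite subr0.
apply: near_eq_is_derive dG => //.
near=> t.
have ct : c < t by near: t; exact: lt_nbhsr.
by rewrite /F -![(_ - _ : R -> R) _]/(_ - _) /=; apply: locE => //; apply big.
Unshelve. all: by end_near.
Qed.

Definition primitive u : R -> R :=
  xget (fun=> 0) [set F | forall x, is_derive x 1 F (u x)].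

(** With integrals as differences of primitives, additivity and the sign rule
    for reversed bounds hold by construction. *)
Definition rint u a b : R := primitive u b - primitive u a.

Lemma primitiveP u x : continuous u -> is_derive x 1 (primitive u) (u x).
Proof.
move=> /primitive_exists[F HF]; rewrite /primitive.
by case: xgetP => [G _ /(_ x)//|/(_ F)/(_ HF)].
Qed.

Lemma rint_chasles u a b c : rint u a b + rint u b c = rint u a c.
Proof. by rewrite /rint addrC subrKA. Qed.

Lemma rintC u a b : rint u a b = - rint u b a.
Proof. by rewrite /rint opprB. Qed.

Lemma rint_FTC u F a b : continuous u ->
  (forall x, Num.min a b <= x <= Num.max a b -> is_derive x 1 F (u x)) ->
  rint u a b = F b - F a.
Proof.
move=> cu; wlog ab : a b / a <= b.
  move=> H; case: (boolP (a <= b)) => [/H//|]; rewrite -ltNge => /ltW ba dF.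
  have E : rint u b a = F a - F b.
    by apply: H => // x xab; apply: dF; rewrite minC maxC.
  by rewrite rintC E opprB.
rewrite (min_idPl ab) (max_idPr ab) => dF.
by apply: (derive_unique (u := u)) => // x _; exact: primitiveP.
Qed.

Lemma rintD u v a b : continuous u -> continuous v ->
  rint (fun x => u x + v x) a b = rint u a b + rint v a b.
Proof.
move=> cu cv; transitivity
  ((primitive u + primitive v) b - (primitive u + primitive v) a); last first.
  by rewrite /rint -![(_ + _ : R -> R) _]/(_ + _); ring.
apply: rint_FTC.
- by move=> x; exact: (continuousD (cu x) (cv x)).
- by move=> x _; have := primitiveP x cu; have := primitiveP x cv => h1 h2;
  apply: is_derive_eq.
Qed.

Lemma rintZ (k : R) u a b : continuous u ->
  rint (fun x => k * u x) a b = k * rint u a b.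
Proof.
move=> cu; transitivity ((k *: primitive u) b - (k *: primitive u) a); last first.
  by rewrite /rint -![(_ *: _ : R -> R) _]/(_ * _); ring.
apply: rint_FTC.
- by move=> x; exact: (continuousM (@cst_continuous _ _ k x) (cu x)).
- by move=> x _; have := primitiveP x cu => h1; apply: is_derive_eq.
Qed.

Lemma ler_rint u (M a b : R) : continuous u ->
  (forall x, Num.min a b <= x <= Num.max a b -> `|u x| <= M) ->
  `|rint u a b| <= M * `|b - a|.
Proof.
move=> cu; wlog ab : a b / a <= b.
  move=> H; case: (boolP (a <= b)) => [/H//|]; rewrite -ltNge => /ltW ba dF.
  rewrite rintC normrN (distrC b a); apply: H => // x xab; apply: dF.
  by rewrite minC maxC.
rewrite (min_idPl ab) (max_idPr ab) => uM.
have [||c] := @MVT_segment R (primitive u) u a b ab.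
- by move=> x _; exact: primitiveP.
- apply: derivable_within_continuous => x _.
  by have [] := primitiveP x cu.
rewrite in_itv /= => cab; rewrite /rint => ->; rewrite normrM.
by rewrite ler_wpM2r // uM.
Qed.

Lemma rint_gt0 u a b : continuous u -> a < b ->
  (forall x, a <= x <= b -> 0 < u x) -> 0 < rint u a b.
Proof.
move=> cu ab u0; have [||c] := @MVT_segment R (primitive u) u a b (ltW ab).
- by move=> x _; exact: primitiveP.
- apply: derivable_within_continuous => x _.
  by have [] := primitiveP x cu.
rewrite in_itv /= => cab; rewrite /rint => ->.
by rewrite mulr_gt0 ?subr_gt0 // u0.
Qed.

End RealIntegral.

Section ComplexIntegral.
Variable R : realType.
Notation C := (R[i]^o).
Implicit Types (u v : R -> C) (a b : R).

Definition cint u a b : C :=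
  Complex (rint (fun t => Re (u t)) a b) (rint (fun t => Im (u t)) a b).

Lemma cint_chasles u a b c : cint u a b + cint u b c = cint u a c.
Proof. by congr Complex; exact: rint_chasles. Qed.

Lemma cintD u v a b : continuous u -> continuous v ->
  cint (fun t => u t + v t) a b = cint u a b + cint v a b.
Proof.
move=> cu cv; congr Complex.
- rewrite -rintD; [|exact: continuous_Re..].
  by congr rint; apply/funext => t; rewrite ReD.
- rewrite -rintD; [|exact: continuous_Im..].
  by congr rint; apply/funext => t; rewrite ImD.
Qed.

Lemma cintZ (k : C) u a b : continuous u ->
  cint (fun t => k * u t) a b = k * cint u a b.
Proof.
move=> cu; have cR := continuous_Re cu; have cI := continuous_Im cu.
have cZ (w : R -> R) (l : R) : continuous w -> continuous (fun t => l * w t).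
  by move=> cw t; exact: (continuousM (@cst_continuous _ _ l t) (cw t)).
rewrite [RHS]complexE ReM ImM [LHS]complexE /=.
congr (_%:C%C + 'i%C * _%:C%C).
- rewrite -mulNr -!rintZ // -rintD; [|exact: cZ..].
  by congr rint; apply/funext => t; rewrite ReM mulNr.
- rewrite -!rintZ // -rintD; [|exact: cZ..].
  by congr rint; apply/funext => t; rewrite ImM.
Qed.

Lemma ler_cint u (M : R) a b : continuous u ->
  (forall t, Num.min a b <= t <= Num.max a b -> normc (u t) <= M) ->
  normc (cint u a b) <= 2 * M * `|b - a|.
Proof.
move=> cu uM; rewrite (le_trans (normc_le_ReIm _)) // -mulrA mulr_natl mulr2n.
rewrite lerD //=.
- apply: ler_rint => [|t /uM]; first exact: continuous_Re.
  exact/le_trans/ler_Re_normc.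
- apply: ler_rint => [|t /uM]; first exact: continuous_Im.
  exact/le_trans/ler_Im_normc.
Qed.

End ComplexIntegral.

(** * Integrals along the boundary of a rectangle *)

Section Boundary.
Variable R : realType.
Notation C := (R[i]^o).
Implicit Types (f g Q : C -> C) (x y : R).

(** The integral of [f] along the boundary of the rectangle with opposite
    corners [x0 + i y0] and [x1 + i y1]; the order of the corners only affects
    the sign. *)
Definition bint f x0 x1 y0 y1 : C :=
  cint (fun t => f (Complex t y0)) x0 x1
  + 'i%C * cint (fun t => f (Complex x1 t)) y0 y1
  - cint (fun t => f (Complex t y1)) x0 x1
  - 'i%C * cint (fun t => f (Complex x0 t)) y0 y1.

(** Continuity is asked along the four lines only, for the sake of functions with
    a pole inside the rectangle. *)
Definition bcont f x0 x1 y0 y1 :=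
  [/\ continuous (fun t => f (Complex t y0) : C),
      continuous (fun t => f (Complex x1 t) : C),
      continuous (fun t => f (Complex t y1) : C) &
      continuous (fun t => f (Complex x0 t) : C)].

Definition on_boundary x0 x1 y0 y1 (w : C) :=
  (Num.min x0 x1 <= Re w <= Num.max x0 x1) && ((Im w == y0) || (Im w == y1)) ||
  (Num.min y0 y1 <= Im w <= Num.max y0 y1) && ((Re w == x0) || (Re w == x1)).

Lemma continuous_hline y : continuous (fun t : R => Complex t y : C).
Proof.
move=> t; apply/(cvgcP (nbhs_filter t)) => e e0.
have : \forall s \near t, `|t - s| <= e.
  by apply/nbhs_ballP; exists e => // s /ltW.
apply: filterS => s ts.
rewrite -[normc _]/(normc (Complex (t - s) (y - y))) subrr complexr0.
by rewrite normc_real.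
Qed.

Lemma continuous_vline x : continuous (fun t : R => Complex x t : C).
Proof.
move=> t; apply/(cvgcP (nbhs_filter t)) => e e0.
have : \forall s \near t, `|t - s| <= e.
  by apply/nbhs_ballP; exists e => // s /ltW.
apply: filterS => s ts.
rewrite -[normc _]/(normc (Complex (x - x) (t - s))) subrr.
by rewrite (le_trans (normc_le_ReIm _)) //= normr0 add0r.
Qed.

Lemma continuous_bcont f x0 x1 y0 y1 : continuous f -> bcont f x0 x1 y0 y1.
Proof.
move=> cf; split=> t.
- exact: (continuous_comp (@continuous_hline y0 t) (cf _)).
- exact: (continuous_comp (@continuous_vline x1 t) (cf _)).
- exact: (continuous_comp (@continuous_hline y1 t) (cf _)).
- exact: (continuous_comp (@continuous_vline x0 t) (cf _)).
Qed.

Lemma bint_chasles_x f x0 x1 x2 y0 y1 :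
  bint f x0 x1 y0 y1 + bint f x1 x2 y0 y1 = bint f x0 x2 y0 y1.
Proof.
rewrite /bint -(cint_chasles _ x0 x1 x2) -(cint_chasles (fun t => f (Complex t y1)) x0 x1 x2).
by ring.
Qed.

Lemma bint_chasles_y f x0 x1 y0 y1 y2 :
  bint f x0 x1 y0 y1 + bint f x0 x1 y1 y2 = bint f x0 x1 y0 y2.
Proof.
rewrite /bint -(cint_chasles _ y0 y1 y2) -(cint_chasles (fun t => f (Complex x0 t)) y0 y1 y2).
by ring.
Qed.

(** The integrals are abstracted first, lest [ring] unfold them in trying to
    tell them apart. *)
Ltac ring_cint :=
  repeat match goal with |- context [cint ?u ?a ?b] =>
    generalize (cint u a b); intro end; ring.

Lemma bintD f g x0 x1 y0 y1 : bcont f x0 x1 y0 y1 -> bcont g x0 x1 y0 y1 ->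
  bint (fun w => f w + g w) x0 x1 y0 y1 = bint f x0 x1 y0 y1 + bint g x0 x1 y0 y1.
Proof.
move=> [f1 f2 f3 f4] [g1 g2 g3 g4].
have H y : continuous (fun t => f (Complex t y) : C) ->
    continuous (fun t => g (Complex t y) : C) ->
    cint (fun t => f (Complex t y) + g (Complex t y)) x0 x1 =
    cint (fun t => f (Complex t y)) x0 x1 + cint (fun t => g (Complex t y)) x0 x1.
  by move=> cf cg; exact: (cintD x0 x1 cf cg).
have V x : continuous (fun t => f (Complex x t) : C) ->
    continuous (fun t => g (Complex x t) : C) ->
    cint (fun t => f (Complex x t) + g (Complex x t)) y0 y1 =
    cint (fun t => f (Complex x t)) y0 y1 + cint (fun t => g (Complex x t)) y0 y1.
  by move=> cf cg; exact: (cintD y0 y1 cf cg).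
rewrite /bint (H _ f1 g1) (V _ f2 g2) (H _ f3 g3) (V _ f4 g4).
by ring_cint.
Qed.

Lemma bintZ (k : C) f x0 x1 y0 y1 : bcont f x0 x1 y0 y1 ->
  bint (fun w => k * f w) x0 x1 y0 y1 = k * bint f x0 x1 y0 y1.
Proof.
move=> [f1 f2 f3 f4].
have H y : continuous (fun t => f (Complex t y) : C) ->
    cint (fun t => k * f (Complex t y)) x0 x1 = k * cint (fun t => f (Complex t y)) x0 x1.
  by move=> cf; exact: (cintZ k x0 x1 cf).
have V x : continuous (fun t => f (Complex x t) : C) ->
    cint (fun t => k * f (Complex x t)) y0 y1 = k * cint (fun t => f (Complex x t)) y0 y1.
  by move=> cf; exact: (cintZ k y0 y1 cf).
rewrite /bint (H _ f1) (V _ f2) (H _ f3) (V _ f4).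
by ring_cint.
Qed.

Lemma ler_bint f (M : R) x0 x1 y0 y1 : bcont f x0 x1 y0 y1 ->
  (forall w, on_boundary x0 x1 y0 y1 w -> normc (f w) <= M) ->
  normc (bint f x0 x1 y0 y1) <= 4 * M * (`|x1 - x0| + `|y1 - y0|).
Proof.
move=> [f1 f2 f3 f4] fM; rewrite /bint.
have B1 : normc (cint (fun t => f (Complex t y0)) x0 x1) <= 2 * M * `|x1 - x0|.
  by apply: (ler_cint f1) => t tx; apply: fM; rewrite /on_boundary /= tx eqxx.
have B3 : normc (cint (fun t => f (Complex t y1)) x0 x1) <= 2 * M * `|x1 - x0|.
  by apply: (ler_cint f3) => t tx; apply: fM; rewrite /on_boundary /= tx eqxx orbT.
have B2 : normc (cint (fun t => f (Complex x1 t)) y0 y1) <= 2 * M * `|y1 - y0|.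
  by apply: (ler_cint f2) => t tx; apply: fM; rewrite /on_boundary /= tx eqxx !orbT.
have B4 : normc (cint (fun t => f (Complex x0 t)) y0 y1) <= 2 * M * `|y1 - y0|.
  by apply: (ler_cint f4) => t tx; apply: fM; rewrite /on_boundary /= tx eqxx !orbT.
move: (cint _ _ _) (cint _ _ _) (cint _ _ _) (cint _ _ _) B1 B2 B3 B4
  => z1 z2 z3 z4 B1 B2 B3 B4.
rewrite (le_trans (normcB _ _)) // normcM normc_i mul1r.
apply: (@le_trans _ _ (2 * M * `|x1 - x0| + 2 * M * `|y1 - y0| + 2 * M * `|x1 - x0|
   + 2 * M * `|y1 - y0|)); last by lra.
rewrite lerD // (le_trans (normcB _ _)) // lerD // (le_trans (normcD _ _)) //.
by rewrite normcM normc_i mul1r lerD.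
Qed.

Lemma is_derive_epsilon (F : R -> R) (x d : R) :
  (forall e, 0 < e -> exists2 r, 0 < r & forall h, `|h| <= r ->
     `|F (x + h) - F x - d * h| <= e * `|h|) ->
  is_derive x 1 F d.
Proof.
move=> H.
have key : (fun h : R => h^-1 *: (F (h *: 1 + x) - F x)) h @[h --> 0^'] --> d.
  apply/cvgrPdist_le => e /H[r r0 {}H].
  apply/nbhs_ballP; exists r => // h; rewrite /ball /= sub0r normrN => hr h0.
  have E : `|d - h^-1 *: (F (h *: 1 + x) - F x)| * `|h|
      = `|F (x + h) - F x - d * h|.
    rewrite -normrM -normrN -[h *: 1]/(h * 1) mulr1 -[_ *: _]/(_ * _) [h + x]addrC.
    by congr `|_|; field.
  by rewrite -(@ler_pM2r _ `|h|) ?normr_gt0 // E H // ltW.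
split; first by apply/cvg_ex; exists d.
by apply: cvg_lim.
Qed.

Lemma cdiff_line Q (p v d : C) (t : R) :
  cdiff Q (p + t%:C%C * v) d ->
  is_derive t 1 (fun s : R => Re (Q (p + s%:C%C * v))) (Re (v * d)) /\
  is_derive t 1 (fun s : R => Im (Q (p + s%:C%C * v))) (Im (v * d)).
Proof.
move=> H.
have key e : 0 < e -> exists2 r, 0 < r & forall h : R, `|h| <= r ->
    normc (Q (p + (t + h)%:C%C * v) - Q (p + t%:C%C * v) - (v * d) * h%:C%C)
    <= e * `|h|.
  move=> e0; have v0 : 0 < normc v + 1 by rewrite ltr_wpDl ?normc_ge0.
  have [r r0 {}H] := H (e / (normc v + 1)) (divr_gt0 e0 v0).
  exists (r / (normc v + 1)); first exact: divr_gt0.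
  move=> h hr.
  have hv : normc (h%:C%C * v) <= `|h| * (normc v + 1).
    by rewrite normcM normc_real ler_wpM2l // lerDl.
  have := H (h%:C%C * v); rewrite -(addrA p) -(mulrDl t%:C%C) -rmorphD => HH.
  have -> : v * d * h%:C%C = d * (h%:C%C * v) by ring.
  have hvr : normc (h%:C%C * v) <= r by rewrite (le_trans hv) // -ler_pdivlMr.
  rewrite (le_trans (HH hvr)) // -mulrA ler_wpM2l ?(ltW e0) //.
  by rewrite ler_pdivrMl // (mulrC _ `|h|).
split; apply: is_derive_epsilon => e /key[r r0 {}H]; exists r => // h /H;
  apply: le_trans.
- apply: le_trans (ler_Re_normc _).
  by rewrite !ReB [Re (_ * _%:C%C)]ReM /= mulr0 subr0.
- apply: le_trans (ler_Im_normc _).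
  by rewrite !ImB [Im (_ * _%:C%C)]ImM /= mulr0 add0r.
Qed.

(** This applies to [w ^- n.+2], whose primitive has a pole inside the rectangle. *)
Lemma bint_primitive f Q x0 x1 y0 y1 : bcont f x0 x1 y0 y1 ->
  (forall w, on_boundary x0 x1 y0 y1 w -> cdiff Q w (f w)) ->
  bint f x0 x1 y0 y1 = 0.
Proof.
move=> [f1 f2 f3 f4] dQ; rewrite /bint.
have hor y : continuous (fun t => f (Complex t y) : C) ->
    (y == y0) || (y == y1) ->
    cint (fun t => f (Complex t y)) x0 x1 = Q (Complex x1 y) - Q (Complex x0 y).
  move=> cf yy.
  have E (s : R) : Complex s y = Complex 0 y + s%:C%C * 1 :> C.
    by rewrite mulr1; congr Complex; rewrite ?add0r ?addr0.
  have D t : Num.min x0 x1 <= t <= Num.max x0 x1 ->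
      cdiff Q (Complex 0 y + t%:C%C * 1) (f (Complex t y)).
    by move=> tx; rewrite -E; apply: dQ; rewrite /on_boundary /= tx yy.
  rewrite /cint [in RHS](complexE (_ - _)) ReB ImB [LHS]complexE /=.
  congr (_%:C%C + 'i%C * _%:C%C).
  - rewrite (E x1) (E x0); apply: (rint_FTC (F := fun s => Re (Q (Complex 0 y + s%:C%C * 1)))).
      exact: continuous_Re.
    by move=> t /D/cdiff_line[+ _]; rewrite mul1r.
  - rewrite (E x1) (E x0); apply: (rint_FTC (F := fun s => Im (Q (Complex 0 y + s%:C%C * 1)))).
      exact: continuous_Im.
    by move=> t /D/cdiff_line[_]; rewrite mul1r.
have ver x : continuous (fun t => f (Complex x t) : C) ->
    (x == x0) || (x == x1) ->
    'i%C * cint (fun t => f (Complex x t)) y0 y1 = Q (Complex x y1) - Q (Complex x y0).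
  move=> cf xx; rewrite -(cintZ _ y0 y1 cf).
  have E (s : R) : Complex x s = x%:C%C + s%:C%C * 'i%C :> C.
    by rewrite [LHS]complexE mulrC.
  have cif : continuous (fun t => 'i%C * f (Complex x t) : C).
    by move=> t; exact: (continuousM (@cst_continuous _ _ ('i%C : C) t) (cf t)).
  have D t : Num.min y0 y1 <= t <= Num.max y0 y1 ->
      cdiff Q (x%:C%C + t%:C%C * 'i%C) (f (Complex x t)).
    by move=> tx; rewrite -E; apply: dQ; rewrite /on_boundary /= tx xx orbT.
  rewrite /cint [in RHS](complexE (_ - _)) ReB ImB [LHS]complexE.
  rewrite [Re (Complex _ _)]/= [Im (Complex _ _)]/=.
  congr (_%:C%C + 'i%C * _%:C%C).
  - rewrite (E y1) (E y0); apply: (rint_FTC (F := fun s => Re (Q (x%:C%C + s%:C%C * 'i%C)))).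
      exact: continuous_Re.
    by move=> t /D/cdiff_line[].
  - rewrite (E y1) (E y0); apply: (rint_FTC (F := fun s => Im (Q (x%:C%C + s%:C%C * 'i%C)))).
      exact: continuous_Im.
    by move=> t /D/cdiff_line[].
rewrite !hor ?ver ?eqxx ?orbT //.
move: (Q _) (Q _) (Q _) (Q _) => q1 q2 q3 q4; ring.
Qed.

End Boundary.

(** * Goursat's theorem *)

Section Goursat.
Variable R : realType.
Notation C := (R[i]^o).
Implicit Types (f : C -> C) (x y : R).

Definition in_rect x0 x1 y0 y1 (w : C) :=
  (x0 <= Re w <= x1) && (y0 <= Im w <= y1).

Lemma bintC_x f x0 x1 y0 y1 : bint f x0 x1 y0 y1 = - bint f x1 x0 y0 y1.
Proof.
apply/eqP; rewrite -subr_eq0 opprK bint_chasles_x; apply/eqP.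
by have /eqP := bint_chasles_x f x0 x0 x0 y0 y1; rewrite -subr_eq0 addrK => /eqP.
Qed.

Lemma bintC_y f x0 x1 y0 y1 : bint f x0 x1 y0 y1 = - bint f x0 x1 y1 y0.
Proof.
apply/eqP; rewrite -subr_eq0 opprK bint_chasles_y; apply/eqP.
by have /eqP := bint_chasles_y f x0 x1 y0 y0 y0; rewrite -subr_eq0 addrK => /eqP.
Qed.

Lemma bint_x0 f x0 y0 y1 : bint f x0 x0 y0 y1 = 0.
Proof.
by have /eqP := bint_chasles_x f x0 x0 x0 y0 y1; rewrite -subr_eq0 addrK => /eqP.
Qed.

Lemma bint_y0 f x0 x1 y0 : bint f x0 x1 y0 y0 = 0.
Proof.
by have /eqP := bint_chasles_y f x0 x1 y0 y0 y0; rewrite -subr_eq0 addrK => /eqP.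
Qed.

Lemma exp2_large (a r : R) : 0 < r -> exists n, a / 2 ^+ n <= r.
Proof.
move=> r0; pose n := Num.bound (`|a| / r); exists n.
rewrite ler_pdivrMr ?exprn_gt0 // mulrC -ler_pdivrMr //.
rewrite (@le_trans _ _ (`|a| / r)) ?ler_pM2r ?invr_gt0 ?ler_norm //.
have /ltW/le_trans := archi_boundP (divr_ge0 (normr_ge0 a) (ltW r0)); apply.
by rewrite -natrX ler_nat ltnW // ltn_expl.
Qed.

(** A complex derivative makes the integral along small rectangles
    quadratically small: an affine function has a primitive, so only the
    error term of the linearization is integrated. *)
Lemma bint_small f (p d : C) (e : R) : continuous f -> cdiff f p d -> 0 < e ->
  exists2 r : R, 0 < r & forall x y a b : R,
    x <= Re p <= x + a -> y <= Im p <= y + b -> a + b <= r ->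
    normc (bint f x (x + a) y (y + b)) <= 4 * e * (a + b) ^+ 2.
Proof.
move=> cf df e0; have [r r0 H] := df e e0; exists r => // x y a b px py abr.
have a0 : 0 <= a by case/andP: px => [h1 h2]; rewrite -(lerDl x) (le_trans h1).
have b0 : 0 <= b by case/andP: py => [h1 h2]; rewrite -(lerDl y) (le_trans h1).
pose aff (w : C) : C := f p + d * (w - p).
pose err (w : C) : C := f w - aff w.
have caff : continuous aff.
  move=> w; apply: (@continuousD _ _ _ (cst (f p)) (fun w => d * (w - p))).
    exact: cst_continuous.
  apply: (@continuousM _ _ (cst d) (fun w => w - p)); first exact: cst_continuous.
  apply: (@continuousB _ _ _ id (cst p)); last exact: cst_continuous.
  by move=> A.
have cerr : continuous err by move=> w; exact: (continuousB (cf w) (caff w)).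
have -> : bint f x (x + a) y (y + b) = bint err x (x + a) y (y + b).
  have -> : f = (fun w => aff w + err w).
    by apply/funext => w; rewrite /err addrC subrK.
  rewrite [LHS]bintD; [|exact: continuous_bcont..].
  rewrite (bint_primitive (Q := fun w => f p * w + d * ((w - p) ^+ 2) / 2)).
  - by rewrite add0r.
  - exact: continuous_bcont.
  - move=> w _ k k0; have d0 : 0 < normc d + 1 by rewrite ltr_wpDl ?normc_ge0.
    exists (k / (normc d + 1)); first exact: divr_gt0.
    move=> h hk; rewrite [X in normc X](_ : _ = d * h / 2 * h).
      rewrite 2!normcM ler_wpM2r ?normc_ge0 // normcM normcV normc_nat.
      rewrite ler_pdivrMr // (@le_trans _ _ k) //; last by rewrite ler_pMr // ler1n.
      rewrite ler_pdivlMr // in hk; apply: le_trans hk; rewrite mulrC.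
      by rewrite ler_wpM2l ?normc_ge0 // lerDl.
    by rewrite /aff; field.
have Hb w : on_boundary x (x + a) y (y + b) w -> normc (err w) <= e * (a + b).
  move=> ow; have wp : normc (w - p) <= a + b.
    rewrite (le_trans (normc_le_ReIm _)) // ReB ImB.
    move: ow; rewrite /on_boundary (min_idPl _) ?lerDl // (max_idPr _) ?lerDl //.
    rewrite (min_idPl _) ?lerDl // (max_idPr _) ?lerDl // => ow.
    have [rx ry] : x <= Re w <= x + a /\ y <= Im w <= y + b.
      case/orP: ow => /andP[-> /orP[/eqP->|/eqP->]]; split=> //;
      by rewrite !lexx ?lerDl ?a0 ?b0.
    move: px py rx ry => /andP[? ?] /andP[? ?] /andP[? ?] /andP[? ?].
    by rewrite lerD // ler_norml; apply/andP; split; lra.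
  have := H (w - p) (le_trans wp abr); rewrite addrCA subrr addr0 => E.
  rewrite /err /aff opprD addrA (le_trans E) //.
  by rewrite ler_wpM2l // ltW.
apply: (le_trans (ler_bint (continuous_bcont _ _ _ _ cerr) Hb)).
have Ek (u v : R) : u + v - u = v by ring.
by rewrite !Ek !ger0_norm // expr2 !mulrA.
Qed.

Lemma quarter_split (B : R) (z1 z2 z3 z4 : C) : B <= normc (z1 + z2 + (z3 + z4)) ->
  [\/ B / 4 <= normc z1, B / 4 <= normc z2, B / 4 <= normc z3 | B / 4 <= normc z4].
Proof.
move=> H; have [|h1] := leP (B / 4) (normc z1); first by constructor 1.
have [|h2] := leP (B / 4) (normc z2); first by constructor 2.
have [|h3] := leP (B / 4) (normc z3); first by constructor 3.
have [|h4] := leP (B / 4) (normc z4); first by constructor 4.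
have := normcD (z1 + z2) (z3 + z4).
have := normcD z1 z2; have := normcD z3 z4; lra.
Qed.

Lemma nested_limit (x : nat -> R) (w : R) :
  (forall n, x n <= x n.+1) ->
  (forall n, x n.+1 + w / 2 ^+ n.+1 <= x n + w / 2 ^+ n) -> 0 <= w ->
  exists X, forall n, x n <= X <= x n + w / 2 ^+ n.
Proof.
move=> x1 x2 w0.
have w0n n : 0 <= w / 2 ^+ n by rewrite divr_ge0 // exprn_ge0.
have xn n m : x n <= x (n + m)%N.
  by elim: m => [|m IH]; rewrite ?addn0 // addnS (le_trans IH).
have yn n m : x (n + m)%N + w / 2 ^+ (n + m) <= x n + w / 2 ^+ n.
  by elim: m => [|m IH]; rewrite ?addn0 // addnS (le_trans (x2 _)).
have xy n m : x n <= x m + w / 2 ^+ m.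
  have [nm|mn] := leqP n m.
    by rewrite (le_trans (xn n (m - n)%N)) // subnKC // lerDl.
  apply: le_trans (yn m (n - m)%N); rewrite subnKC ?lerDl //.
  exact: ltnW.
have hs : has_sup (range x).
  split; first by exists (x 0%N); exists 0%N.
  by exists (x 0%N + w / 2 ^+ 0) => _ [n _ <-].
exists (sup (range x)) => n; apply/andP; split.
  by apply: (ub_le_sup hs.2); exists n.
by apply: ge_sup hs.1 _ => _ [m _ <-].
Qed.

(** By bisection: some quarter carries a quarter of the integral, so after [n]
    steps the integral is at least [B / 4 ^ n], while [bint_small] at the common
    point of the nested rectangles bounds it by a small multiple of [1 / 4 ^ n]. *)
Lemma goursat_ordered f x0 x1 y0 y1 : continuous f -> x0 <= x1 -> y0 <= y1 ->
  (forall w, in_rect x0 x1 y0 y1 w -> derivable f w 1) ->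
  bint f x0 x1 y0 y1 = 0.
Proof.
move=> cf x01 y01 df; pose w := x1 - x0; pose h := y1 - y0.
have w0 : 0 <= w by rewrite subr_ge0.
have h0 : 0 <= h by rewrite subr_ge0.
have [|B0] := eqVneq (normc (bint f x0 x1 y0 y1)) 0; first exact: eq0_normc.
pose B := normc (bint f x0 x1 y0 y1).
have {}B0 : 0 < B by rewrite lt_def B0 normc_ge0.
pose cell n (p : R * R) :=
  bint f p.1 (p.1 + w / 2 ^+ n) p.2 (p.2 + h / 2 ^+ n).
have step (q : nat * (R * R)) : exists p' : R * R,
    B / 4 ^+ q.1 <= normc (cell q.1 q.2) ->
    [/\ B / 4 ^+ q.1.+1 <= normc (cell q.1.+1 p'),
       q.2.1 <= p'.1, p'.1 + w / 2 ^+ q.1.+1 <= q.2.1 + w / 2 ^+ q.1,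
       q.2.2 <= p'.2 & p'.2 + h / 2 ^+ q.1.+1 <= q.2.2 + h / 2 ^+ q.1].
  case: q => n [x y] /=.
  have [BC|] := boolP (B / 4 ^+ n <= normc (cell n (x, y))); last by exists (x, y).
  pose a := w / 2 ^+ n.+1; pose b := h / 2 ^+ n.+1.
  have a0 : 0 <= a by rewrite divr_ge0 // exprn_ge0.
  have b0 : 0 <= b by rewrite divr_ge0 // exprn_ge0.
  have Ea : w / 2 ^+ n = a + a by rewrite /a exprS invfM; field; rewrite expf_neq0.
  have Eb : h / 2 ^+ n = b + b by rewrite /b exprS invfM; field; rewrite expf_neq0.
  have BE : B / 4 ^+ n.+1 = B / 4 ^+ n / 4.
    by rewrite exprS invfM; field; rewrite expf_neq0.
  have : B / 4 ^+ n <= normc (bint f x (x + a) y (y + b)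
      + bint f (x + a) (x + a + a) y (y + b)
      + (bint f x (x + a) (y + b) (y + b + b)
      + bint f (x + a) (x + a + a) (y + b) (y + b + b))).
    by rewrite 2!bint_chasles_x bint_chasles_y -!addrA -Ea -Eb.
  rewrite Ea Eb BE => /quarter_split[] H.
  - by exists (x, y); rewrite /cell /= -/a -/b; split=> //; lra.
  - by exists (x + a, y); rewrite /cell /= -/a -/b; split=> //; lra.
  - by exists (x, y + b); rewrite /cell /= -/a -/b; split=> //; lra.
  - by exists (x + a, y + b); rewrite /cell /= -/a -/b; split=> //; lra.
have Ew : x0 + w / 2 ^+ 0 = x1 by rewrite expr0 divr1 /w addrC subrK.
have Eh : y0 + h / 2 ^+ 0 = y1 by rewrite expr0 divr1 /h addrC subrK.
have [next nextP] := choice step.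
pose p := fix p n := if n is m.+1 then next (m, p m) else (x0, y0).
have pB n : B / 4 ^+ n <= normc (cell n (p n)).
  elim: n => [|n IH]; last by have [] := nextP (n, p n) IH.
  by rewrite /cell [p 0%N]/= Ew Eh expr0 divr1.
have [X HX] : exists X, forall n, (p n).1 <= X <= (p n).1 + w / 2 ^+ n.
  apply: (@nested_limit (fun n => (p n).1)) => // n;
  by have [] := nextP (n, p n) (pB n).
have [Y HY] : exists Y, forall n, (p n).2 <= Y <= (p n).2 + h / 2 ^+ n.
  apply: (@nested_limit (fun n => (p n).2)) => // n;
  by have [] := nextP (n, p n) (pB n).
have dXY : derivable f (Complex X Y) 1.
  apply: df; rewrite /in_rect /=; have := HX 0%N; have := HY 0%N.
  by rewrite [p 0%N]/= Ew Eh => -> ->.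
(* the bound of [bint_small] becomes less than [B / 4 ^ n] *)
pose e := B / (8 * (w + h + 1) ^+ 2).
have e0 : 0 < e.
  by rewrite divr_gt0 // mulr_gt0 // exprn_gt0 // ltr_wpDl // addr_ge0.
have [r r0 H] := bint_small cf (derivable_cdiff dXY) e0.
have [n nr] := exp2_large (w + h) r0; rewrite mulrDl in nr.
have := le_trans (pB n) (H _ _ _ _ (HX n) (HY n) nr).
rewrite -mulrDl expr_div_n -exprM mulnC exprM -[2 ^+ 2]natrX mulrA.
rewrite ler_pM2r ?invr_gt0 ?exprn_gt0 // /e => HB; exfalso.
have k0 : 0 < (w + h + 1) ^+ 2 by rewrite exprn_gt0 // ltr_wpDl // addr_ge0.
have le1 : (w + h) ^+ 2 <= (w + h + 1) ^+ 2.
  by have := addr_ge0 w0 h0; move: (w + h) => q q0; rewrite !expr2; nra.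
have : B * (2 * (w + h + 1) ^+ 2) <= B * (w + h) ^+ 2.
  have := ler_wpM2r (ltW k0) HB.
  rewrite (_ : 4 * _ * _ * _ = B * (w + h) ^+ 2 / 2) => [h2|]; first lra.
  by field; rewrite lt0r_neq0 // ltr_wpDl // addr_ge0.
rewrite ler_pM2l //; lra.
Qed.

Lemma goursat f x0 x1 y0 y1 : continuous f ->
  (forall w, in_rect (Num.min x0 x1) (Num.max x0 x1) (Num.min y0 y1)
     (Num.max y0 y1) w -> derivable f w 1) ->
  bint f x0 x1 y0 y1 = 0.
Proof.
move=> cf; wlog x01 : x0 x1 / x0 <= x1.
  move=> H; case: (boolP (x0 <= x1)) => [/H//|]; rewrite -ltNge => /ltW x10 df.
  rewrite bintC_x; apply/eqP; rewrite oppr_eq0; apply/eqP; apply: H => // w.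
  by rewrite (minC x1) (maxC x1); exact: df.
wlog y01 : y0 y1 / y0 <= y1.
  move=> H; case: (boolP (y0 <= y1)) => [/H//|]; rewrite -ltNge => /ltW y10 df.
  rewrite bintC_y; apply/eqP; rewrite oppr_eq0; apply/eqP; apply: H => // w.
  by rewrite (minC y1) (maxC y1); exact: df.
rewrite (min_idPl x01) (max_idPr x01) (min_idPl y01) (max_idPr y01).
exact: goursat_ordered.
Qed.

(** An exceptional point at a corner is harmless: cutting off rectangles that
    avoid it leaves an arbitrarily small one, with a small boundary. *)
Lemma goursat_corner f x0 x1 y0 y1 : continuous f ->
  (forall w, w != Complex x0 y0 -> derivable f w 1) ->
  bint f x0 x1 y0 y1 = 0.
Proof.
move=> cf df; have [->|x01] := eqVneq x1 x0; first exact: bint_x0.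
have [->|y01] := eqVneq y1 y0; first exact: bint_y0.
pose p : C := Complex x0 y0; pose L := `|x1 - x0| + `|y1 - y0|.
have L0 : 0 < L by rewrite ltr_wpDr // normr_gt0 subr_eq0.
have cut (s : R) : 0 < s <= 1 -> bint f x0 x1 y0 y1 =
    bint f x0 (x0 + s * (x1 - x0)) y0 (y0 + s * (y1 - y0)).
  move=> /andP[s0 s1]; set xs := x0 + _; set ys := y0 + _.
  rewrite -(bint_chasles_x f x0 xs x1) -(bint_chasles_y f x0 xs y0 ys y1).
  rewrite [X in _ + X + _]goursat ?[X in _ + X]goursat ?addr0 //.
  - move=> w /andP[/andP[wx wx2] _]; apply: df.
    apply/eqP => E; move: wx wx2; rewrite E /= ge_min le_max /xs.
    have : x1 < x0 \/ x0 < x1 by apply/orP; rewrite -neq_lt.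
    by move=> [] h /orP[] h1 /orP[] h2; nra.
  - move=> w /andP[_ /andP[wy wy2]]; apply: df.
    apply/eqP => E; move: wy wy2; rewrite E /= ge_min le_max /ys.
    have : y1 < y0 \/ y0 < y1 by apply/orP; rewrite -neq_lt.
    by move=> [] h /orP[] h1 /orP[] h2; nra.
have [r r0 Hr] := (continuouscP f p).1 (cf p) 1 ltr01.
pose M := normc (f p) + 1.
have M0 : 0 < M by rewrite ltr_wpDl ?normc_ge0.
have [|B0] := eqVneq (normc (bint f x0 x1 y0 y1)) 0; first exact: eq0_normc.
pose B := normc (bint f x0 x1 y0 y1).
have {}B0 : 0 < B by rewrite lt_def B0 normc_ge0.
(* the small rectangle stays where [|f| <= M], and [4 * M * (s * L) < B] *)
pose s := Num.min 1 (Num.min (r / (2 * L)) (B / (8 * M * L))).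
have s0 : 0 < s by rewrite !lt_min ltr01 !divr_gt0 ?mulr_gt0.
have s1 : s <= 1 by rewrite ge_min lexx.
have sr : s * L < r.
  have : s <= r / (2 * L) by rewrite !ge_min lexx !orbT.
  rewrite ler_pdivlMr ?mulr_gt0 //; nra.
have sB : 4 * M * (s * L) < B.
  have : s <= B / (8 * M * L) by rewrite !ge_min lexx !orbT.
  rewrite ler_pdivlMr ?mulr_gt0 // => h; apply: (@lt_le_trans _ _ (8 * M * (s * L))).
    by rewrite ltr_pM2r ?mulr_gt0 // ltr_pM2r // ltr_nat.
  by rewrite (_ : 8 * M * (s * L) = s * (8 * M * L)) //; ring.
suff : B <= 4 * M * (s * L) by rewrite leNgt sB.
rewrite /B (cut s) ?s0 //.
have Hb w : on_boundary x0 (x0 + s * (x1 - x0)) y0 (y0 + s * (y1 - y0)) w ->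
    normc (f w) <= M.
  move=> ow; have wp : normc (p - w) <= s * L.
    rewrite (le_trans (normc_le_ReIm _)) // ReB ImB /=.
    have [rx ry] : `|x0 - Re w| <= s * `|x1 - x0| /\ `|y0 - Im w| <= s * `|y1 - y0|.
      have btw (u v t : R) : Num.min u (u + v) <= t <= Num.max u (u + v) ->
          `|u - t| <= `|v|.
        have [v0|v0|->] := ltgtP v 0; last first.
        - rewrite addr0 minxx maxxx -eq_le => /eqP ->.
          by rewrite subrr.
        - rewrite (min_idPl _) ?(max_idPr _) ?lerDl ?(ltW v0) // => /andP[h1 h2].
          by rewrite (gtr0_norm v0) ler0_norm; lra.
        - rewrite (min_idPr _) ?(max_idPl _) ?gerDl ?(ltW v0) // => /andP[h1 h2].
          by rewrite (ltr0_norm v0) ger0_norm; lra.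
      have sN (v : R) : s * `|v| = `|s * v| by rewrite normrM (gtr0_norm s0).
      rewrite !sN; case/orP: ow => /andP[/btw h /orP[/eqP->|/eqP->]]; split=> //;
      by rewrite ?subrr ?normr0 ?opprD ?addNKr ?normrN.
    by rewrite /L mulrDr lerD.
  have := Hr w (le_lt_trans wp sr); rewrite normc_distC => h.
  rewrite /M -lerBlDl (le_trans _ h) //.
  exact: normc_lerB.
apply: (le_trans (ler_bint (continuous_bcont _ _ _ _ cf) Hb)).
have Ek (u v : R) : u + v - u = v by ring.
by rewrite !Ek !normrM (gtr0_norm s0) -mulrDr.
Qed.

(** The lines through [z] cut the rectangle into four with a corner at [z]. *)
Lemma goursat_except f (z : C) x0 x1 y0 y1 : continuous f ->
  (forall w, w != z -> derivable f w 1) -> bint f x0 x1 y0 y1 = 0.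
Proof.
case: z => a b cf df.
have cor x y : bint f a x b y = 0 by apply: goursat_corner.
rewrite -(bint_chasles_x f x0 a x1) -!(bint_chasles_y f _ _ y0 b y1).
rewrite (bintC_x f x0) (bintC_x f x0 a b) !(bintC_y f _ _ y0 b) !cor.
by rewrite !oppr0 !addr0.
Qed.

End Goursat.

(** * Cauchy's formula on the unit square, and power series *)

Section Cauchy.
Variable R : realType.
Notation C := (R[i]^o).
Implicit Types (f g : C -> C) (z w : C).

Let sq f : C := bint f (-1) 1 (-1) 1.
Let sqcont f := bcont f (-1 : R) 1 (-1) 1.

(** Whole lines and not segments, because [cint] integrates functions that are
    defined on the whole real line. *)
Let edge w := (`|Re w| == 1) || (`|Im w| == 1).

Let eq_sq f g : (forall w, edge w -> f w = g w) -> sq f = sq g.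
Proof.
move=> fg; rewrite /sq /bint.
have hor y : `|y| == 1 ->
    (fun t : R => f (Complex t y)) = (fun t => g (Complex t y)).
  by move=> y1; apply/funext => t; apply: fg; rewrite /edge /= y1 orbT.
have ver x : `|x| == 1 ->
    (fun t : R => f (Complex x t)) = (fun t => g (Complex x t)).
  by move=> x1; apply/funext => t; apply: fg; rewrite /edge /= x1.
by rewrite !hor ?ver ?normrN ?normr1.
Qed.

Let edge_normc w : edge w -> 1 <= normc w.
Proof.
by case/orP => /eqP <-; [exact: ler_Re_normc|exact: ler_Im_normc].
Qed.

Let edge_boundary w : on_boundary (-1) 1 (-1) 1 w -> edge w.
Proof.
by rewrite /on_boundary /edge => /orP[]/andP[_ /orP[/eqP->|/eqP->]];
  rewrite ?normrN ?normr1 eqxx ?orbT.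
Qed.

Let edge_sqcont f : (forall w, edge w -> {for w, continuous f}) -> sqcont f.
Proof.
move=> cf; have N1 : `|-1 : R| == 1 by rewrite normrN normr1.
split=> t.
- apply: (continuous_comp (@continuous_hline R (-1) t)).
  by apply: cf; rewrite /edge /= N1 orbT.
- apply: (continuous_comp (@continuous_vline R 1 t)).
  by apply: cf; rewrite /edge /= normr1 eqxx.
- apply: (continuous_comp (@continuous_hline R 1 t)).
  by apply: cf; rewrite /edge /= normr1 eqxx orbT.
- apply: (continuous_comp (@continuous_vline R (-1) t)).
  by apply: cf; rewrite /edge /= N1.
Qed.

Let edge_neq z w : normc z < 1 -> edge w -> w - z != 0.
Proof.
by move=> z1 /edge_normc w1; rewrite subr_eq0; apply: contraTneq w1 => ->;
  rewrite -ltNge.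
Qed.

Let continuous_exp n : continuous (fun w : C => w ^+ n).
Proof.
elim: n => [|n IH] w; first by under eq_fun do rewrite expr0; exact: cst_continuous.
under eq_fun do rewrite exprS.
exact: (@continuousM _ _ id (fun w => w ^+ n) w (@cvg_id _ _) (IH w)).
Qed.

Let continuous_pole z w n : w - z != 0 ->
  {for w, continuous (fun w : C => (w - z) ^- n)}.
Proof.
move=> wz; apply: (@continuousV _ _ (fun w : C => (w - z) ^+ n)).
  by rewrite expf_neq0.
apply: (continuous_comp (f := fun w : C => w - z) (g := fun w => w ^+ n)).
  exact: (continuousB (@cvg_id _ _) (@cst_continuous _ _ z w)).
exact: continuous_exp.
Qed.

Let continuous_pole0 w n : w != 0 -> {for w, continuous (fun w : C => w ^- n)}.
Proof.
move=> w0; apply: (@continuousV _ _ (fun w : C => w ^+ n)).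
  by rewrite expf_neq0.
exact: continuous_exp.
Qed.

Let sqcontZ (k : C) f : sqcont f -> sqcont (fun w => k * f w).
Proof.
have cZ (u : R -> C) : continuous u -> continuous (fun t => k * u t).
  by move=> cu t; exact: (continuousM (@cst_continuous _ _ k t) (cu t)).
by move=> [f1 f2 f3 f4]; split; [exact: (cZ _ f1)|exact: (cZ _ f2)|
  exact: (cZ _ f3)|exact: (cZ _ f4)].
Qed.

Definition cauchy_kernel f z : C := sq (fun w => f w / (w - z)).
Definition cauchy_coef f n : C := sq (fun w => f w * w ^- n.+1).

Let kernel_sqcont f z n : continuous f -> normc z < 1 ->
  sqcont (fun w => f w * w ^- n / (w - z)).
Proof.
move=> cf z1; apply: edge_sqcont => w ew.
apply: (@continuousM _ _ (fun w => f w * w ^- n) (fun w => (w - z)^-1)).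
  apply: (@continuousM _ _ f (fun w => w ^- n)); first exact: cf.
  apply: continuous_pole0; rewrite -normc_gt0; exact: lt_le_trans ltr01 (edge_normc ew).
have := @continuous_pole z w 1 (edge_neq z1 ew).
have -> // : (fun w : C => (w - z) ^- 1) = (fun w => (w - z)^-1).
by apply/funext => v; rewrite expr1.
Qed.

Let coef_sqcont f n : continuous f -> sqcont (fun w => f w * w ^- n).
Proof.
move=> cf; apply: edge_sqcont => w ew.
apply: (@continuousM _ _ f (fun w => w ^- n)); first exact: cf.
apply: continuous_pole0; rewrite -normc_gt0; exact: lt_le_trans ltr01 (edge_normc ew).
Qed.

(** One step of the geometric series of [1 / (w - z)] in powers of [z / w]. *)
Let kernel_step f z n : continuous f -> normc z < 1 ->
  sq (fun w => f w * w ^- n / (w - z)) =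
  cauchy_coef f n + z * sq (fun w => f w * w ^- n.+1 / (w - z)).
Proof.
move=> cf z1.
have k1 := kernel_sqcont n.+1 cf z1; have k2 := coef_sqcont n.+1 cf.
rewrite /cauchy_coef /sq -(bintZ z k1) -(bintD k2 (sqcontZ z k1)).
rewrite -!/(sq _).
apply: eq_sq => w ew.
have w0 : w != 0 by rewrite -normc_gt0; exact: lt_le_trans ltr01 (edge_normc ew).
have wz := edge_neq z1 ew.
by rewrite exprS; field; rewrite wz w0 expf_neq0.
Qed.

Let kernel_expansion f z N : continuous f -> normc z < 1 ->
  cauchy_kernel f z = \sum_(n < N) cauchy_coef f n * z ^+ n
    + z ^+ N * sq (fun w => f w * w ^- N / (w - z)).
Proof.
move=> cf z1; elim: N => [|N ->].
  rewrite big_ord0 add0r expr0 mul1r; congr (sq _).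
  by apply/funext => w; rewrite expr0 invr1 mulr1.
by rewrite big_ord_recr /= kernel_step // exprSr; ring.
Qed.

Let continuous_bounded (u : R -> C) a b : continuous u -> a <= b ->
  exists M, forall t, a <= t <= b -> normc (u t) <= M.
Proof.
move=> cu ab; pose n t := normc (u t).
have cn : continuous n.
  move=> t; apply/cvgrPdist_le => e e0.
  have /cvgcP/(_ e e0) := cu t; apply: filterS => s /= h.
  rewrite ler_norml lerNl opprB (le_trans (normc_lerB _ _) h) andbT.
  by rewrite (le_trans (normc_lerB _ _)) // normc_distC.
have [c _ H] := EVT_max ab (continuous_subspaceT cn).
by exists (n c) => t tab; apply: H; rewrite in_itv.
Qed.

Let boundary_bounded f : continuous f -> exists2 M, 0 <= M & forall w,
  on_boundary (-1) 1 (-1) 1 w -> normc (f w) <= M.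
Proof.
move=> cf; have [h1 h2 h3 h4] := continuous_bcont (-1) 1 (-1) 1 cf.
have N1 : -1 <= 1 :> R by lra.
have [M1 H1] := continuous_bounded h1 N1; have [M2 H2] := continuous_bounded h2 N1.
have [M3 H3] := continuous_bounded h3 N1; have [M4 H4] := continuous_bounded h4 N1.
have Mge0 (M : R) (u : R -> C) : (forall t, -1 <= t <= 1 -> normc (u t) <= M) -> 0 <= M.
  by move=> /(_ 0) H; apply: le_trans (normc_ge0 _) (H _); lra.
have m1 := Mge0 _ _ H1; have m2 := Mge0 _ _ H2.
have m3 := Mge0 _ _ H3; have m4 := Mge0 _ _ H4.
exists (M1 + M2 + M3 + M4); first by rewrite !addr_ge0.
case=> x y; rewrite /on_boundary /= (min_idPl N1) (max_idPr N1).
case/orP => /andP[h /orP[]/eqP->].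
- by rewrite (le_trans (H1 _ h)) //; lra.
- by rewrite (le_trans (H3 _ h)) //; lra.
- by rewrite (le_trans (H4 _ h)) //; lra.
- by rewrite (le_trans (H2 _ h)) //; lra.
Qed.

Let kernel_remainder f : continuous f -> exists2 M, 0 <= M & forall z N,
  normc z < 1 ->
  normc (cauchy_kernel f z - \sum_(n < N) cauchy_coef f n * z ^+ n)
    <= M / (1 - normc z) * normc z ^+ N.
Proof.
move=> cf; have [M M0 HM] := boundary_bounded cf.
exists (16 * M) => [|z N z1]; first by rewrite mulr_ge0.
rewrite (@kernel_expansion f z N) // addrC addKr normcM normcX mulrC.
rewrite ler_wpM2r ?exprn_ge0 ?normc_ge0 //.
have Hb w : on_boundary (-1) 1 (-1) 1 w ->
    normc (f w * w ^- N / (w - z)) <= M / (1 - normc z).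
  move=> ow; have w1 := edge_normc (edge_boundary ow).
  rewrite 2!normcM !normcV normcX ler_pM ?mulr_ge0 ?invr_ge0 ?exprn_ge0 ?normc_ge0 //.
    rewrite -[leRHS]mulr1 ler_pM ?HM ?invr_ge0 ?exprn_ge0 ?normc_ge0 //.
    by rewrite invf_le1 ?exprn_ege1 // exprn_gt0 // (lt_le_trans ltr01).
  have l1 := normc_lerB w z.
  by rewrite lef_pV2 ?posrE ?subr_gt0 // ?(lt_le_trans _ l1); lra.
rewrite (le_trans (ler_bint (kernel_sqcont N cf z1) Hb)) //.
rewrite opprK ger0_norm //.
have: 0 <= M / (1 - normc z) by rewrite divr_ge0 // subr_ge0 ltW.
by rewrite -(mulrA 16); move: (M / _) => q; lra.
Qed.

(** By Goursat's theorem for the difference quotient of [f] at [z], which is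
    continuous at [z] although its derivative there is not known to exist. *)
Let cauchy_formula f z : entire f -> normc z < 1 ->
  cauchy_kernel f z = f z * cauchy_kernel (fun=> 1) z.
Proof.
move=> ef z1; have cf := entire_continuous ef.
pose phi w := if w == z then derive1 f z else (f w - f z) / (w - z).
have phi_near w : w != z -> \forall v \near w, (f v - f z) / (v - z) = phi v.
  move=> wz; apply/nbhscP; exists (normc (w - z)); first by rewrite normc_gt0 subr_eq0.
  move=> v vw; rewrite /phi ifN //; apply: contraTneq vw => ->.
  by rewrite ltxx.
have dphi w : w != z -> derivable phi w 1.
  move=> wz; apply: near_eq_derivable (phi_near w wz) _ => //.
  apply: (@derivableM _ _ (fun w => f w - f z) (fun w => (w - z)^-1)).
    apply: (@derivableB _ _ _ f (cst (f z))); first exact: ef.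
    exact: derivable_cst.
  apply: derivableV; first by rewrite subr_eq0.
  apply: (@derivableB _ _ _ id (cst z)); first exact: derivable_id.
  exact: derivable_cst.
have cphi : continuous phi.
  move=> w; have [->|wz] := eqVneq w z; last first.
    exact/differentiable_continuous/derivable1_diffP/dphi.
  apply/continuouscP => e e0; have [r r0 H] := derivable_cdiff (ef z) e0.
  exists r => // v vz; rewrite /phi eqxx; case: eqVneq => [_|nvz].
    by rewrite subrr normc0 ltW.
  have n0 : 0 < normc (v - z) by rewrite normc_gt0 subr_eq0.
  have vzr : normc (v - z) <= r by rewrite normc_distC ltW.
  have := H _ vzr; rewrite addrCA subrr addr0 => Hv.
  have vz0 : v - z != 0 by rewrite subr_eq0.
  have E : (derive1 f z - (f v - f z) / (v - z)) * (v - z)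
      = - (f v - f z - derive1 f z * (v - z)) by rewrite mulrBl divfK // !opprB.
  by rewrite -(ler_pM2r n0) -normcM E normcN.
have E : sq phi = 0 by apply: (goursat_except (z := z)) => //; exact: dphi.
have k1 := kernel_sqcont 0 cf z1.
have k2 := kernel_sqcont 0 (@cst_continuous _ _ (1 : C)) z1.
have kN := sqcontZ (- f z) k2.
have : sq (fun w => f w * w ^- 0 / (w - z) + - f z * (1 * w ^- 0 / (w - z))) = 0.
  transitivity (sq phi); last exact: E.
  apply: eq_sq => w ew; have wz := edge_neq z1 ew.
  have wz' : w != z by rewrite -subr_eq0.
  rewrite /phi (negbTE wz') expr0 invr1 !mulr1 mul1r mulrBl.
  by rewrite mulNr.
rewrite /sq (bintD k1 kN) (bintZ _ k2) mulNr => /eqP; rewrite subr_eq0 => /eqP.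
have s1 g : sq (fun w => g w * w ^- 0 / (w - z)) = cauchy_kernel g z.
  by congr (sq _); apply/funext => w; rewrite expr0 invr1 mulr1.
by rewrite -!/(sq _) (s1 f) (s1 (fun=> 1)).
Qed.

Let cdiff_pole n w : w != 0 -> cdiff (fun w => - n.+1%:R^-1 * w ^- n.+1) w (w ^- n.+2).
Proof.
move=> w0; apply/cdiffP.
have dX : is_derive w 1 (fun v : C => v ^+ n.+1) (n.+1%:R * w ^+ n).
  have := @is_deriveX _ _ id n.+1 w 1 1 (is_derive_id _ _).
  by rewrite exprfctE -[(_ *: 1)]/(_ * 1) mulr1 => h; exact: h.
have wn0 : w ^+ n.+1 != 0 by rewrite expf_neq0.
pose X (v : C) : C := v ^+ n.+1.
have dXw : derivable X w 1 by case: dX.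
have XV : derivable (fun v : C => (X v)^-1) w 1 by exact: (@derivableV _ _ X w 1 wn0 dXw).
have DV : 'D_1 (fun v : C => (X v)^-1) w = - X w ^- 2 *: (n.+1%:R * w ^+ n).
  by rewrite (@deriveV _ _ X w 1 wn0 dXw); case: dX => _ <-.
have dV := DeriveDef XV DV.
have := @is_deriveM _ _ (cst (- n.+1%:R^-1)) _ _ _ _ _ (is_derive_cst _ _ _) dV.
rewrite scaler0 addr0 => h; apply: is_derive_eq.
rewrite -![_ *: _]/(_ * _) /= /X (exprS w n.+1) !(exprS w n).
have w1 : w ^+ n != 0 by rewrite expf_neq0.
by field; rewrite w0 w1 /= -[1]/(1%:R) -natrD pnatr_eq0.
Qed.

Let coef1_gt0 n : (0 < n)%N -> cauchy_coef (fun=> 1) n = 0.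
Proof.
case: n => // n _; rewrite /cauchy_coef.
have c := coef_sqcont n.+2 (@cst_continuous _ _ (1 : C)).
apply: (bint_primitive (Q := fun w => - n.+1%:R^-1 * w ^- n.+1)) => // w ow.
rewrite mul1r; apply: cdiff_pole; rewrite -normc_gt0.
exact: lt_le_trans ltr01 (edge_normc (edge_boundary ow)).
Qed.

(** Each edge contributes the integral of [1 / (1 + t ^ 2)] to the imaginary
    part, so the constant of Cauchy's formula does not vanish. *)
Let coef1_0 : cauchy_coef (fun=> 1) 0 != 0.
Proof.
have [c1 c2 c3 c4] := coef_sqcont 1 (@cst_continuous _ _ (1 : C)).
have N1 : -1 < 1 :> R by lra.
have ImV (x y : R) : Im (1 * Complex x y ^- 1 : C) = - y / (x ^+ 2 + y ^+ 2).
  by rewrite mul1r expr1 /= mulNr.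
have ReV (x y : R) : Re (1 * Complex x y ^- 1 : C) = x / (x ^+ 2 + y ^+ 2).
  by rewrite mul1r expr1 /=.
have pos (t y : R) : y ^+ 2 = 1 -> 0 < t ^+ 2 + y ^+ 2.
  by move=> ->; rewrite ltr_wpDl // sqr_ge0.
have lt0 (u : R -> R) : continuous u -> (forall t, u t < 0) -> rint u (-1) 1 < 0.
  move=> cu u0; have cNu : continuous (fun t => -1 * u t).
    by move=> t; exact: (continuousM (@cst_continuous _ _ _ t) (cu t)).
  have := rint_gt0 cNu N1; rewrite rintZ // mulN1r oppr_gt0; apply=> t _.
  by rewrite mulN1r oppr_gt0.
have b1 : 0 < Im (cint (fun t => 1 * Complex t (-1) ^- 1 : C) (-1) 1).
  apply: (rint_gt0 (continuous_Im c1) N1) => t _.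
  by rewrite ImV opprK divr_gt0 // pos // sqrrN expr1n.
have b2 : 0 < Re (cint (fun t => 1 * Complex 1 t ^- 1 : C) (-1) 1).
  apply: (rint_gt0 (continuous_Re c2) N1) => t _.
  by rewrite ReV divr_gt0 // addrC pos // expr1n.
have b3 : Im (cint (fun t => 1 * Complex t 1 ^- 1 : C) (-1) 1) < 0.
  apply: (lt0 _ (continuous_Im c3)) => t.
  by rewrite ImV mulNr oppr_lt0 divr_gt0 // pos // expr1n.
have b4 : Re (cint (fun t => 1 * Complex (-1) t ^- 1 : C) (-1) 1) < 0.
  apply: (lt0 _ (continuous_Re c4)) => t.
  by rewrite ReV mulNr oppr_lt0 divr_gt0 // addrC pos // sqrrN expr1n.
suff : 0 < Im (cauchy_coef (fun=> 1) 0) by apply: contraTneq => ->; rewrite /= ltxx.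
rewrite /cauchy_coef /sq /bint !(ImB, ImD) !(ImM 'i%C).
move: b1 b2 b3 b4; move: (cint _ _ _) (cint _ _ _) (cint _ _ _) (cint _ _ _).
by move=> q1 q2 q3 q4 /=; lra.
Qed.

Let kernel1 z : normc z < 1 -> cauchy_kernel (fun=> 1) z = cauchy_coef (fun=> 1) 0.
Proof.
move=> z1; have [M M0 H] := kernel_remainder (@cst_continuous _ _ (1 : C)).
apply/eqP; rewrite -subr_eq0; apply/eqP/eq0_normc; apply/eqP.
rewrite eq_le normc_ge0 andbT; apply/ler_addgt0Pl => e e0; rewrite addr0.
pose K := M / (1 - normc z).
have K0 : 0 <= K by rewrite divr_ge0 // subr_ge0 ltW.
have [N] : exists N, normc z ^+ N.+1 <= e / (K + 1).
  have c0 : (fun n => normc z ^+ n.+1) @ \oo --> (0 : R).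
    have := @cvg_expr R (normc z); rewrite ger0_norm ?normc_ge0 // => /(_ z1).
    by rewrite -(@cvg_shiftS _ (fun n => normc z ^+ n)).
  have eK : 0 < e / (K + 1) by rewrite divr_gt0 // ltr_wpDl.
  have [N _ /(_ N (leqnn N)) /=] := (cvgrPdist_le _ _).1 c0 _ eK.
  by rewrite sub0r normrN ger0_norm ?exprn_ge0 ?normc_ge0 // => h; exists N.
rewrite ler_pdivlMr ?ltr_wpDl // => h.
have S : \sum_(n < N.+1) cauchy_coef (fun=> 1) n * z ^+ n = cauchy_coef (fun=> 1) 0.
  rewrite big_ord_recl big1 ?addr0; first by rewrite expr0 mulr1.
  by move=> i _; rewrite coef1_gt0 ?mul0r.
have := H z N.+1 z1; rewrite S.
move=> h2; rewrite (le_trans h2) // -/K (le_trans _ h) // mulrC ler_wpM2l //.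
  by rewrite exprn_ge0 ?normc_ge0.
by rewrite lerDl.
Qed.

Lemma entire_power_series_disc f : entire f -> exists (c : nat -> C) M,
  [/\ 0 <= M, forall n, normc (c n) <= M & forall z N, normc z < 1 ->
    normc (f z - \sum_(n < N) c n * z ^+ n) <= M / (1 - normc z) * normc z ^+ N].
Proof.
move=> ef; have cf := entire_continuous ef.
pose k := cauchy_coef (fun=> 1) 0; have k0 : 0 < normc k by rewrite normc_gt0 coef1_0.
have [M M0 HM] := kernel_remainder cf.
have [M' M0' HM'] := boundary_bounded cf.
exists (fun n => cauchy_coef f n / k), ((M + 16 * M') / normc k); split.
- by rewrite divr_ge0 ?addr_ge0 ?mulr_ge0 ?(ltW k0).
- move=> n; rewrite normcM normcV ler_pM2r ?invr_gt0 //.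
  have Hb w : on_boundary (-1) 1 (-1) 1 w -> normc (f w * w ^- n.+1) <= M'.
    move=> ow; have w1 := edge_normc (edge_boundary ow).
    rewrite normcM normcV normcX -[leRHS]mulr1.
    rewrite ler_pM ?HM' ?invr_ge0 ?exprn_ge0 ?normc_ge0 //.
    by rewrite invf_le1 ?exprn_ege1 // exprn_gt0 // (lt_le_trans ltr01).
  rewrite (le_trans (ler_bint (coef_sqcont n.+1 cf) Hb)) //.
  by rewrite opprK ger0_norm //; lra.
- move=> z N z1.
  have -> : f z - \sum_(n < N) cauchy_coef f n / k * z ^+ n =
      (cauchy_kernel f z - \sum_(n < N) cauchy_coef f n * z ^+ n) / k.
    rewrite cauchy_formula // kernel1 // -/k mulrBl mulfK -?normc_gt0 // mulr_suml.
    by congr (_ - _); apply: eq_bigr => i _; rewrite mulrAC.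
  rewrite normcM normcV ler_pdivrMr // (le_trans (HM z N z1)) //.
  rewrite [leRHS](_ : _ = (M + 16 * M') / (1 - normc z) * normc z ^+ N).
    by rewrite !ler_wpM2r ?exprn_ge0 ?normc_ge0 ?invr_ge0 ?subr_ge0 ?(ltW z1) // lerDl mulr_ge0.
  have z10 : 1 - normc z != 0 by rewrite subr_eq0 gt_eqF.
  by field; rewrite z10 gt_eqF.
Qed.

End Cauchy.

(** * Entire functions as power series *)

Section PowerSeries.
Variable R : realType.
Notation C := (R[i]^o).
Implicit Types (f g : C -> C) (z w : C) (c : nat -> C).

Lemma primitive_root_exists n : (0 < n)%N -> exists w : R[i], n.-primitive_root w.
Proof.
move=> n_gt0; pose p : {poly R[i]} := 'X^n - 1.
have [r Dp] := closed_field_poly_normal p.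
move: Dp; rewrite (monicP _) ?monicXnsubC // scale1r => Dp.
have rn1 : all n.-unity_root r by apply/allP => z; rewrite -root_prod_XsubC -Dp.
have sz_r : (n < (size r).+1)%N by rewrite -(size_prod_XsubC r id) -Dp size_XnsubC.
have [|z] := hasP (has_prim_root n_gt0 rn1 _ sz_r); last by exists z.
by rewrite -separable_prod_XsubC -Dp separable_Xn_sub_1 // pnatr_eq0 -lt0n.
Qed.

Lemma normc_root_of_unity n w : (0 < n)%N -> w ^+ n = 1 -> normc w = 1.
Proof.
move=> n0 wn; have : normc w ^+ n == 1 by rewrite -normcX wn normc1.
by rewrite pexprn_eq1 ?normc_ge0 // eqn0Ngt n0 => /eqP.
Qed.

(** This is how the number of terms of a series is sent to infinity, the
    remainders being geometric. *)
Lemma ler_geometric (a b m : R) :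
  (exists N0, forall N, (N0 <= N)%N -> a <= b + m / 2 ^+ N) -> a <= b.
Proof.
move=> [N0 H]; apply/ler_addgt0Pr => e e0.
have [n ne] := exp2_large `|m| e0.
have := H (N0 + n)%N (leq_addr _ _); move/le_trans; apply.
rewrite lerD2l (le_trans _ ne) // (le_trans (y := `|m| / 2 ^+ (N0 + n))) //.
  by rewrite ler_wpM2r ?ler_norm // invr_ge0 exprn_ge0.
rewrite ler_wpM2l // lef_pV2 ?posrE ?exprn_gt0 //.
by rewrite ler_weXn2l ?ler1n // leq_addl.
Qed.

(** Averaging over the [N]-th roots of unity kills every monomial of degree
    below [N] but the chosen one, and an average is at most the maximum. *)
Lemma cauchy_estimate_series F c (r K B : R) (n : nat) : 0 <= r ->
  (forall z N, normc z = r -> normc (F z - \sum_(k < N) c k * z ^+ k) <= K / 2 ^+ N) ->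
  (forall z, normc z = r -> normc (F z) <= B) ->
  normc (c n) * r ^+ n <= B.
Proof.
move=> r0 HK HB; apply: (@ler_geometric _ _ K); exists n.+1 => N nN.
have N0 : (0 < N)%N by rewrite (leq_ltn_trans _ nN).
have [w pw] := primitive_root_exists N0.
have w1 : normc w = 1 := normc_root_of_unity N0 (prim_expr_order pw).
have wne0 : w != 0 by rewrite -normc_gt0 w1.
pose x j : C := r%:C%C * w ^+ j.
have xr j : normc (x j) = r.
  by rewrite normcM normcX w1 expr1n mulr1 normc_real ger0_norm.
have sumw k : (k < N)%N -> \sum_(j < N) (w ^+ k / w ^+ n) ^+ j = (k == n)%:R * N%:R :> C.
  move=> kN; have [->|kn] := eqVneq k n.
    rewrite divff ?expf_neq0 // mul1r (eq_bigr (fun=> 1)) => [|i _]; last by rewrite expr1n.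
    by rewrite sumr_const card_ord.
  rewrite mul0r; have q1 : w ^+ k / w ^+ n - 1 != 0.
    rewrite subr_eq0; apply: contra kn => /eqP E.
    have : w ^+ k == w ^+ n by rewrite -[X in X == _](divfK (expf_neq0 n wne0)) E mul1r.
    by rewrite (eq_prim_root_expr pw) !modn_small.
  apply: (mulfI q1); rewrite mulr0 -subrX1 expr_div_n -!exprM mulnC exprM.
  by rewrite (prim_expr_order pw) mulnC exprM (prim_expr_order pw) !expr1n divr1 subrr.
pose A : C := \sum_(j < N) F (x j) * w ^- (n * j).
pose S : C := \sum_(j < N) (\sum_(k < N) c k * x j ^+ k) * w ^- (n * j).
have SE : S = c n * (r%:C%C) ^+ n * N%:R.
  rewrite /S; under eq_bigr do rewrite mulr_suml.
  rewrite exchange_big /=.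
  rewrite (eq_bigr (fun k : 'I_N => c k * (r%:C%C) ^+ k * ((k : nat) == n)%:R * N%:R)).
    rewrite -mulr_suml; congr (_ * _).
    rewrite (bigD1 (Ordinal nN)) //= eqxx mulr1 big1 ?addr0 // => i.
    by rewrite -val_eqE /= => /negbTE ->; rewrite mulr0.
  move=> k _; rewrite -[RHS]mulrA -sumw // mulr_sumr; apply: eq_bigr => j _.
  by rewrite /x exprMn expr_div_n -!exprM (mulnC j k) !mulrA.
have AB : normc A <= N%:R * B.
  rewrite (le_trans (normc_sum _ _ _)) // mulr_natl -[X in _ *+ X]card_ord -sumr_const.
  apply: ler_sum => j _; rewrite normcM normcV normcX w1 expr1n invr1 mulr1.
  exact: HB.
have AS : normc (A - S) <= N%:R * (K / 2 ^+ N).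
  rewrite /A /S -sumrB (le_trans (normc_sum _ _ _)) // mulr_natl.
  rewrite -[X in _ *+ X]card_ord -sumr_const.
  apply: ler_sum => j _; rewrite -mulrBl normcM normcV normcX w1 expr1n invr1 mulr1.
  exact: HK.
have : normc S <= N%:R * (B + K / 2 ^+ N).
  rewrite mulrDr (_ : S = A - (A - S)); last by ring.
  by rewrite (le_trans (normcB _ _)) // lerD.
rewrite SE 2!normcM normc_nat normcX normc_real ger0_norm // mulrC.
by rewrite ler_pM2l // ltr0n.
Qed.

Definition entire_seq c :=
  forall s : R, 0 < s -> exists M, forall n, normc (c n) * s ^+ n <= M.

(** The speed of convergence is part of the definition, so that estimates of
    partial sums pass to the sum by [ler_geometric]. *)
Definition has_series f c :=
  forall s : R, 0 < s -> exists M, forall z N, normc z <= s ->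
    normc (f z - \sum_(k < N) c k * z ^+ k) <= M / 2 ^+ N.

Lemma scale_entire f (s : C) : entire f -> entire (fun z => f (s * z)).
Proof.
move=> ef z; have df := derivable_cdiff (ef (s * z)).
apply: (@cdiff_derivable _ _ _ (s * derive1 f (s * z))) => e e0.
have s0 : 0 < normc s + 1 by rewrite ltr_wpDl ?normc_ge0.
have [r r0 H] := df (e / (normc s + 1)) (divr_gt0 e0 s0).
exists (r / (normc s + 1)) => [|h hr]; first exact: divr_gt0.
have sh : normc (s * h) <= (normc s + 1) * normc h.
  by rewrite normcM ler_wpM2r ?normc_ge0 // lerDl.
have shr : normc (s * h) <= r.
  by rewrite (le_trans sh) // mulrC -ler_pdivlMr.
rewrite mulrDr (_ : s * _ * h = derive1 f (s * z) * (s * h)); last by ring.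
rewrite (le_trans (H _ shr)) //.
by rewrite -mulrA ler_wpM2l ?(ltW e0) // ler_pdivrMl.
Qed.

Lemma shift_cdiff f z w d : cdiff f (z + w) d -> cdiff (fun v => f (z + v)) w d.
Proof. by move=> H e /H[r r0 {}H]; exists r => // h /H; rewrite addrA. Qed.

Lemma shift_entire f z : entire f -> entire (fun w => f (z + w)).
Proof. by move=> ef w; apply/cdiff_derivable/shift_cdiff/derivable_cdiff/ef. Qed.

Lemma half_lt1 : 2^-1 < 1 :> R. Proof. by rewrite invf_lt1 ?ltr1n. Qed.

(** The expansions of [f (s * z)] in the unit disc for all [s] fit together,
    since the coefficients of a power series are unique. *)
Lemma entire_has_series f : entire f ->
  exists2 c, entire_seq c & has_series f c.
Proof.
move=> ef; have [c [M [M0 cM Hf]]] := entire_power_series_disc ef.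
have half (g : C -> C) (a : nat -> C) (L : R) z N : 0 <= L -> normc z <= 2^-1 ->
    (forall z N, normc z < 1 ->
    normc (g z - \sum_(n < N) a n * z ^+ n) <= L / (1 - normc z) * normc z ^+ N) ->
    normc (g z - \sum_(n < N) a n * z ^+ n) <= (2 * L) / 2 ^+ N.
  move=> L0 z2 H; have z1 := le_lt_trans z2 half_lt1.
  rewrite (le_trans (H z N z1)) // ler_pM ?exprn_ge0 ?normc_ge0 //.
  - by rewrite divr_ge0 // subr_ge0 ltW.
  - rewrite mulrC ler_wpM2r // -[leRHS]invrK lef_pV2 ?posrE ?subr_gt0 //; lra.
  - by rewrite -exprVn lerXn2r ?nnegrE ?normc_ge0.
have scaled (s : R) : 0 < s -> exists M', [/\ 0 <= M',
    forall n, normc (c n) * s ^+ n <= M' &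
    forall z N, normc z < 1 ->
    normc (f (s%:C%C * z) - \sum_(n < N) c n * (s%:C%C * z) ^+ n)
    <= M' / (1 - normc z) * normc z ^+ N].
  move=> s0; have [c' [M' [M'0 cM' Hf']]] :=
    entire_power_series_disc (@scale_entire f s%:C%C ef).
  have cc n : c' n = c n * s%:C%C ^+ n.
    apply/eqP; rewrite -subr_eq0; apply/eqP/eq0_normc.
    (* both expansions hold at [z] and [s * z] when [|z| = r] *)
    pose r := (2 * (s + 1))^-1.
    have r0 : 0 < r by rewrite invr_gt0 mulr_gt0 // addr_gt0.
    have r2 : r <= 2^-1.
      by rewrite lef_pV2 ?posrE ?mulr_gt0 ?addr_gt0 // ler_pMr //; lra.
    have rs : s * r <= 2^-1.
      by rewrite /r invfM mulrCA ler_piMr // ler_pdivrMr ?mul1r ?addr_gt0 //; lra.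
    apply/eqP; rewrite eq_le normc_ge0 andbT -(@ler_pM2r _ (r ^+ n)) ?exprn_gt0 // mul0r.
    apply: (@cauchy_estimate_series (fun=> 0) (fun n => c' n - c n * s%:C%C ^+ n) r
      (2 * M + 2 * M') 0 n (ltW r0)) => [z N zr|z _]; last by rewrite normc0.
    have zh : normc z <= 2^-1 by rewrite zr.
    have szh : normc (s%:C%C * z) <= 2^-1.
      by rewrite normcM normc_real (gtr0_norm s0) zr.
    have h1 := half _ _ _ _ N M0 szh Hf.
    have h2 := half _ _ _ _ N M'0 zh Hf'.
    have -> : 0 - \sum_(k < N) (c' k - c k * s%:C%C ^+ k) * z ^+ k =
      (f (s%:C%C * z) - \sum_(n < N) c' n * z ^+ n) -
      (f (s%:C%C * z) - \sum_(n < N) c n * (s%:C%C * z) ^+ n).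
      rewrite opprB [RHS]addrC addrA subrK sub0r -sumrB -sumrN.
      by apply: eq_bigr => i _; rewrite exprMn; ring.
    by rewrite (le_trans (normcB _ _)) // mulrDl addrC lerD.
  exists M'; split=> // [n|z N z1].
    by have := cM' n; rewrite cc normcM normcX normc_real gtr0_norm.
  have := Hf' z N z1; congr (normc (_ - _) <= _); apply: eq_bigr => i _.
  by rewrite cc exprMn mulrA.
exists c => s s0.
  by have [M' [_ H _]] := scaled s s0; exists M'.
have s20 : 0 < 2 * s by rewrite mulr_gt0.
have [M' [M'0 _ H]] := scaled (2 * s) s20; exists (2 * M') => z N zs.
pose w : C := z / (2 * s)%:C%C.
have s2n0 : (2 * s)%:C%C != 0 :> C by rewrite -normc_gt0 normc_real normr_gt0 gt_eqF.
have zw : z = (2 * s)%:C%C * w by rewrite /w mulrCA mulfV // mulr1.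
have w2 : normc w <= 2^-1.
  rewrite normcM normcV normc_real (gtr0_norm s20) ler_pdivrMr //.
  by rewrite mulrA mulVf // mul1r.
have := @half (fun w => f ((2 * s)%:C%C * w)) (fun n => c n * (2 * s)%:C%C ^+ n) M' w N M'0 w2.
have E (v : C) n : \sum_(k < n) c k * (2 * s)%:C%C ^+ k * v ^+ k
    = \sum_(k < n) c k * ((2 * s)%:C%C * v) ^+ k.
  by apply: eq_bigr => i _; rewrite exprMn mulrA.
rewrite E -zw; apply=> v n v1; rewrite E; exact: H.
Qed.

Lemma has_series_estimate f c (r B : R) n : has_series f c -> 0 < r ->
  (forall z, normc z = r -> normc (f z) <= B) -> normc (c n) * r ^+ n <= B.
Proof.
move=> sf r0; have [M H] := sf r r0; apply: cauchy_estimate_series (ltW r0) _ => z N zr.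
by apply: H; rewrite zr.
Qed.

Lemma has_series0 f c : has_series f c -> f 0 = c 0%N.
Proof.
move=> /(_ 1 ltr01)[M H]; apply/eqP; rewrite -subr_eq0; apply/eqP/eq0_normc.
apply/eqP; rewrite eq_le normc_ge0 andbT; apply: (@ler_geometric _ _ M).
exists 1%N => -[//|N] _; rewrite add0r.
have := H 0 N.+1; rewrite normc0 ler01 => /(_ isT).
rewrite big_ord_recl big1 ?addr0 ?expr0 ?mulr1 // => i _.
by rewrite /= expr0n mulr0.
Qed.

Lemma cauchy_limit (u : nat -> C) (M : R) : 0 <= M ->
  (forall n, normc (u n.+1 - u n) <= M / 2 ^+ n) ->
  exists l, forall n, normc (l - u n) <= 4 * M / 2 ^+ n.
Proof.
move=> M0 H.
have real (x : nat -> R) : (forall n, `|x n.+1 - x n| <= M / 2 ^+ n) ->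
    exists X, forall n, `|X - x n| <= 2 * M / 2 ^+ n.
  move=> Hx; have h n : M / 2 ^+ n.+1 = M / 2 ^+ n / 2.
    by rewrite exprS invfM; field; rewrite expf_neq0.
  have [||//|X HX] := @nested_limit R (fun n => x n - 2 * (M / 2 ^+ n)) (4 * M).
  - move=> n; have := Hx n; rewrite ler_norml => /andP[]; rewrite h; lra.
  - move=> n; have := Hx n; rewrite ler_norml -!(mulrA 4) => /andP[]; rewrite h; lra.
  - by rewrite mulr_ge0.
  exists X => n; have /andP[] := HX n; rewrite -!mulrA ler_norml => h1 h2.
  by apply/andP; split; lra.
have [X HX] : exists X, forall n, `|X - Re (u n)| <= 2 * M / 2 ^+ n.
  by apply: real => n; rewrite -ReB (le_trans (ler_Re_normc _)).
have [Y HY] : exists Y, forall n, `|Y - Im (u n)| <= 2 * M / 2 ^+ n.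
  by apply: real => n; rewrite -ImB (le_trans (ler_Im_normc _)).
exists (Complex X Y) => n; rewrite (le_trans (normc_le_ReIm _)) // ReB ImB /=.
by have := HX n; have := HY n; rewrite -!mulrA; lra.
Qed.

Lemma series_exists c : entire_seq c -> exists f, has_series f c.
Proof.
move=> ec; pose S z N : C := \sum_(k < N) c k * z ^+ k.
have incr (s : R) : 0 < s -> exists2 M, 0 <= M & forall z n, normc z <= s ->
    normc (S z n.+1 - S z n) <= M / 2 ^+ n.
  move=> s0; have s20 : 0 < 2 * s by rewrite mulr_gt0.
  have [M HM] := ec (2 * s) s20.
  exists M => [|z n zs].
    by apply: le_trans (HM 0%N); rewrite mulr_ge0 ?normc_ge0 ?exprn_ge0 ?ltW.
  rewrite /S big_ord_recr /= [X in normc X]addrAC subrr add0r normcM normcX.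
  rewrite ler_pdivlMr ?exprn_gt0 //.
  rewrite (le_trans _ (HM n)) // -mulrA ler_wpM2l ?normc_ge0 // -exprMn.
  by rewrite lerXn2r ?nnegrE ?mulr_ge0 ?normc_ge0 ?(ltW s0) // mulrC ler_wpM2l.
have : forall z, exists l : C, exists M : R, forall n, normc (l - S z n) <= M / 2 ^+ n.
  move=> z; have z0 : 0 < normc z + 1 by rewrite ltr_wpDl ?normc_ge0.
  have [M M0 H] := incr _ z0.
  have [n|l Hl] := @cauchy_limit (S z) M M0; last by exists l, (4 * M).
  by apply: H; rewrite lerDl.
move=> /choice[f Hf]; exists f => s s0; have [M M0 H] := incr s s0.
exists (4 * M) => z N zs; have [K HK] := Hf z.
have [n|l Hl] := @cauchy_limit (S z) M M0; first exact: H.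
suff -> : f z = l by exact: Hl.
apply/eqP; rewrite -subr_eq0; apply/eqP/eq0_normc.
apply/eqP; rewrite eq_le normc_ge0 andbT; apply: (@ler_geometric _ _ (K + 4 * M)).
exists 0%N => n _; rewrite add0r (_ : f z - l = (f z - S z n) - (l - S z n)).
  by rewrite (le_trans (normcB _ _)) // mulrDl lerD.
by ring.
Qed.

Definition deriv_seq c n : C := n.+1%:R * c n.+1.

Lemma leq_natr_exp2 n : n%:R <= 2 ^+ n :> R.
Proof. by rewrite -natrX ler_nat ltnW // ltn_expl. Qed.

Lemma deriv_seq_entire c : entire_seq c -> entire_seq (deriv_seq c).
Proof.
move=> ec s s0; have s20 : 0 < 2 * s by rewrite mulr_gt0.
have [M HM] := ec (2 * s) s20; exists (M / s) => n.
rewrite ler_pdivlMr // -mulrA -exprSr /deriv_seq normcM normc_nat.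
rewrite (le_trans _ (HM n.+1)) // exprMn mulrA.
rewrite ler_wpM2r ?exprn_ge0 ?(ltW s0) // mulrC ler_wpM2l ?normc_ge0 //.
exact: leq_natr_exp2.
Qed.

(** The crude power of [|z| + 2] serves because the coefficients decrease faster
    than any geometric sequence. *)
Lemma ler_taylor2 z w n : normc w <= 1 ->
  normc ((z + w) ^+ n - z ^+ n - n%:R * w * z ^+ n.-1)
    <= normc w ^+ 2 * (normc z + 2) ^+ n.
Proof.
move=> w1; have bern (a : R) m : 0 <= a -> m%:R * a ^+ m.-1 <= (a + 1) ^+ m.
  move=> a0; elim: m => [|[|m] IH].
  - by rewrite mul0r expr0.
  - by rewrite /= expr0 mulr1 expr1 lerDr.
  - have -> : m.+2%:R * a ^+ m.+2.-1 = a * (m.+1%:R * a ^+ m.+1.-1) + a ^+ m.+1.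
      by rewrite -natr1 /= exprS; ring.
    rewrite [leRHS]exprS mulrDl mul1r.
    by rewrite lerD ?ler_wpM2l // lerXn2r ?nnegrE ?addr_ge0 // lerDl.
elim: n => [|n IH].
  by rewrite !expr0 subrr mul0r mul0r subr0 normc0 mulr1 exprn_ge0 ?normc_ge0.
have -> : (z + w) ^+ n.+1 - z ^+ n.+1 - n.+1%:R * w * z ^+ n.+1.-1 =
   (z + w) * ((z + w) ^+ n - z ^+ n - n%:R * w * z ^+ n.-1)
   + w ^+ 2 * (n%:R * z ^+ n.-1).
  case: n {IH} => [|n] /=; first by rewrite !expr0 expr1; ring.
  by rewrite -natr1 !exprS; ring.
have a0 := normc_ge0 z.
rewrite (le_trans (normcD _ _)) // !normcM !normcX normc_nat [(_ + 2) ^+ _]exprS.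
apply: (@le_trans _ _ ((normc z + 1) * (normc w ^+ 2 * (normc z + 2) ^+ n)
   + normc w ^+ 2 * (normc z + 2) ^+ n)); last first.
  by rewrite le_eqVlt; apply/orP; left; apply/eqP; ring.
apply: lerD.
- by rewrite ler_pM ?normc_ge0 // (le_trans (normcD _ _)) // lerD.
- by rewrite ler_wpM2l ?sqr_ge0 ?mulr_ge0 ?normc_ge0 // (le_trans (bern _ _ a0)) //
     lerXn2r ?nnegrE ?addr_ge0 // lerD2l ler1n.
Qed.

(** The linearization error is at most a constant times [|w| ^ 2] for each
    partial sum, uniformly, hence also for the sum. *)
Lemma has_series_cdiff f g c : entire_seq c ->
  has_series f c -> has_series g (deriv_seq c) -> forall z, cdiff f z (g z).
Proof.
move=> ec sf sg z; pose a := normc z.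
have a0 : 0 <= a := normc_ge0 z.
have s0 : 0 < 2 * (a + 2) by rewrite mulr_gt0 // ltr_wpDl.
have [M HM] := ec _ s0.
have M0 : 0 <= M by apply: le_trans (HM 0%N); rewrite mulr_ge0 ?normc_ge0 ?exprn_ge0 ?ltW.
have a10 : 0 < a + 1 by rewrite ltr_wpDl.
have [Mf Hf] := sf _ a10; have [Mg Hg] := sg _ a10.
have key w : normc w <= 1 -> normc (f (z + w) - f z - g z * w) <= 2 * M * normc w ^+ 2.
  move=> w1; have zw : normc (z + w) <= a + 1 by rewrite (le_trans (normcD _ _)) // lerD.
  have za : normc z <= a + 1 by rewrite lerDl.
  apply: (@ler_geometric _ _ (Mf + Mf + Mg)); exists 0%N => N _.
  pose err n : C := c n * ((z + w) ^+ n - z ^+ n - n%:R * w * z ^+ n.-1).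
  have errN : normc (\sum_(n < N.+1) err n) <= 2 * M * normc w ^+ 2.
    have bnd n : normc (err n) <= M * normc w ^+ 2 / 2 ^+ n.
      rewrite normcM ler_pdivlMr ?exprn_gt0 // (le_trans (y :=
        normc (c n) * (normc w ^+ 2 * (a + 2) ^+ n) * 2 ^+ n)) //.
        by rewrite ler_wpM2r ?exprn_ge0 // ler_wpM2l ?normc_ge0 // ler_taylor2.
      rewrite (_ : _ * _ = normc (c n) * (2 * (a + 2)) ^+ n * normc w ^+ 2).
        by rewrite ler_wpM2r ?exprn_ge0 ?normc_ge0.
      by rewrite exprMn; ring.
    have geo n : \sum_(k < n) (M * normc w ^+ 2) / 2 ^+ k <=
        2 * (M * normc w ^+ 2) - 2 * (M * normc w ^+ 2) / 2 ^+ n.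
      move: (M * normc w ^+ 2) => Q.
      elim: n => [|n IH]; first by rewrite big_ord0 expr0 divr1 subrr.
      rewrite big_ord_recr /= (le_trans (lerD IH (lexx _))) //.
      have h : Q / 2 ^+ n.+1 = Q / 2 ^+ n / 2.
        by rewrite exprS invfM; field; rewrite expf_neq0.
      by rewrite -!(mulrA 2) h; lra.
    rewrite (le_trans (normc_sum _ _ _)) //.
    rewrite (le_trans (y := \sum_(k < N.+1) (M * normc w ^+ 2) / 2 ^+ k)) //.
      by apply: ler_sum => k _; exact: bnd.
    rewrite (le_trans (geo _)) // -[leRHS]mulrA gerBl.
    by rewrite !mulr_ge0 ?invr_ge0 ?exprn_ge0 ?normc_ge0.
  have E : \sum_(n < N.+1) err n = \sum_(n < N.+1) c n * (z + w) ^+ n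
      - \sum_(n < N.+1) c n * z ^+ n - (\sum_(n < N) deriv_seq c n * z ^+ n) * w.
    rewrite /err; under eq_bigr do rewrite mulrBr mulrBr.
    rewrite !sumrB; congr (_ - _); rewrite big_ord_recl /= mul0r mul0r mulr0 add0r.
    by rewrite mulr_suml; apply: eq_bigr => i _; rewrite /deriv_seq /bump /= add1n; ring.
  have -> : f (z + w) - f z - g z * w =
     (f (z + w) - \sum_(n < N.+1) c n * (z + w) ^+ n)
     - (f z - \sum_(n < N.+1) c n * z ^+ n)
     - (g z - \sum_(n < N) deriv_seq c n * z ^+ n) * w
     + \sum_(n < N.+1) err n by rewrite E; ring.
  have half (L : R) : 0 <= L -> L / 2 ^+ N.+1 <= L / 2 ^+ N.
    by move=> L0; apply: ler_wpM2l => //; rewrite lef_pV2 ?posrE ?exprn_gt0 // ler_weXn2l ?ler1n.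
  have Mf0 : 0 <= Mf.
    by have := le_trans (normc_ge0 _) (Hf z 0%N za); rewrite expr0 divr1.
  have Mg0 : 0 <= Mg.
    by have := le_trans (normc_ge0 _) (Hg z 0%N za); rewrite expr0 divr1.
  have e1 := le_trans (Hf _ N.+1 zw) (half _ Mf0).
  have e2 := le_trans (Hf _ N.+1 za) (half _ Mf0).
  have e3 : normc ((g z - \sum_(n < N) deriv_seq c n * z ^+ n) * w) <= Mg / 2 ^+ N.
    by rewrite normcM -[leRHS]mulr1 ler_pM ?normc_ge0 ?Hg.
  apply: (le_trans (normcD _ _)); rewrite addrC; apply: lerD => //.
  have -> : (Mf + Mf + Mg) / 2 ^+ N = Mf / 2 ^+ N + Mf / 2 ^+ N + Mg / 2 ^+ N.
    by rewrite !mulrDl.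
  apply: (le_trans (normcB _ _)); apply: lerD e3.
  exact: le_trans (normcB _ _) (lerD e1 e2).
move=> e e0; have M10 : 0 < 2 * M + 1 by rewrite ltr_wpDl ?mulr_ge0.
exists (Num.min 1 (e / (2 * M + 1))); first by rewrite lt_min ltr01 divr_gt0.
move=> h; rewrite le_min => /andP[h1 he]; rewrite (le_trans (key h h1)) //.
rewrite expr2 mulrA ler_wpM2r ?normc_ge0 //.
rewrite ler_pdivlMr // mulrC in he; rewrite (le_trans _ he) //.
by rewrite ler_wpM2r ?normc_ge0 // lerDl.
Qed.

Lemma has_series_derive f c : entire_seq c -> has_series f c ->
  entire f /\ has_series (derive1 f) (deriv_seq c).
Proof.
move=> ec sf; have [g sg] := series_exists (deriv_seq_entire ec).
have df := has_series_cdiff ec sf sg.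
split=> [z|]; first exact: cdiff_derivable (df z).
by rewrite (_ : derive1 f = g) //; apply/funext => z; exact: cdiff_derive1.
Qed.

End PowerSeries.

(** * Taylor coefficients at arbitrary points *)

Section Taylor.
Variable R : realType.
Notation C := (R[i]^o).
Implicit Types (f g : C -> C) (z w : C) (c : nat -> C).

Lemma entire_derive1 f : entire f -> entire (derive1 f).
Proof.
move=> /entire_has_series[c ec sf].
have [_ sf'] := has_series_derive ec sf.
by have [] := has_series_derive (deriv_seq_entire ec) sf'.
Qed.

Lemma entire_derive1n f n : entire f -> entire (derive1n n f).
Proof.
by move=> ef; elim: n => [//|n IH]; rewrite derive1nS; exact: entire_derive1.
Qed.

Lemma taylor_coef0 f z : taylor_coef f 0 z = f z.
Proof. by rewrite /taylor_coef derive1n0 fact0 divr1. Qed.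

Lemma taylor_has_series f : entire f ->
  entire_seq (fun n => taylor_coef f n 0) /\
  has_series f (fun n => taylor_coef f n 0).
Proof.
move=> /entire_has_series[c ec sf].
suff -> : (fun n => taylor_coef f n 0) = c by [].
have iterE n k : k`!%:R * iter n (@deriv_seq R) c k = (k + n)`!%:R * c (k + n)%N.
  elim: n k => [|n IH] k /=; first by rewrite addn0.
  by rewrite /deriv_seq mulrA -natrM mulnC -factS IH addSnnS.
have iterS n : entire_seq (iter n (@deriv_seq R) c) /\
    has_series (derive1n n f) (iter n (@deriv_seq R) c).
  elim: n => [//|n [e1 e2]]; split; first exact: deriv_seq_entire.
  by rewrite derive1nS; have [] := has_series_derive e1 e2.
apply/funext => n; rewrite /taylor_coef (has_series0 (iterS n).2).
have := iterE n 0; rewrite fact0 mul1r add0n => ->.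
by rewrite mulrC mulKf // pnatr_eq0 -lt0n fact_gt0.
Qed.

Lemma derive1n_shift f z n w : entire f ->
  derive1n n (fun v => f (z + v)) w = derive1n n f (z + w).
Proof.
move=> ef; elim: n w => [//|n IH] w.
rewrite !derive1nS (_ : derive1n n _ = fun v => derive1n n f (z + v)); last first.
  exact/funext.
apply/cdiff_derive1/shift_cdiff/derivable_cdiff.
exact: entire_derive1n.
Qed.

Lemma taylor_coef_shift f z n w : entire f ->
  taylor_coef (fun v => f (z + v)) n w = taylor_coef f n (z + w).
Proof. by move=> ef; rewrite /taylor_coef derive1n_shift. Qed.

Lemma shift_has_series f z : entire f ->
  has_series (fun w => f (z + w)) (fun n => taylor_coef f n z).
Proof.
move=> ef; have [_] := taylor_has_series (@shift_entire R f z ef).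
rewrite (_ : (fun n => _) = fun n => taylor_coef f n z) //.
by apply/funext => n; rewrite taylor_coef_shift // addr0.
Qed.

Lemma taylor_coef_estimate f z (r B : R) n : entire f -> 0 < r ->
  (forall w, normc w = r -> normc (f (z + w)) <= B) ->
  normc (taylor_coef f n z) * r ^+ n <= B.
Proof. by move=> ef; exact: (has_series_estimate n (shift_has_series z ef)). Qed.

Lemma cdiff_divr f (k : C) z d : cdiff f z d -> cdiff (fun w => f w / k) z (d / k).
Proof.
move=> /cdiffP H; apply/cdiffP.
have := @is_deriveM _ _ f (cst k^-1) z 1 d 0 H (is_derive_cst _ _ _).
by rewrite scaler0 add0r => h; rewrite mulrC; exact: h.
Qed.

Lemma taylor_coef_cdiff f n z : entire f ->
  cdiff (taylor_coef f n) z (n.+1%:R * taylor_coef f n.+1 z).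
Proof.
move=> ef; rewrite (_ : _ * _ = derive1 (derive1n n f) z / n`!%:R).
  by apply/cdiff_divr/derivable_cdiff/entire_derive1n.
rewrite /taylor_coef derive1nS factS natrM.
have f0 : n`!%:R != 0 :> C by rewrite pnatr_eq0 -lt0n fact_gt0.
have n0 : n.+1%:R != 0 :> C by rewrite pnatr_eq0.
by move: (derive1 _ _) => d; field; rewrite f0 -[1]/(1%:R) -natrD.
Qed.

Lemma taylor_coef_entire f n : entire f -> entire (taylor_coef f n).
Proof. by move=> ef z; exact: cdiff_derivable (taylor_coef_cdiff n z ef). Qed.

Lemma taylor_coef_taylor1 f n z : entire f ->
  taylor_coef (taylor_coef f n) 1 z = n.+1%:R * taylor_coef f n.+1 z.
Proof.
move=> ef; rewrite [LHS]/taylor_coef derive1n1 divr1.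
exact: cdiff_derive1 (taylor_coef_cdiff n z ef).
Qed.

Lemma entire_bounded f (r : R) : entire f ->
  exists M, forall z, normc z <= r -> normc (f z) <= M.
Proof.
move=> ef; have [_ sf] := taylor_has_series ef.
have r0 : 0 < `|r| + 1 by rewrite ltr_wpDl.
have [M HM] := sf _ r0; exists M => z zr.
have := HM z 0%N; rewrite big_ord0 subr0 expr0 divr1; apply.
by rewrite (le_trans zr) // (le_trans (ler_norm r)) // lerDl.
Qed.

End Taylor.

(** * Growth of an entire function and size of its Taylor coefficients *)

Section RealPowers.
Variable R : realType.
Implicit Types (a b s x rho : R).

Lemma ler_ln_expN1 x : 0 < x -> ln x <= x / expR 1.
Proof.
move=> x0; have := expR_ge1Dx (ln x - 1).
by rewrite expRD lnK ?posrE // expRN addrC subrK.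
Qed.

Lemma powR_leq_rho rho x y : 0 <= rho -> 0 <= x -> x <= y -> x `^ rho <= y `^ rho.
Proof.
move=> r0 x0 xy; apply: ge0_ler_powR => //; rewrite nnegrE //.
exact: le_trans xy.
Qed.

Lemma powRVK rho x : 0 < rho -> 0 <= x -> (x `^ rho^-1) `^ rho = x.
Proof. by move=> r0 x0; rewrite -powRrM mulVf ?gt_eqF // powRr1. Qed.

Lemma powRKV rho x : 0 < rho -> 0 <= x -> (x `^ rho) `^ rho^-1 = x.
Proof. by move=> r0 x0; rewrite -powRrM mulfV ?gt_eqF // powRr1. Qed.

Lemma powR_large rho b : 0 < rho -> exists2 s0, 0 < s0 &
  forall s, s0 <= s -> b <= s `^ rho.
Proof.
move=> r0; exists ((`|b| + 1) `^ rho^-1); first by rewrite powR_gt0 // ltr_wpDl.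
move=> s hs; rewrite (@le_trans _ _ (`|b| + 1)) //.
  by rewrite (le_trans (ler_norm b)) // lerDl.
rewrite -[leLHS](@powRVK rho) //.
by rewrite powR_leq_rho ?powR_ge0 // ltW.
Qed.

Lemma powR_gt1 x (p : R) : 0 < p -> 1 < x -> 1 < x `^ p.
Proof.
move=> p0 x1; have x0 : 0 <= x by rewrite ltW // (lt_trans ltr01).
by have := @gt0_ltr_powR _ _ p0 1 x ler01 x0 x1; rewrite powR1.
Qed.

Lemma powR_shift rho a (k : R) : 0 < rho -> 0 <= a -> 1 < k -> exists2 s0, 0 < s0 &
  forall s, s0 <= s -> (s + a) `^ rho <= k * s `^ rho.
Proof.
move=> r0 a0 k1; pose l := k `^ rho^-1.
have l1 : 1 < l by rewrite powR_gt1 ?invr_gt0.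
exists (a / (l - 1) + 1); first by rewrite ltr_wpDl // divr_ge0 // subr_ge0 ltW.
move=> s hs; have s0 : 0 < s.
  by rewrite (lt_le_trans _ hs) // ltr_wpDl // divr_ge0 // subr_ge0 ltW.
have k0 : 0 <= k by rewrite ltW // (lt_trans ltr01).
rewrite -[k in leRHS](@powRVK rho) // -powRM ?powR_ge0 ?(ltW s0) //.
apply: powR_leq_rho; [exact: ltW|exact: addr_ge0 (ltW s0) a0|].
have : a / (l - 1) <= s by rewrite (le_trans _ hs) // lerDl.
by rewrite ler_pdivrMr ?subr_gt0 // -/l; lra.
Qed.

(** The size [(A / n) ^ (n / rho)] of the [n]-th Taylor coefficient of a function
    of order [rho] and type [A / (e * rho)]. *)
Definition coef_size rho A (n : nat) : R := (A / n%:R) `^ (n%:R / rho).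

Lemma coef_size_gt0 rho A n : 0 < A -> (0 < n)%N -> 0 < coef_size rho A n.
Proof. by move=> A0 n0; rewrite powR_gt0 // divr_gt0 // ltr0n. Qed.

Lemma coef_size_ge0 rho A n : 0 <= coef_size rho A n.
Proof. exact: powR_ge0. Qed.

(** Dividing out [n ^ (n / rho)] turns a change of [A] into a geometric factor. *)
Lemma coef_sizeM rho A k n : 0 <= A -> 0 <= k ->
  coef_size rho (k * A) n = (k `^ rho^-1) ^+ n * coef_size rho A n.
Proof.
move=> A0 k0; rewrite /coef_size -mulrA powRM //; last by rewrite divr_ge0.
by rewrite [n%:R / _]mulrC powRrM powR_mulrn ?powR_ge0 // mulrC.
Qed.

Lemma coef_size_le rho A B n : 0 < rho -> 0 <= A -> A <= B ->
  coef_size rho A n <= coef_size rho B n.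
Proof.
move=> r0 A0 AB; apply: powR_leq_rho; rewrite ?divr_ge0 ?(ltW r0) //.
by rewrite ler_wpM2r ?invr_ge0.
Qed.

Lemma term_coef_size rho A (x : R) (n : nat) : 0 < rho -> 0 <= x -> 0 <= A ->
  (0 < n)%N -> (n%:R * x `^ (rho / n%:R) <= A) = (x <= coef_size rho A n).
Proof.
move=> r0 x0 A0 n0; have n0' : 0 < n%:R :> R by rewrite ltr0n.
have q0 : 0 < rho / n%:R by rewrite divr_gt0.
have An0 : 0 <= A / n%:R by rewrite divr_ge0 // ltW.
have E : n%:R / rho = (rho / n%:R)^-1 by rewrite invf_div.
rewrite mulrC -ler_pdivlMr // /coef_size E; apply/idP/idP => h.
  rewrite -[leLHS](powRKV q0 x0); apply: powR_leq_rho => //.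
    by rewrite invr_ge0 ltW.
  exact: powR_ge0.
rewrite -[leRHS](powRVK q0 An0); apply: powR_leq_rho => //.
exact: ltW.
Qed.

(** The maximum over [s] of [s ^ n * exp (- T * s ^ rho)] is attained at
    [s = (n / (rho * T)) ^ (1 / rho)]; [coef_size_bound] and
    [coef_size_extremal] are this extremal problem, read in both directions. *)
Lemma coef_size_bound rho A s n : 0 < rho -> 0 < A -> 0 <= s -> (0 < n)%N ->
  coef_size rho A n * s ^+ n <= expR (A / (expR 1 * rho) * s `^ rho).
Proof.
move=> r0 A0; rewrite le_eqVlt => /predU1P[<- n0|s0 n0].
  by rewrite expr0n eqn0Ngt n0 mulr0 ltW // expR_gt0.
have n0' : 0 < n%:R :> R by rewrite ltr0n.
rewrite -(@lnK _ (_ * _)) ?posrE ?mulr_gt0 ?coef_size_gt0 ?exprn_gt0 // ler_expR.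
rewrite lnM ?posrE ?coef_size_gt0 ?exprn_gt0 // ln_powR lnXn // -[ln s *+ n]mulr_natl.
pose X := A / n%:R * s `^ rho.
have X0 : 0 < X by rewrite mulr_gt0 ?divr_gt0 ?powR_gt0.
have -> : n%:R / rho * ln (A / n%:R) + n%:R * ln s = n%:R / rho * ln X.
  by rewrite /X [ln (_ * _ `^ _)]lnM ?posrE ?divr_gt0 ?powR_gt0 // ln_powR; field; rewrite gt_eqF.
have := ler_ln_expN1 X0; rewrite -(ler_pM2l (divr_gt0 n0' r0)).
move/le_trans; apply; rewrite le_eqVlt; apply/orP; left; apply/eqP; rewrite /X.
by field; rewrite !gt_eqF ?expR_gt0.
Qed.

Definition extremal_radius rho T (n : nat) : R := (n%:R / (rho * T)) `^ rho^-1.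

Lemma extremal_radius_gt0 rho T n : 0 < rho -> 0 < T -> (0 < n)%N ->
  0 < extremal_radius rho T n.
Proof.
by move=> r0 T0 n0; rewrite powR_gt0 // divr_gt0 ?mulr_gt0 // ltr0n.
Qed.

Lemma coef_size_extremal rho T n : 0 < rho -> 0 < T -> (0 < n)%N ->
  expR (T * extremal_radius rho T n `^ rho) / extremal_radius rho T n ^+ n
  = coef_size rho (expR 1 * rho * T) n.
Proof.
move=> r0 T0 n0; have n0' : 0 < n%:R :> R by rewrite ltr0n.
have rT : 0 < n%:R / (rho * T) by rewrite divr_gt0 ?mulr_gt0.
have s0 := extremal_radius_gt0 r0 T0 n0.
have X0 : 0 < expR 1 * rho * T / n%:R by rewrite divr_gt0 // !mulr_gt0 ?expR_gt0.
apply: ln_inj; rewrite ?posrE ?divr_gt0 ?expR_gt0 ?exprn_gt0 ?coef_size_gt0 //.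
  by rewrite !mulr_gt0 ?expR_gt0.
rewrite lnM ?posrE ?expR_gt0 ?invr_gt0 ?exprn_gt0 // lnV ?posrE ?exprn_gt0 //.
rewrite expRK lnXn // -[ln _ *+ n]mulr_natl !ln_powR powRVK ?(ltW rT) //.
rewrite (_ : expR 1 * rho * T / n%:R = expR 1 * (n%:R / (rho * T))^-1); last first.
  by field; rewrite !gt_eqF.
rewrite lnM ?posrE ?expR_gt0 ?invr_gt0 // lnV ?posrE // expRK.
by move: (ln _) => q; field; rewrite !gt_eqF.
Qed.

Lemma extremal_radius_large rho T (b : R) : 0 < rho -> 0 < T ->
  exists n0 : nat, forall n, (n0 <= n)%N -> b <= extremal_radius rho T n.
Proof.
move=> r0 T0; exists (Num.bound (`|b| `^ rho * (rho * T))) => n hn.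
rewrite (le_trans (ler_norm b)) // -[leLHS](powRKV r0 (normr_ge0 b)).
apply: powR_leq_rho; rewrite ?invr_ge0 ?powR_ge0 ?(ltW r0) //.
rewrite ler_pdivlMr ?mulr_gt0 // ltW //.
have h : 0 <= `|b| `^ rho * (rho * T) by rewrite !mulr_ge0 ?powR_ge0 ?(ltW r0) ?(ltW T0).
by rewrite (lt_le_trans (archi_boundP h)) // ler_nat.
Qed.

End RealPowers.

Section Growth.
Variables (R : realType) (rho : R).
Hypothesis rho_gt0 : 0 < rho.
Notation C := (R[i]^o).
Implicit Types (f g : C -> C) (z w : C) (T A : R).

Definition growth T f := exists r0 : R, forall w, r0 <= normc w ->
  normc (f w) <= expR (T * normc w `^ rho).

(** Cauchy's estimate on the circle of extremal radius about [z]; the room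
    between [T] and [T'] pays for the distance of [z] from the origin. *)
Lemma growth_coef f T T' (r1 : R) : entire f -> 0 < T -> T < T' -> 0 <= r1 ->
  growth T f -> exists n0 : nat, forall n z, (n0 <= n)%N -> normc z <= r1 ->
  normc (taylor_coef f n z) <= coef_size rho (expR 1 * rho * T') n.
Proof.
move=> ef T0 TT' r10 [r0 gf].
have T'0 : 0 < T' := lt_trans T0 TT'.
have k1 : 1 < T' / T by rewrite ltr_pdivlMr // mul1r.
have [s0 s0p Hs] := powR_shift rho_gt0 r10 k1.
have [n0 Hn] := extremal_radius_large (Num.max s0 (r0 + r1)) rho_gt0 T'0.
exists n0.+1 => n z hn zr.
have n_gt0 : (0 < n)%N by rewrite (leq_trans _ hn).
have := Hn n (ltnW hn); rewrite ge_max => /andP[h1 h2].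
have s_gt0 := extremal_radius_gt0 rho_gt0 T'0 n_gt0.
rewrite -coef_size_extremal // ler_pdivlMr ?exprn_gt0 //.
apply: taylor_coef_estimate => // w ws.
rewrite (le_trans (gf _ _)) //.
  have := normc_lerB w (- z); rewrite opprK normcN addrC.
  by rewrite (addrC w) ws; lra.
have TE : T * (T' / T) = T' by rewrite mulrCA divff ?mulr1 // gt_eqF.
have := ler_wpM2l (ltW T0) (Hs _ h1); rewrite mulrA TE ler_expR => h.
rewrite (le_trans _ h) // ler_pM2l //.
apply: powR_leq_rho; rewrite ?normc_ge0 ?(ltW rho_gt0) //.
by rewrite (le_trans (normcD _ _)) // addrC ws lerD.
Qed.

(** By [coef_size_bound] all terms of the Taylor series are at most
    [K * exp (T1 * s ^ rho)] on the circle of radius [s]. Used at radius [l * s]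
    with [l > 1] slightly larger, this bounds the terms at radius [s] by a
    geometric sequence. *)
Lemma coef_growth f z A T : entire f -> 0 < A -> A / (expR 1 * rho) < T ->
  (exists n0 : nat, forall n, (n0 <= n)%N ->
     normc (taylor_coef f n z) <= coef_size rho A n) ->
  growth T f.
Proof.
move=> ef A0; set T1 := A / _ => T1T [n0 Hn].
have T10 : 0 < T1 by rewrite divr_gt0 // mulr_gt0 ?expR_gt0.
pose a n := normc (taylor_coef f n z).
pose K : R := \sum_(n < n0) (a n / coef_size rho A n) + a 0%N + 1.
have Ki n : 0 <= a n / coef_size rho A n by rewrite divr_ge0 ?normc_ge0 ?coef_size_ge0.
have sum0 m : 0 <= \sum_(n < m) (a n / coef_size rho A n) by rewrite sumr_ge0.
have K1 : 1 <= K by rewrite lerDr addr_ge0 ?normc_ge0.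
have K0 : 0 < K := lt_le_trans ltr01 K1.
have aK n (s : R) : 0 <= s -> a n * s ^+ n <= K * expR (T1 * s `^ rho).
  move=> s0; have [->|n_gt0] := posnP n.
    rewrite expr0 mulr1 -[leLHS]mulr1 ler_pM ?normc_ge0 //.
      by rewrite /K -addrA addrCA lerDl addr_ge0.
    by rewrite -expR0 ler_expR mulr_ge0 ?powR_ge0 ?(ltW T10).
  have W0 := coef_size_gt0 rho A0 n_gt0.
  have anK : a n <= K * coef_size rho A n.
    have [nn0|n0n] := leqP n0 n.
      by rewrite (le_trans (Hn n nn0)) // ler_peMl // ltW.
    rewrite -ler_pdivrMr // /K (bigD1 (Ordinal n0n)) //= -!addrA lerDl.
    by rewrite !addr_ge0 ?normc_ge0 // sumr_ge0.
  rewrite (le_trans (ler_wpM2r _ anK)) ?exprn_ge0 // -mulrA ler_pM2l //.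
  exact: coef_size_bound.
(* [T2] pays for [l], [T3] for the shift by [z], and [T] for the constant *)
pose T2 := (T1 + T) / 2; pose T3 := (T2 + T) / 2.
have T12 : T1 < T2 by rewrite /T2; lra.
have T23 : T2 < T3 by rewrite /T3 /T2; lra.
have T3T : T3 < T by rewrite /T3 /T2; lra.
have T20 : 0 < T2 := lt_trans T10 T12.
pose l := (T2 / T1) `^ rho^-1.
have l1 : 1 < l.
  rewrite powR_gt1 ?invr_gt0 //.
  by rewrite ltr_pdivlMr // mul1r.
have l0 : 0 < l := lt_trans ltr01 l1.
pose K2 := K / (1 - l^-1).
have li1 : 0 < 1 - l^-1 by rewrite subr_gt0 invf_lt1.
have bound w : normc (f (z + w)) <= K2 * expR (T2 * normc w `^ rho).
  set s := normc w; have s0 : 0 <= s := normc_ge0 w.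
  have s10 : 0 < s + 1 by rewrite ltr_wpDl.
  have [M HM] := shift_has_series z ef s10.
  apply: (@ler_geometric _ _ _ M); exists 0%N => N _.
  have Hw : normc w <= s + 1 by rewrite lerDl.
  rewrite (_ : f (z + w) = \sum_(n < N) taylor_coef f n z * w ^+ n +
    (f (z + w) - \sum_(n < N) taylor_coef f n z * w ^+ n)); last by rewrite [RHS]addrC subrK.
  rewrite (le_trans (normcD _ _)) // lerD //; last exact: HM.
  rewrite (le_trans (normc_sum _ _ _)) //.
  have E2 : T1 * (l * s) `^ rho = T2 * s `^ rho.
    have q0 : 0 <= T2 / T1 by rewrite divr_ge0 ?ltW.
    rewrite powRM ?(ltW l0) // /l (powRVK rho_gt0 q0).
    by rewrite mulrA mulrCA mulfV ?mulr1 // gt_eqF.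
  have term n : normc (taylor_coef f n z * w ^+ n) <= K * expR (T2 * s `^ rho) * l^-1 ^+ n.
    rewrite normcM normcX -/s -E2 exprVn ler_pdivlMr ?exprn_gt0 // -mulrA.
    by rewrite [_ * l ^+ n]mulrC -exprMn aK // mulr_ge0 // ltW.
  apply: (@le_trans _ _ (\sum_(n < N) K * expR (T2 * s `^ rho) * l^-1 ^+ n)).
    by apply: ler_sum => n _; exact: term.
  rewrite -mulr_sumr /K2 [leRHS]mulrAC ler_pM2l ?mulr_gt0 ?expR_gt0 //.
  rewrite -[leRHS]mul1r ler_pdivlMr //.
  by rewrite mulrC -(opprB l^-1) mulNr -subrX1 opprB gerBl exprn_ge0 // invr_ge0 ltW.
have K20 : 0 < K2 by rewrite divr_gt0.
have k1 : 1 < T3 / T2 by rewrite ltr_pdivlMr // mul1r.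
have [s0 s0p Hs] := powR_shift rho_gt0 (normc_ge0 z) k1.
have [s1 s1p Hs1] := powR_large (ln K2 / (T - T3)) rho_gt0.
exists (Num.max s0 s1) => w; rewrite ge_max => /andP[h0 h1].
have := bound (w - z); rewrite addrCA subrr addr0 => /le_trans; apply.
rewrite -[K2]lnK ?posrE // -expRD ler_expR.
have := Hs1 _ h1; rewrite ler_pdivrMr ?subr_gt0 // => hK.
have := Hs _ h0; rewrite mulrAC ler_pdivlMr // => hS.
have hN : normc (w - z) `^ rho <= (normc w + normc z) `^ rho.
  by apply: powR_leq_rho; rewrite ?normc_ge0 ?(ltW rho_gt0) // normcB.
have := ler_wpM2r (ltW T20) hN; lra.
Qed.

Lemma max_modulus_ge f w : entire f -> normc (f w) <= max_modulus f (normc w).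
Proof.
move=> ef; have [M HM] := entire_bounded (normc w) ef.
apply: ub_le_sup; last by exists w.
by exists M => _ [v /= vw <-]; apply: HM; rewrite vw.
Qed.

Lemma type_growth f T : entire f -> (entire_type f rho < T%:E)%E -> growth T f.
Proof.
move=> ef /ereal_inf_lt[_ [V /= [r [_ rV]] <-]] VT.
exists (Num.max 1 (r + 1)) => w; rewrite ge_max => /andP[w1 rw].
have w0 : 0 < normc w := lt_le_trans ltr01 w1.
rewrite (le_trans (max_modulus_ge w ef)) //.
have [M0|M0] := leP (max_modulus f (normc w)) 0.
  by rewrite (le_trans M0) // ltW // expR_gt0.
rewrite -[leLHS]lnK ?posrE // ler_expR -ler_pdivrMr ?powR_gt0 //.
rewrite -lee_fin (le_trans _ (ltW VT)) //; apply: ereal_sup_ubound.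
by exists (normc w) => //; apply: rV; rewrite (lt_le_trans _ rw) // ltrDl.
Qed.

Lemma growth_type f T : 0 <= T -> growth T f -> (entire_type f rho <= T%:E)%E.
Proof.
move=> T0 [r0 gf]; apply: (@le_trans _ _ (ereal_sup ((fun r : R =>
  (ln (max_modulus f r) / r `^ rho)%:E) @` [set r | Num.max 1 r0 < r]))).
  apply: ereal_inf_lbound; exists [set r | Num.max 1 r0 < r] => //.
  by exists (Num.max 1 r0); split; first exact: num_real.
apply: ub_ereal_sup => _ [r /= + <-]; rewrite gt_max => /andP[r1 r0r].
have rp : 0 < r := lt_trans ltr01 r1.
rewrite lee_fin ler_pdivrMr ?powR_gt0 //.
have [M0|M0] := leP (max_modulus f r) 0; first by rewrite ln0 // mulr_ge0 ?powR_ge0.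
rewrite -ler_expR lnK ?posrE //; apply: ge_sup.
  exists (normc (f r%:C%C)), r%:C%C => //=.
  by rewrite -[LHS]/(normc r%:C%C) normc_real gtr0_norm.
by move=> _ [w /= wr <-]; rewrite -wr; apply: gf; rewrite wr ltW.
Qed.

(** If the type were negative, [ln M(r)] would be negative for large [r], and the
    order would be 0. *)
Lemma order_type_ge0 f : entire_order f = rho%:E -> (0 <= entire_type f rho)%E.
Proof.
move=> fo; rewrite leNgt; apply/negP => /ereal_inf_lt[_ [V /= [r [_ rV]] <-]] V0.
suff : (entire_order f <= 0)%E by rewrite fo lee_fin leNgt rho_gt0.
apply: (@le_trans _ _ (ereal_sup ((fun r : R =>
  (ln (ln (max_modulus f r)) / ln r)%:E) @` [set s | Num.max 1 r < s]))).
  apply: ereal_inf_lbound; exists [set s | Num.max 1 r < s] => //.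
  by exists (Num.max 1 r); split; first exact: num_real.
apply: ub_ereal_sup => _ [s /= + <-]; rewrite gt_max => /andP[s1 rs].
have sp : 0 < s := lt_trans ltr01 s1.
have : ((ln (max_modulus f s) / s `^ rho)%:E < 0)%E.
  by apply: le_lt_trans V0; apply: ereal_sup_ubound; exists s => //; exact: rV.
rewrite lte_fin pmulr_llt0 ?invr_gt0 ?powR_gt0 // => /ltW h.
by rewrite (ln0 h) mul0r.
Qed.

End Growth.

(** * Interpolation at well-spaced nodes *)

Section Interpolation.
Variable R : realType.
Notation C := (R[i]^o).

(** The elements of a set of positive measure may be chosen greedily so that
    consecutive ones are far apart: each choice costs measure at most [2 * g]. *)
Lemma spaced_points (g : R) n (Y : set R) : 0 < g -> measurable Y ->
  has_lbound Y -> ((2 * g * n%:R)%:E < lebesgue_measure Y)%E ->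
  exists y : nat -> R, (forall i, y i + g <= y i.+1) /\
    (forall i, (i <= n)%N -> Y (y i)).
Proof.
move=> g0; elim: n Y => [|n IH] Y mY lY.
  rewrite mulr0 => Y0; have [t Yt] : exists t, Y t.
    apply/set0P; apply: contraTneq Y0 => ->.
    by rewrite measure0 ltxx.
  (* only the first point has to belong to [Y]; the others keep the gaps *)
  exists (fun i => t + i%:R * g); split=> i.
    by rewrite -natr1; lra.
  by rewrite leqn0 => /eqP ->; rewrite mul0r addr0.
move=> Yn.
have Y0 : Y !=set0.
  apply/set0P; apply: contraTneq Yn => ->.
  by rewrite measure0 -leNgt lee_fin mulr_ge0 // mulr_ge0 // ltW.
have [t Yt ta] : exists2 t, Y t & t < inf Y + g by apply: inf_adherent.
pose Y' := Y `&` `[t + g, +oo[%classic.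
have mY' : measurable Y' by apply: measurableI.
pose J : set R := `[inf Y, inf Y + 2 * g]%classic.
have mJ : measurable J by exact: measurable_itv.
have sub : Y `<=` J `|` Y'.
  move=> s Ys; have [ts|st] := leP (t + g) s.
    by right; split=> //=; rewrite in_itv /= ts.
  left; rewrite /J /= in_itv /= ge_inf //=; lra.
have {}Yn : ((2 * g * n%:R)%:E < lebesgue_measure Y')%E.
  have h1 : (lebesgue_measure Y <= (2 * g)%:E + lebesgue_measure Y')%E.
    have h2 : (lebesgue_measure Y <= lebesgue_measure (J `|` Y'))%E.
      by apply: le_measure => //; rewrite inE //; exact: measurableU.
    apply: (le_trans h2); apply: (le_trans (measureU2 _ _ _)) => //.
    rewrite leeD2r // (_ : _ J = (2 * g)%:E) //.
    rewrite -[LHS]/(lebesgue_measure J) lebesgue_measure_itv /= lte_fin ltrDl.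
    by rewrite mulr_gt0 // -EFinB addrAC subrr add0r.
  have := lt_le_trans Yn h1; rewrite -[n.+1%:R]natr1 mulrDr mulr1 EFinD addeC.
  by rewrite lteD2lE.
have lY' : has_lbound Y' by case: lY => b Hb; exists b => s [/Hb].
have [y [y1 y2]] := IH Y' mY' lY' Yn.
exists (fun i => if i is j.+1 then y j else t); split=> [[|i]|[|i]] //.
  by have [_] := y2 0%N isT; rewrite /= in_itv /= andbT.
by rewrite ltnS => /y2[].
Qed.

Lemma spaced_dist (g : R) (y : nat -> R) i j : 0 <= g ->
  (forall i, y i + g <= y i.+1) -> (i <= j)%N -> (j - i)%:R * g <= y j - y i.
Proof.
move=> g0 H; elim: j => [|j IH]; first by rewrite leqn0 => /eqP ->; rewrite !subrr mul0r.
rewrite leq_eqVlt => /predU1P[->|]; first by rewrite subnn mul0r subrr.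
rewrite ltnS => ij; rewrite subSn // -natr1.
by have := H j; have := IH ij; lra.
Qed.

Definition dist_nat (i j : nat) := ((i - j) + (j - i))%N.

Lemma prod_dist_nat i n : (i <= n)%N ->
  (\prod_(j < n.+1 | j != i :> nat) dist_nat i j = i`! * (n - i)`!)%N.
Proof.
move=> i_n; rewrite -(big_mkord (fun j => j != i) (dist_nat i)).
rewrite (big_cat_nat (n := i)) ?leqW //=; congr (_ * _)%N.
  rewrite big_nat_cond (eq_bigl (fun j => (0 <= j < i)%N && true)) => [|j]; last first.
    by rewrite andbT andb_idr //= => ji; rewrite neq_ltn ji.
  rewrite -big_nat_cond big_nat_rev /= fact_prod [RHS]big_add1 /=.
  by rewrite big_nat [RHS]big_nat; apply: eq_bigr => j /andP[_ ji]; rewrite /dist_nat; lia.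
rewrite big_ltn_cond ?ltnS // eqxx /=.
rewrite big_nat_cond (eq_bigl (fun j => (i.+1 <= j < n.+1)%N && true)) => [|j]; last first.
  by rewrite andbT andb_idr //= => /andP[ij _]; rewrite neq_ltn ij orbT.
rewrite -big_nat_cond fact_prod -[i.+1]addn1 addnC big_addn.
rewrite (_ : (n.+1 - i)%N = (n - i).+1); last by lia.
by apply: eq_bigr => j _; rewrite /dist_nat; lia.
Qed.

(** Multiplying by [X - x] multiplies the largest coefficient by at most
    [1 + |x|]. *)
Lemma coef_prod_XsubC (s : seq nat) (P : pred nat) (x : nat -> C) (r : R) :
  0 <= r -> (forall j, j \in s -> normc (x j) <= r) ->
  forall k, normc (\prod_(j <- s | P j) ('X - (x j)%:P))`_k <= (1 + r) ^+ size s.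
Proof.
move=> r0; have r1 : 1 <= 1 + r by rewrite lerDl.
elim: s => [_ k|a s IH H k].
  by rewrite big_nil coef1 expr0; case: (k == 0)%N; rewrite ?normc1 ?normc0.
have {}IH := IH (fun j js => H j (mem_behead (s := a :: s) js)).
rewrite big_cons /=; case: (P a); last first.
  by rewrite (le_trans (IH k)) // ler_weXn2l.
set p := \prod_(_ <- _ | _) _ in IH *.
rewrite mulrBl coefB coefXM mul_polyC coefZ (le_trans (normcB _ _)) //.
rewrite exprS mulrDl mul1r lerD //.
  by case: ifP => _; rewrite ?normc0 ?exprn_ge0 ?addr_ge0.
by rewrite normcM ler_pM ?normc_ge0 // H // mem_head.
Qed.

(** Lagrange's formula: the denominators contribute [i! (N - i)!], which sum up
    to the binomial sum [2 ^ N / N!]. *)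
Lemma interpolation_coef (g r D : R) N (x : nat -> C) (p : {poly C}) k :
  0 < g -> 0 <= r ->
  (forall i j, (dist_nat i j)%:R * g <= normc (x i - x j)) ->
  (forall i, (i <= N)%N -> normc (x i) <= r) ->
  (size p <= N.+1)%N -> (forall i, (i <= N)%N -> normc p.[x i] <= D) ->
  normc p`_k <= D * (2 * (1 + r) / g) ^+ N / N`!%:R * (1 + r).
Proof.
move=> g0 r0 xd xr sp pD.
have D0 : 0 <= D by apply: le_trans (pD 0%N _); rewrite ?normc_ge0.
have xinj : injective x.
  move=> i j xij; have := xd i j; rewrite xij subrr normc0 pmulr_lle0 // lern0.
  by rewrite /dist_nat; lia.
rewrite (@lagrange_gen _ N.+1 x (ltn0Sn N) xinj p sp) coef_sum.
rewrite (le_trans (normc_sum _ _ _)) //.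
pose b (i : 'I_N.+1) : R := D * ((1 + r) ^+ N.+1 / g ^+ N) * ('C(N, i)%:R / N`!%:R).
apply: (@le_trans _ _ (\sum_(i < N.+1) b i)).
  apply: ler_sum => i _; have iN : (i <= N)%N by rewrite -ltnS.
  rewrite lagrangeE //= !coefCM.
  set q := \prod_(j < N.+1 | _) _.
  have qk : normc q`_k <= (1 + r) ^+ N.+1.
    have -> : q = \prod_(j <- iota 0 N.+1 | j != i) ('X - (x j)%:P).
      by rewrite -[iota _ _]/(index_iota 0 N.+1) big_mkord.
    rewrite -[X in _ ^+ X](size_iota 0); apply: coef_prod_XsubC => // j.
    by rewrite mem_iota /= add0n ltnS; exact: xr.
  have qi : g ^+ N * (i`! * (N - i)`!)%:R <= normc q.[x i].
    rewrite horner_prod normc_prod -prod_dist_nat //.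
    have -> : g ^+ N * (\prod_(j < N.+1 | j != i :> nat) dist_nat i j)%:R
       = \prod_(j < N.+1 | j != i :> nat) ((dist_nat i j)%:R * g).
      rewrite big_split /= natr_prod mulrC; congr (_ * _).
      rewrite prodr_const; congr (_ ^+ _).
      by rewrite (eq_card (B := predC1 i)) ?cardC1 ?card_ord // => j; rewrite !inE val_eqE.
    apply: ler_prod => j _; rewrite mulr_ge0 ?(ltW g0) //=.
    by rewrite hornerXsubC; exact: xd.
  have ff : 0 < (i`! * (N - i)`!)%:R :> R by rewrite ltr0n muln_gt0 !fact_gt0.
  have gff : 0 < g ^+ N * (i`! * (N - i)`!)%:R by rewrite mulr_gt0 ?exprn_gt0.
  rewrite /b (_ : 'C(N, i)%:R / N`!%:R = (i`! * (N - i)`!)%:R^-1); last first.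
    have := bin_fact iN => /(congr1 (fun n => n%:R : R)); rewrite natrM => <-.
    by rewrite invfM mulrA divff ?mul1r // pnatr_eq0 -lt0n bin_gt0.
  rewrite !normcM normcV -!mulrA ler_pM ?normc_ge0 ?mulr_ge0 ?invr_ge0 ?normc_ge0 ?pD //.
  rewrite -[X in _ <= _ * X]invfM mulrC ler_pM ?invr_ge0 ?normc_ge0 //.
  by rewrite lef_pV2 ?posrE // (lt_le_trans gff).
rewrite /b -mulr_sumr -mulr_suml -natr_sum.
have -> : (\sum_(i < N.+1) 'C(N, i) = 2 ^ N)%N.
  by rewrite -[2%N]/(1 + 1)%N expnDn; apply: eq_bigr => i _; rewrite !exp1n !muln1.
rewrite natrX le_eqVlt; apply/orP; left; apply/eqP.
rewrite exprS expr_div_n exprMn; field.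
by rewrite expf_neq0 ?gt_eqF // pnatr_eq0 -lt0n fact_gt0.
Qed.

(** With [N + 1] nodes of spacing [m / (N + 1)] the factorial absorbs the small
    spacing, and the loss is only geometric in [N]. *)
Lemma interpolation_coef_spaced (m r D : R) N (x : nat -> C) (p : {poly C}) k :
  0 < m -> 0 <= r ->
  (forall i j, (dist_nat i j)%:R * (m / N.+1%:R) <= normc (x i - x j)) ->
  (forall i, (i <= N)%N -> normc (x i) <= r) ->
  (size p <= N.+1)%N -> (forall i, (i <= N)%N -> normc p.[x i] <= D) ->
  normc p`_k <= D * ((2 * (1 + r) / m + 1 + r) * expR 1) ^+ N.+1.
Proof.
move=> m0 r0 xd xr sp pD.
have g0 : 0 < m / N.+1%:R by rewrite divr_gt0.
have D0 : 0 <= D by apply: le_trans (pD 0%N _); rewrite ?normc_ge0.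
have := interpolation_coef k g0 r0 xd xr sp pD; move/le_trans; apply.
pose Q := 2 * (1 + r) / m.
have Q0 : 0 <= Q by rewrite divr_ge0 ?mulr_ge0 ?addr_ge0 // ltW.
have -> : 2 * (1 + r) / (m / N.+1%:R) = Q * N.+1%:R.
  by rewrite /Q; field; rewrite gt_eqF // -[1]/(1%:R) -natrD pnatr_eq0.
have fact_e : N.+1%:R ^+ N / N`!%:R <= expR 1 ^+ N.+1 :> R.
  have := expR_ge1Dxn N (ler0n R N.+1); rewrite -expRM_natl mulr1 => h.
  apply: le_trans (_ : N.+1%:R ^+ N.+1 / (N.+1)`!%:R <= _); last by rewrite (le_trans _ h) // lerDr.
  rewrite factS natrM exprS invfM mulrACA divff ?mul1r // pnatr_eq0 //.
rewrite exprMn (_ : D * _ / _ * _ = D * ((Q ^+ N * (1 + r)) * (N.+1%:R ^+ N / N`!%:R)));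
  last by rewrite !mulrA; ring.
rewrite ler_wpM2l // [leRHS]exprMn -/Q.
apply: (@le_trans _ _ ((Q + 1 + r) ^+ N * (1 + r) * expR 1 ^+ N.+1)).
  rewrite ler_pM ?mulr_ge0 ?invr_ge0 ?exprn_ge0 ?addr_ge0 //.
  by rewrite ler_wpM2r ?addr_ge0 // lerXn2r ?nnegrE ?addr_ge0 // -addrA lerDl addr_ge0.
rewrite ler_wpM2r ?exprn_ge0 ?expR_ge0 // exprSr ler_wpM2l ?exprn_ge0 ?addr_ge0 //.
by rewrite -addrA lerDr.
Qed.

End Interpolation.

(** * From half of the Taylor coefficients to all of them *)

Section Spread.
Variables (R : realType) (rho : R).
Hypothesis rho_gt0 : 0 < rho.
Notation C := (R[i]^o).
Implicit Types (f g : C -> C) (z w : C) (T A : R).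

(** Bernoulli's inequality for the square root of [k] makes [k ^ n] at least
    quadratic in [n]. *)
Lemma expr_linear (k b : R) : 1 < k ->
  exists n0 : nat, forall n, (n0 <= n)%N -> b * n.+1%:R <= k ^+ n.
Proof.
move=> k1; have k0 : 0 < k := lt_trans ltr01 k1.
pose d := Num.sqrt k - 1.
have s0 : 0 < Num.sqrt k by rewrite sqrtr_gt0.
have sE : Num.sqrt k ^+ 2 = k by rewrite sqr_sqrtr // ltW.
have d0 : 0 < d by rewrite /d; nra.
have bern n : n%:R * d <= Num.sqrt k ^+ n.
  suff H (e : R) : 0 <= e -> 1 + n%:R * e <= (1 + e) ^+ n.
    by have := H d (ltW d0); rewrite /d [1 + (_ - 1)]addrC subrK -/d; lra.
  move=> e0; elim: n => [|n IH]; first by rewrite mul0r addr0 expr0.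
  rewrite exprS -natr1 mulrDl mul1r mulrDl mul1r.
  have n0 : 0 <= n%:R :> R by [].
  move: (_ ^+ n) IH => X IH; nra.
pose B := `|b| * 2 / d ^+ 2; have B0 : 0 <= B by rewrite divr_ge0 ?sqr_ge0 ?mulr_ge0.
exists (Num.bound B).+1 => n hn.
have nB : B <= n%:R.
  by rewrite (le_trans (ltW (archi_boundP B0))) // ler_nat ltnW.
have n1 : 1 <= n%:R :> R by rewrite ler1n (leq_ltn_trans _ hn).
rewrite -[k]sE -exprM mulnC exprM.
apply: (@le_trans _ _ ((n%:R * d) ^+ 2)); last first.
  by rewrite lerXn2r ?nnegrE ?exprn_ge0 ?mulr_ge0 ?(ltW d0) ?(ltW s0).
have h : `|b| * 2 <= n%:R * d ^+ 2 by rewrite -ler_pdivrMr ?exprn_gt0.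
rewrite exprMn expr2 -mulrA -natr1.
apply: (@le_trans _ _ (n%:R * (`|b| * 2))); last by rewrite ler_wpM2l.
by have := ler_norm b; have := normr_ge0 b; nra.
Qed.

(** The step from [n] to [n + 1] costs a power of [n], which is less than the
    geometric gain from [A] to [A2]. *)
Lemma coef_sizeS A A2 : 0 < A -> A < A2 -> exists n0 : nat, forall n, (n0 <= n)%N ->
  coef_size rho A n <= coef_size rho A2 n.+1.
Proof.
move=> A0 AA2; have A20 : 0 < A2 := lt_trans A0 AA2.
have k1 : 1 < A2 / A by rewrite ltr_pdivlMr // mul1r.
have [n0 H] := expr_linear (expR 1 / A2) k1; exists n0.+1 => n hn.
have n_gt0 : (0 < n)%N by rewrite (leq_trans _ hn).
have n0' : 0 < n%:R :> R by rewrite ltr0n.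
have n1' : 0 < n.+1%:R :> R by rewrite ltr0n.
have E (a : R) m : 0 <= a -> coef_size rho a m = ((a / m%:R) ^+ m) `^ rho^-1.
  by move=> a0; rewrite /coef_size powRrM powR_mulrn // divr_ge0.
rewrite !E ?(ltW A0) ?(ltW A20) //; apply: powR_leq_rho; rewrite ?invr_ge0 ?(ltW rho_gt0) //.
  by rewrite exprn_ge0 // divr_ge0 ?ltW.
have e1 : (n.+1%:R / n%:R) ^+ n <= expR 1 :> R.
  rewrite -[leRHS](_ : expR (n%:R^-1) ^+ n = _); last first.
    by rewrite -expRM_natl mulfV // gt_eqF.
  rewrite lerXn2r ?nnegrE ?expR_ge0 ?divr_ge0 //.
  by rewrite (le_trans _ (expR_ge1Dx _)) // -natr1 mulrDl mul1r mulfV // gt_eqF.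
have h : expR 1 * n.+1%:R * A ^+ n <= A2 * A2 ^+ n.
  have := H n (ltnW hn); rewrite expr_div_n ler_pdivlMr ?exprn_gt0 //.
  rewrite -(ler_pM2l A20) => h; rewrite (le_trans _ h) // le_eqVlt.
  by apply/orP; left; apply/eqP; field; rewrite gt_eqF.
rewrite !expr_div_n ler_pdivlMr ?exprn_gt0 // mulrAC ler_pdivrMr ?exprn_gt0 //.
rewrite expr_div_n ler_pdivrMr ?exprn_gt0 // in e1.
have e2 : A ^+ n * n.+1%:R ^+ n.+1 <= A ^+ n * n.+1%:R * (expR 1 * n%:R ^+ n).
  by rewrite exprS mulrA ler_wpM2l ?mulr_ge0 ?exprn_ge0 ?(ltW A0).
rewrite (le_trans e2) // (exprS A2) mulrA.
rewrite ler_wpM2r ?exprn_ge0 //.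
by rewrite (_ : A ^+ n * n.+1%:R * expR 1 = expR 1 * n.+1%:R * A ^+ n) //; ring.
Qed.

Definition parity (p : bool) (n : nat) := (0 < n)%N && (odd n == p).

(** Every large index is of the given parity or comes right after one that is. *)
Lemma consecutive_growth f z A T (p : bool) : entire f -> 0 < A ->
  A / (expR 1 * rho) < T ->
  (exists n0 : nat, forall n, (n0 <= n)%N -> parity p n ->
    normc (taylor_coef f n z) <= coef_size rho A n /\
    normc (taylor_coef f n.+1 z) <= coef_size rho A n) ->
  growth rho T f.
Proof.
move=> ef A0 AT [n0 H].
have er : 0 < expR 1 * rho :> R by rewrite mulr_gt0 ?expR_gt0.
pose A2 := (A + T * (expR 1 * rho)) / 2.
have hAT : A < T * (expR 1 * rho) by rewrite -ltr_pdivrMr.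
have AA2 : A < A2 by rewrite /A2; lra.
have A2T : A2 / (expR 1 * rho) < T by rewrite ltr_pdivrMr // /A2; lra.
have [n1 H1] := coef_sizeS A0 AA2.
apply: (coef_growth rho_gt0 ef (lt_trans A0 AA2) A2T (z := z)).
exists (maxn n0 n1).+2 => -[//|n]; rewrite ltnS gtn_max => /andP[hn0 hn1].
have n_gt0 : (0 < n)%N by rewrite (leq_ltn_trans _ hn0).
have [on|on] := eqVneq (odd n.+1) p.
  have pn : parity p n.+1 by rewrite /parity on eqxx.
  have [h _] := H n.+1 (leqW (ltnW hn0)) pn.
  by rewrite (le_trans h) // coef_size_le ?ltW.
have pn : parity p n.
  by rewrite /parity n_gt0 /=; move: on; rewrite /=; clear; case: (odd n); case: p.
have [_ h] := H n (ltnW hn0) pn.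
by rewrite (le_trans h) // H1 // ltnW.
Qed.

Lemma taylor_truncation h (B q r : R) N z : entire h -> 0 < q -> q <= 2^-1 -> 0 < r ->
  (forall w, normc w = r / q -> normc (h w) <= B) -> normc z <= r ->
  normc (h z - \sum_(k < N) taylor_coef h k 0 * z ^+ k) <= 2 * B * q ^+ N.
Proof.
move=> eh q0 q2 r0 HB zr; have rq0 : 0 < r / q by rewrite divr_gt0.
have coef k : normc (taylor_coef h k 0 * z ^+ k) <= B * q ^+ k.
  have hk : normc (taylor_coef h k 0) * (r / q) ^+ k <= B.
    by apply: taylor_coef_estimate => // w wr; rewrite add0r; exact: HB.
  rewrite normcM normcX (le_trans (y := normc (taylor_coef h k 0) * r ^+ k)) //.
    by rewrite ler_wpM2l ?normc_ge0 // lerXn2r ?nnegrE ?normc_ge0 // ltW.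
  by rewrite -ler_pdivrMr ?exprn_gt0 // -mulrA -expr_div_n.
have B0 : 0 <= B.
  by have := coef 0%N; rewrite !expr0 !mulr1 => h0; exact: le_trans (normc_ge0 _) h0.
have [_ sh] := taylor_has_series eh; have [M HM] := sh r r0.
apply: (@ler_geometric _ _ _ M); exists N => N' NN'.
pose S n : C := \sum_(k < n) taylor_coef h k 0 * z ^+ k.
have tail n : normc (S (N + n)%N - S N) <= 2 * B * q ^+ N - 2 * B * q ^+ N * q ^+ n.
  elim: n => [|n IH]; first by rewrite addn0 subrr normc0 expr0 mulr1 subrr.
  rewrite addnS /S big_ord_recr /= -/(S (N + n)%N) addrAC.
  rewrite (le_trans (normcD _ _)) // (le_trans (lerD IH (coef _))) // exprD.
  pose X := B * q ^+ N * q ^+ n.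
  have X0 : 0 <= X by rewrite !mulr_ge0 ?exprn_ge0 ?(ltW q0).
  have -> : B * (q ^+ N * q ^+ n) = X by rewrite /X mulrA.
  have -> : 2 * B * q ^+ N * q ^+ n = 2 * X by rewrite /X !mulrA.
  have -> : 2 * B * q ^+ N * q ^+ n.+1 = 2 * q * X by rewrite /X exprS; ring.
  by nra.
rewrite -/(S N) (_ : h z - S N = S N' - S N + (h z - S N')); last by ring.
rewrite (le_trans (normcD _ _)) // lerD ?HM // -(subnKC NN') (le_trans (tail _)) //.
by rewrite gerBl !mulr_ge0 ?exprn_ge0 ?(ltW q0).
Qed.

(** The Taylor polynomial of [taylor_coef f n] of degree [N] at the origin is
    interpolated at [N + 1] nodes in [Y]; its first two coefficients are
    [taylor_coef f n 0] and [n.+1%:R * taylor_coef f n.+1 0]. As [N] is a small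
    fraction [n / d] of [n], the loss [Q ^ N] is absorbed by the gap between [A]
    and [A1]; the growth bound of [f] makes the Taylor remainder smaller still, by
    the choice of [q]. *)
Lemma spread_from_line f A A1 T (x b : R) (Y : set R) (S : pred nat) :
  entire f -> 0 < A -> A < A1 -> 0 < T -> growth rho T f ->
  measurable Y -> Y `<=` [set y | `|y| <= b] -> (0 < lebesgue_measure Y)%E ->
  (forall n y, S n -> Y y ->
     normc (taylor_coef f n (Complex x y)) <= coef_size rho A n) ->
  exists n0 : nat, forall n, (n0 <= n)%N -> S n ->
    normc (taylor_coef f n 0) <= coef_size rho A1 n /\
    normc (taylor_coef f n.+1 0) <= coef_size rho A1 n.
Proof.
move=> ef A0 AA1 T0 gf mY Yb Y0 HY.
have [m m0 Ym] : exists2 m : R, 0 < m & ((2 * m)%:E <= lebesgue_measure Y)%E.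
  move: Y0; case: (lebesgue_measure Y) => [M|_|//].
    rewrite lte_fin => M0; exists (M / 2); first by rewrite divr_gt0.
    by rewrite lee_fin mulrC divfK.
  by exists 1 => //; rewrite leey.
pose r : R := `|x| + `|b|; have r0 : 0 <= r by rewrite addr_ge0.
pose Q0 : R := (2 * (1 + r) / m + 1 + r) * expR 1.
have Q00 : 0 <= Q0.
  by rewrite mulr_ge0 ?expR_ge0 // !addr_ge0 // divr_ge0 ?mulr_ge0 ?addr_ge0 // ltW.
pose Q : R := Q0 + 2; have Q2 : 2 <= Q by rewrite lerDr.
have Qp : 0 < Q by apply: lt_le_trans Q2.
(* [k1 ^ n] is the gap between [A] and [A1]; it beats [Q ^ (2 * N)] *)
pose k1 : R := (A1 / A) `^ rho^-1.
have k11 : 1 < k1 by rewrite powR_gt1 ?invr_gt0 // ltr_pdivlMr // mul1r.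
have [d0 Hd] := expr_linear (Q ^+ 2) k11; pose d := d0.+1.
have Qd : Q ^+ 2 <= k1 ^+ d.
  rewrite (le_trans _ (Hd d (leqnSn _))) // ler_peMr ?exprn_ge0 ?(ltW Qp) //.
  by rewrite ler1n.
pose A' : R := expR 1 * rho * (T + 1).
have A'0 : 0 < A' by rewrite !mulr_gt0 ?expR_gt0 // addr_gt0.
(* [taylor_coef f n] is larger by [k2 ^ n] on the disc of radius [(r + 1) / q];
   as [n <= d * (N + 1)], the factor [q ^ (N + 1)] compensates this *)
pose k2 : R := (A' / A) `^ rho^-1; pose k3 : R := k2 + 1.
have k31 : 1 <= k3 by rewrite lerDr powR_ge0.
have k3d : 0 < k3 ^+ d by rewrite exprn_gt0 // (lt_le_trans ltr01).
pose q : R := (2 * k3 ^+ d)^-1.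
have q0 : 0 < q by rewrite invr_gt0 mulr_gt0.
have q2 : q <= 2^-1.
  by rewrite lef_pV2 ?posrE ?mulr_gt0 // ler_pMr // exprn_ege1.
have qk : k3 ^+ d * q = 2^-1 by rewrite /q invfM mulrCA mulfV ?mulr1 // gt_eqF.
have r10 : 0 < r + 1 by rewrite ltr_wpDl.
have rq0 : 0 <= (r + 1) / q by rewrite divr_ge0 // ltW.
have TT1 : T < T + 1 by rewrite ltrDl.
have [n1 H1] := growth_coef rho_gt0 ef T0 TT1 rq0 gf.
exists (maxn n1 (2 * d)).+1 => n; rewrite gtn_max => /andP[n1n dn] Sn.
pose N := (n %/ d)%N.
have N2 : (2 <= N)%N by rewrite leq_divRL // ltnW.
have Nn : (d * N <= n)%N by rewrite mulnC leq_divM.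
have nN : (n <= d * N.+1)%N by rewrite mulnC ltnW // ltn_ceil.
pose h : C -> C := taylor_coef f n.
have eh : entire h := @taylor_coef_entire R f n ef.
pose W := coef_size rho A n; pose B := coef_size rho A' n.
have W0 : 0 <= W := coef_size_ge0 _ _ _.
have BW : B = k2 ^+ n * W.
  by rewrite /B /k2 -coef_sizeM ?divr_ge0 ?(ltW A0) ?(ltW A'0) // divfK // gt_eqF.
have AW : coef_size rho A1 n = k1 ^+ n * W.
  have A10 : 0 < A1 := lt_trans A0 AA1.
  by rewrite /k1 -coef_sizeM ?divr_ge0 ?(ltW A0) ?(ltW A10) // divfK // gt_eqF.
have HB w : normc w = (r + 1) / q -> normc (h w) <= B.
  by move=> wr; apply: H1; [exact: ltnW|rewrite wr].
pose p : {poly C} := \poly_(k < N.+1) taylor_coef h k 0.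
have hp z : normc z <= r -> normc (h z - p.[z]) <= 2 * B * q ^+ N.+1.
  move=> zr; have zr1 : normc z <= r + 1 by rewrite (le_trans zr) // lerDl.
  rewrite horner_poly; exact: (taylor_truncation N.+1 eh q0 q2 r10 HB zr1).
have small : W + 2 * B * q ^+ N.+1 <= 2 * W.
  suff : 2 * (k2 ^+ n * q ^+ N.+1) <= 1.
    by rewrite BW => hk; rewrite (mulrC _ W) mulrA -mulrA (mulrC 2 W); nra.
  have h1 : k2 ^+ n <= (k3 ^+ d) ^+ N.+1.
    rewrite -exprM (le_trans (y := k3 ^+ n)) ?ler_weXn2l //.
    by rewrite lerXn2r ?nnegrE ?addr_ge0 ?powR_ge0 // lerDl.
  have h2 : k2 ^+ n * q ^+ N.+1 <= 2^-1 ^+ N.+1.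
    by rewrite -qk exprMn ler_wpM2r // exprn_ge0 // ltW.
  have h3 : 2^-1 ^+ N.+1 <= 2^-1 :> R.
    by rewrite exprS ler_piMr // exprn_ile1 // invf_le1 // ler1n.
  by lra.
have [y [y1 y2]] : exists y : nat -> R, (forall i, y i + m / N.+1%:R <= y i.+1) /\
    (forall i, (i <= N)%N -> Y (y i)).
  apply: spaced_points => //; first by rewrite divr_gt0.
    by exists (- b) => t /Yb /=; rewrite ler_norml => /andP[].
  apply: lt_le_trans Ym; rewrite lte_fin -mulrA ltr_pM2l // mulrAC ltr_pdivrMr //.
  by rewrite ltr_pM2l // ltr_nat.
pose xs (i : nat) : C := Complex x (y i).
have g0 : 0 < m / N.+1%:R by rewrite divr_gt0.
have xd i j : (dist_nat i j)%:R * (m / N.+1%:R) <= normc (xs i - xs j).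
  have E : normc (xs i - xs j) = `|y i - y j|.
    by rewrite /xs -[Complex _ _ - _]/(Complex (x - x) (y i - y j)) subrr /=
      expr0n add0r sqrtr_sqr.
  rewrite E /dist_nat; have [ij|ji] := leqP i j.
    have := spaced_dist (ltW g0) y1 ij; have /eqP -> : (i - j == 0)%N by rewrite subn_eq0.
    by rewrite distrC => /le_trans; apply; exact: ler_norm.
  have := spaced_dist (ltW g0) y1 (ltnW ji).
  have /eqP -> : (j - i == 0)%N by rewrite subn_eq0 ltnW.
  by rewrite addn0 => /le_trans; apply; exact: ler_norm.
have xr i : (i <= N)%N -> normc (xs i) <= r.
  move=> /y2/Yb yb; rewrite (le_trans (normc_le_ReIm _)) //= lerD2l.
  by rewrite (le_trans yb) // ler_norm.
have pD i : (i <= N)%N -> normc p.[xs i] <= 2 * W.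
  move=> iN; rewrite (le_trans _ small) //.
  rewrite (_ : p.[xs i] = h (xs i) - (h (xs i) - p.[xs i])); last by rewrite subKr.
  rewrite (le_trans (normcB _ _)) // lerD //; last exact/hp/xr.
  by apply: HY => //; exact: y2.
have coef k : (k <= N)%N -> normc (taylor_coef h k 0) <= coef_size rho A1 n.
  move=> kN; have := interpolation_coef_spaced k m0 r0 xd xr (size_poly _ _) pD.
  rewrite coef_poly ltnS kN => /le_trans; apply; rewrite -/Q0 AW.
  apply: (@le_trans _ _ (2 * W * Q ^+ N.+1)).
    by rewrite ler_wpM2l ?mulr_ge0 // lerXn2r ?nnegrE ?(ltW Qp) // lerDl.
  rewrite mulrAC ler_wpM2r //; apply: (@le_trans _ _ (Q ^+ N.+2)).
    by rewrite [leRHS]exprS ler_wpM2r // exprn_ge0 // ltW.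
  have Q1 : 1 <= Q by rewrite (le_trans _ Q2) // ler1n.
  apply: (@le_trans _ _ ((Q ^+ 2) ^+ N)).
    by rewrite -exprM ler_weXn2l // mul2n -addnn -addn2 leq_add2l.
  apply: (@le_trans _ _ ((k1 ^+ d) ^+ N)).
    by rewrite lerXn2r ?nnegrE ?exprn_ge0 ?(ltW Qp) ?powR_ge0.
  by rewrite -exprM ler_weXn2l // ltW.
split; first by have := coef 0%N isT; rewrite taylor_coef0.
have := coef 1%N (ltnW N2); rewrite taylor_coef_taylor1 // normcM normc_nat.
by apply: le_trans; rewrite ler_peMl ?normc_ge0 // ler1n.
Qed.

(** On a bounded part of positive measure, [spread_from_line] would bound all the
    Taylor coefficients at the origin, and the type would be smaller than it is. *)
Lemma small_coef_line_null f A T (x : R) (Y : set R) (p : bool) (K : nat) :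
  entire f -> 0 < A -> ((A / (expR 1 * rho))%:E < entire_type f rho)%E ->
  0 < T -> growth rho T f -> measurable Y ->
  (forall n y, (K <= n)%N -> parity p n -> Y y ->
     normc (taylor_coef f n (Complex x y)) <= coef_size rho A n) ->
  lebesgue_measure Y = 0%E.
Proof.
move=> ef A0 Atau T0 gf mY HY.
have bounded (b : nat) : lebesgue_measure (Y `&` `[- b%:R, b%:R]%classic) = 0%E.
  set Yb := _ `&` _.
  have mYb : measurable Yb by apply: measurableI.
  apply/eqP; rewrite eq_le measure_ge0 andbT leNgt; apply/negP => Yb0.
  have [t [T1 T2]] : exists t : R, A / (expR 1 * rho) < t /\ (t%:E < entire_type f rho)%E.
    move: Atau; case: (entire_type f rho) => [u|_|//].
      rewrite lte_fin => Au; exists ((A / (expR 1 * rho) + u) / 2); rewrite lte_fin.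
      by split; lra.
    by exists (A / (expR 1 * rho) + 1); rewrite ltry; split=> //; lra.
  have er : 0 < expR 1 * rho :> R by rewrite mulr_gt0 ?expR_gt0.
  pose A1 := (A + t * (expR 1 * rho)) / 2.
  have hAT : A < t * (expR 1 * rho) by rewrite -ltr_pdivrMr.
  have AA1 : A < A1 by rewrite /A1; lra.
  have A1T : A1 / (expR 1 * rho) < t by rewrite ltr_pdivrMr // /A1; lra.
  have t0 : 0 < t by rewrite (lt_trans _ T1) // divr_gt0.
  have YbB : Yb `<=` [set y | `|y| <= b%:R].
    by move=> y [_]; rewrite /= in_itv /= ler_norml.
  have [n0 H] := @spread_from_line f A A1 T x b%:R Yb
    (fun n => (K <= n)%N && parity p n) ef A0 AA1 T0 gf mYb YbB Yb0
    (fun n y Sn Yy => HY n y (andP Sn).1 (andP Sn).2 Yy.1).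
  have gt : growth rho t f.
    apply: (@consecutive_growth f 0 A1 t p) => //; first exact: lt_trans AA1.
    exists (maxn n0 K) => n; rewrite geq_max => /andP[n0n Kn] pn.
    by apply: H => //; rewrite Kn.
  by have := lt_le_trans T2 (growth_type (ltW t0) gt); rewrite ltxx.
apply/eqP; rewrite eq_le measure_ge0 andbT.
have YE : Y = \bigcup_(b : nat) (Y `&` `[- b%:R, b%:R]%classic).
  rewrite -setI_bigcupr [X in _ `&` X](_ : _ = setT) ?setIT //.
  rewrite -subTset => y _; exists (Num.bound `|y|) => //=.
  by rewrite in_itv /= -ler_norml ltW // archi_boundP.
rewrite [in leLHS]YE (le_trans (measure_sigma_subadditive _ _ _ (fun _ h => h))) //.
- by move=> b; apply: measurableI.
- by apply: bigcup_measurable => b _; apply: measurableI.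
- by rewrite eseries0 // => i _ _; exact: bounded.
Qed.

End Spread.

(** * The coefficients of one parity *)

Section Parity.
Variables (R : realType) (rho : R).
Hypothesis rho_gt0 : 0 < rho.
Notation C := (R[i]^o).
Implicit Types (f g : C -> C) (z w : C) (T A : R).

Let er : R := expR 1 * rho.
Let er_gt0 : 0 < er. Proof. by rewrite mulr_gt0 ?expR_gt0. Qed.

(** [tau0] and [tau1] together, for [p = false] and [p = true]. *)
Definition tau_parity f (p : bool) z : \bar R :=
  ((expR 1 * rho)^-1%:E * limn_esup (fun k => type_term f rho z (2 * k + p)))%E.

Lemma tau0_parity f z : tau0 f rho z = tau_parity f false z.
Proof.
rewrite /tau0 /tau_parity; congr (_ * limn_esup _)%E; apply/funext => k.
by rewrite addn0.
Qed.

Lemma tau1_parity f z : tau1 f rho z = tau_parity f true z.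
Proof. by []. Qed.

Lemma type_term_le f z n A : 0 <= A -> (0 < n)%N ->
  (type_term f rho z n <= A%:E)%E = (normc (taylor_coef f n z) <= coef_size rho A n).
Proof.
by move=> A0 n0; rewrite /type_term lee_fin term_coef_size ?normc_ge0.
Qed.

Lemma tau_parity_ge0 f p z : (0 <= tau_parity f p z)%E.
Proof.
apply: mule_ge0; first by rewrite lee_fin invr_ge0 ltW.
apply: limf_esup_ge0; first by case=> N _ /(_ N (leqnn N)).
by move=> k; rewrite lee_fin mulr_ge0 ?powR_ge0.
Qed.

Lemma tau_parity_le f p z T : 0 <= T ->
  (exists n0 : nat, forall n, (n0 <= n)%N ->
     normc (taylor_coef f n z) <= coef_size rho (er * T) n) ->
  (tau_parity f p z <= T%:E)%E.
Proof.
move=> T0 [n0 H]; have ET0 : 0 <= er * T by rewrite mulr_ge0 // ltW.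
suff h : (limn_esup (fun k => type_term f rho z (2 * k + p)) <= (er * T)%:E)%E.
  rewrite /tau_parity (_ : T%:E = er^-1%:E * (er * T)%:E)%E.
    by rewrite lee_wpmul2l // lee_fin invr_ge0 ltW.
  by rewrite -EFinM mulrA mulVf ?mul1r // gt_eqF.
apply: (@le_trans _ _ (ereal_sup ((fun k => type_term f rho z (2 * k + p)) @`
    [set k | (n0 < k)%N]))).
  by apply: ereal_inf_lbound; exists [set k | (n0 < k)%N] => //; exists n0.+1.
apply: ub_ereal_sup => _ [k /= kn <-].
have k2 : (k <= 2 * k + p)%N by rewrite mul2n -addnn -addnA leq_addr.
rewrite type_term_le //; first by apply: H; rewrite (leq_trans (ltnW kn)).
by rewrite (leq_trans _ k2) // (leq_ltn_trans _ kn).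
Qed.

Lemma tau_parity_lt f p z A : 0 < A -> (tau_parity f p z < (A / er)%:E)%E ->
  exists K : nat, forall n, (K <= n)%N -> parity p n ->
    normc (taylor_coef f n z) <= coef_size rho A n.
Proof.
move=> A0 tA.
have : (limn_esup (fun k => type_term f rho z (2 * k + p)) < A%:E)%E.
  rewrite (_ : A%:E = er%:E * (A / er)%:E)%E; last first.
    by rewrite -EFinM mulrCA mulfV ?mulr1 // gt_eqF.
  rewrite -lte_pdivrMl //; exact: tA.
move=> /ereal_inf_lt[_ [V [N _ NV] <-]] VA.
exists (2 * N + p)%N => n Nn /andP[n0 np].
pose k := (n./2)%N; have nk : n = (2 * k + p)%N.
  by rewrite -[LHS](odd_double_half n) (eqP np) mul2n addnC.
rewrite -type_term_le ?(ltW A0) // (le_trans _ (ltW VA)) //.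
apply: ereal_sup_ubound; exists k; last by rewrite -nk.
by apply: NV => /=; move: Nn; rewrite nk leq_add2r leq_pmul2l.
Qed.

Definition small_coefs f p A (K : nat) : set C :=
  [set z | forall n, (K <= n)%N -> parity p n ->
     normc (taylor_coef f n z) <= coef_size rho A n].

(** By [growth_coef], whose bound of the coefficients holds at every point. *)
Lemma tau_parity_le_type f p z (t : R) : entire f -> entire_type f rho = t%:E ->
  0 <= t -> (tau_parity f p z <= t%:E)%E.
Proof.
move=> ef ft t0; apply/lee_addgt0Pr => e e0; rewrite -EFinD.
have T0 : 0 < t + e / 2 by rewrite ltr_wpDl // divr_gt0.
have gf : growth rho (t + e / 2) f.
  by apply: type_growth => //; rewrite ft lte_fin ltrDl divr_gt0.
have TT : t + e / 2 < t + e by rewrite ltrD2l ltr_pdivrMr // ltr_pMr // ltr1n.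
have [n0 H] := growth_coef rho_gt0 ef T0 TT (normc_ge0 z) gf.
apply: tau_parity_le; first by rewrite addr_ge0 // ltW.
by exists n0 => n n0n; exact: H.
Qed.

End Parity.

(** * Almost every point *)

Section AlmostEverywhere.
Variables (R : realType) (rho : R).
Hypothesis rho_gt0 : 0 < rho.
Notation C := (R[i]^o).
Implicit Types (f g : C -> C) (T A : R).
Let RR := (measurableTypeR R * measurableTypeR R)%type.

Let toC (q : RR) : C := Complex q.1 q.2.

Let mcomplex (u : RR -> C) :=
  measurable_fun [set: RR] (fun q => Re (u q)) /\
  measurable_fun [set: RR] (fun q => Im (u q)).

Let mcomplexM u v : mcomplex u -> mcomplex v -> mcomplex (fun q => u q * v q).
Proof.
move=> [u1 u2] [v1 v2]; split.
  rewrite (_ : (fun q => _) = (fun q => Re (u q) * Re (v q) - Im (u q) * Im (v q))).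
    apply: measurable_funB.
      exact: (measurable_funM u1 v1).
    exact: (measurable_funM u2 v2).
  by apply/funext => q; rewrite ReM.
rewrite (_ : (fun q => _) = (fun q => Re (u q) * Im (v q) + Im (u q) * Re (v q))).
  apply: measurable_funD.
    exact: (measurable_funM u1 v2).
  exact: (measurable_funM u2 v1).
by apply/funext => q; rewrite ImM.
Qed.

Let mcomplexD u v : mcomplex u -> mcomplex v -> mcomplex (fun q => u q + v q).
Proof.
move=> [u1 u2] [v1 v2]; split.
  rewrite (_ : (fun q => _) = (fun q => Re (u q) + Re (v q))).
    exact: measurable_funD.
  by apply/funext => q; rewrite ReD.
rewrite (_ : (fun q => _) = (fun q => Im (u q) + Im (v q))).
  exact: measurable_funD.
by apply/funext => q; rewrite ImD.
Qed.

Let mcomplex_cst (k : C) : mcomplex (fun=> k).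
Proof. by split; exact: measurable_cst. Qed.

Let mcomplex_toC : mcomplex toC.
Proof. by split; [exact: measurable_fst|exact: measurable_snd]. Qed.

(** As the limit of the partial sums of its power series, which are polynomials
    in the coordinates. *)
Let mcomplex_entire f : entire f -> mcomplex (fun q => f (toC q)).
Proof.
move=> ef; have [_ sf] := taylor_has_series ef.
pose S N q : C := \sum_(k < N) taylor_coef f k 0 * toC q ^+ k.
have mX k : mcomplex (fun q => toC q ^+ k).
  elim: k => [|k IH]; first exact: (mcomplex_cst 1).
  rewrite (_ : (fun q => _) = (fun q => toC q * toC q ^+ k)); first exact: mcomplexM.
  by apply/funext => q; rewrite exprS.
have mS N : mcomplex (S N).
  elim: N => [|N IH].
    rewrite (_ : S 0%N = fun=> 0); first exact: mcomplex_cst.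
    by apply/funext => q; rewrite /S big_ord0.
  rewrite (_ : S N.+1 = fun q => S N q + taylor_coef f N 0 * toC q ^+ N).
    apply: mcomplexD => //; apply: (mcomplexM (u := fun=> _)) => //.
  by apply/funext => q; rewrite /S big_ord_recr.
have lim q : forall e : R, 0 < e -> \forall N \near \oo, normc (f (toC q) - S N q) <= e.
  move=> e e0; have q0 : 0 < normc (toC q) + 1 by rewrite ltr_wpDl ?normc_ge0.
  have [M HM] := sf _ q0; have [n0 Hn] := exp2_large `|M| e0.
  exists n0 => // N /= n0N; rewrite (le_trans (HM _ N _)) ?lerDl //.
  rewrite (le_trans _ Hn) // (@le_trans _ _ (`|M| / 2 ^+ N)) //.
    by rewrite ler_wpM2r ?invr_ge0 ?exprn_ge0 ?ler_norm.
  by rewrite ler_wpM2l // lef_pV2 ?posrE ?exprn_gt0 // ler_weXn2l ?ler1n.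
split.
  apply: (measurable_fun_cvg (fun N => (mS N).1)) => q _.
  apply/cvgrPdist_le => e /(lim q); apply: filterS => N /=; rewrite -ReB.
  exact/le_trans/ler_Re_normc.
apply: (measurable_fun_cvg (fun N => (mS N).2)) => q _.
apply/cvgrPdist_le => e /(lim q); apply: filterS => N /=; rewrite -ImB.
exact/le_trans/ler_Im_normc.
Qed.

Let small_plane f p A K : set RR := [set q | small_coefs rho f p A K (toC q)].

Let measurable_small f p A K : entire f -> measurable (small_plane f p A K).
Proof.
move=> ef; rewrite (_ : small_plane f p A K =
    \bigcap_(n in [set n | (K <= n)%N && parity p n])
      [set q | Re (taylor_coef f n (toC q)) ^+ 2 + Im (taylor_coef f n (toC q)) ^+ 2
               <= coef_size rho A n ^+ 2]).
  apply: bigcap_measurableType => n _.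
  have [m1 m2] := mcomplex_entire (@taylor_coef_entire R f n ef).
  rewrite -[X in measurable X]setTI.
  apply: measurable_fun_le => //.
  by apply: measurable_funD; apply: measurable_funX.
apply/seteqP; split=> q /= H n /=.
  move=> /andP[Kn pn]; have := H n Kn pn.
  case: (taylor_coef f n (toC q)) => a b /= h.
  rewrite -(@sqr_sqrtr _ (a ^+ 2 + b ^+ 2)) ?addr_ge0 ?sqr_ge0 //.
  by rewrite lerXn2r ?nnegrE ?sqrtr_ge0 ?coef_size_ge0.
move=> Kn pn; have := H n; rewrite /= Kn pn => /(_ isT).
case: (taylor_coef f n (toC q)) => a b /= h.
by rewrite -[leRHS]ger0_norm ?coef_size_ge0 // -sqrtr_sqr ler_wsqrtr.
Qed.

(** Fubini reduces the plane to vertical lines. *)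
Let small_null f T p A K : entire f -> 0 < A ->
  ((A / (expR 1 * rho))%:E < entire_type f rho)%E -> 0 < T -> growth rho T f ->
  (@lebesgue_measure R \x @lebesgue_measure R)%E.-negligible (small_plane f p A K).
Proof.
move=> ef A0 At T0 gf; have mE := measurable_small p A K ef.
apply/negligibleP => //; apply: integral0_eq => x _ /=.
apply: (small_coef_line_null (x := x) (p := p) (K := K) rho_gt0 ef A0 At T0 gf).
  exact: measurable_xsection.
move=> n y Kn pn /=; rewrite /xsection /= inE => H.
exact: H.
Qed.

(** A point where a partial type is less than the type has small coefficients for
    some [A j < e * rho * t] and some starting index, hence lies in one of
    countably many null sets. *)
Lemma tau_parity_ae f (t : R) : entire f -> entire_type f rho = t%:E -> 0 <= t ->
  ae_area (fun z : C => forall p, tau_parity rho f p z = t%:E).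
Proof.
move=> ef ft t0; have er0 : 0 < expR 1 * rho :> R by rewrite mulr_gt0 ?expR_gt0.
pose A (j : nat) : R := expR 1 * rho * t * (j.+1%:R / j.+2%:R).
have gf : growth rho (t + 1) f by apply: type_growth => //; rewrite ft lte_fin ltrDl.
have [t00|tp] := eqVneq t 0.
  rewrite /ae_area /almost_everywhere; apply: (@negligibleS _ _ _ _ set0).
    move=> q /=; apply => p; apply/eqP; rewrite eq_le.
    by rewrite (tau_parity_le_type rho_gt0 _ _ ef ft t0) t00 tau_parity_ge0.
  exact: negligible_set0.
have {}t0 : 0 < t by rewrite lt_def tp.
have A0 j : 0 < A j by rewrite !mulr_gt0 ?expR_gt0.
have AE j : A j / (expR 1 * rho) = t * (j.+1%:R / j.+2%:R).
  by rewrite /A -(mulrA (expR 1 * rho)) mulrAC mulfV ?mul1r // gt_eqF.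
have At j : ((A j / (expR 1 * rho))%:E < entire_type f rho)%E.
  by rewrite AE ft lte_fin gtr_pMr // ltr_pdivrMr // mul1r ltr_nat.
have T0 : 0 < t + 1 by rewrite addr_gt0.
rewrite /ae_area /almost_everywhere.
apply: (@negligibleS _ _ _ _
  (\bigcup_j \bigcup_K (small_plane f false (A j) K `|` small_plane f true (A j) K))).
  move=> q /= /existsNP[p Hp].
  have lt : (tau_parity rho f p (toC q) < t%:E)%E.
    rewrite lt_neqAle; apply/andP; split; first exact/eqP.
    exact: (tau_parity_le_type rho_gt0 _ _ ef ft (ltW t0)).
  have [u u0 ut] : exists2 u : R, tau_parity rho f p (toC q) = u%:E & u < t.
    move: lt (tau_parity_ge0 rho_gt0 f p (toC q)).
    by case: (tau_parity rho f p (toC q)) => // u; rewrite lte_fin => ut _; exists u.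
  pose j := Num.bound (t / (t - u)).
  have jt : u < t * (j.+1%:R / j.+2%:R).
    have tu : 0 < t - u by rewrite subr_gt0.
    have b0 : 0 <= t / (t - u) by rewrite divr_ge0 // ltW.
    have hj : t / (t - u) < j.+2%:R.
      by apply: (lt_le_trans (archi_boundP b0)); rewrite ler_nat leqW // leqnSn.
    rewrite mulrA ltr_pdivlMr //; rewrite ltr_pdivrMr // in hj.
    by rewrite -[j.+2%:R]natr1 in hj *; lra.
  have [K HK] : exists K : nat, forall n, (K <= n)%N -> parity p n ->
      normc (taylor_coef f n (toC q)) <= coef_size rho (A j) n.
    by apply: tau_parity_lt => //; rewrite u0 lte_fin AE.
  exists j => //; exists K => //.
  by case: p {Hp lt u0} HK => HK; [right|left].
apply: negligible_bigcup => j; apply: negligible_bigcup => K.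
by apply: negligibleU; exact: (small_null _ _ ef (A0 j) (At j) T0 gf).
Qed.

End AlmostEverywhere.

(** * Baire category in the complex plane *)

Section Baire.
Variable R : realType.
Notation C := (R[i]^o).
Implicit Types (z w : C) (F : nat -> set C).

Lemma opencP (O : set C) : open O <->
  (forall z, O z -> exists2 r : R, 0 < r & forall w, normc (z - w) < r -> O w).
Proof.
rewrite openE; split=> H z /H => [/nbhscP //|h]; exact/nbhscP.
Qed.

(** Each disc contains a closed disc of at most half its radius inside the next
    open set; the centres converge to a point of all these discs. *)
Lemma baire_complex F : (forall m, open (F m) /\ dense (F m)) ->
  dense (\bigcap_m F m).
Proof.
move=> HF O [w Ow] oO.
have [s s0 Hs] := (opencP O).1 oO w Ow.
have step (q : nat * (C * R)) : exists q' : C * R, 0 < q.2.2 ->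
    [/\ 0 < q'.2, q'.2 <= q.2.2 / 2, normc (q'.1 - q.2.1) + q'.2 <= q.2.2 &
        forall v, normc (q'.1 - v) <= q'.2 -> F q.1 v].
  case: q => m [z r] /=; have [r0|] := boolP (0 < r); last by exists (z, r).
  have [oF dF] := HF m.
  have oB : open [set v : C | normc (z - v) < r].
    apply/opencP => v /= vr; exists (r - normc (z - v)); first by rewrite subr_gt0.
    move=> u uv; rewrite (_ : z - u = (z - v) + (v - u)); last by ring.
    by rewrite (le_lt_trans (normcD _ _)) // -ltrBrDl.
  have [|v [/= vr Fv]] := dF [set v : C | normc (z - v) < r] _ oB.
    by exists z; rewrite /= subrr normc0.
  have [e e0 He] := (opencP (F m)).1 oF v Fv.
  pose r' := Num.min (e / 2) (Num.min (r / 2) (r - normc (z - v))).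
  have r'0 : 0 < r' by rewrite !lt_min !divr_gt0 // subr_gt0 vr.
  exists (v, r'); split=> //=.
  - by rewrite /r' !ge_min lexx !orbT.
  - by rewrite normc_distC -lerBrDl /r' !ge_min lexx !orbT.
  - move=> u /le_lt_trans h; apply: He; apply: h.
    by rewrite (@le_lt_trans _ _ (e / 2)) ?ge_min ?lexx // ltr_pdivrMr // ltr_pMr // ltr1n.
have [next nextP] := choice step.
pose r0 := Num.min 1 (s / 2).
have r00 : 0 < r0 by rewrite lt_min ltr01 divr_gt0.
pose p := fix p n := if n is m.+1 then next (m, p m) else (w, r0).
have pS n : p n.+1 = next (n, p n) by [].
have pos n : 0 < (p n).2 by elim: n => [//|n IH]; have [] := nextP (n, p n) IH.
have rad n : (p n).2 <= 1 / 2 ^+ n.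
  elim: n => [|n IH]; first by rewrite expr0 divr1 /= ge_min lexx.
  have [_ h _ _] := nextP (n, p n) (pos n).
  rewrite (le_trans h) // exprSr invfM mul1r mulrC [leRHS]mulrC ler_wpM2l //.
  by rewrite -[leRHS]mul1r.
have ball n m : normc ((p (n + m)%N).1 - (p n).1) + (p (n + m)%N).2 <= (p n).2.
  elim: m => [|m IH]; first by rewrite addn0 subrr normc0 add0r.
  have [_ _ h _] := nextP ((n + m)%N, p (n + m)%N) (pos _).
  rewrite addnS; rewrite /= -pS in h.
  have := normcD ((p (n + m).+1).1 - (p (n + m)%N).1) ((p (n + m)%N).1 - (p n).1).
  rewrite subrKA => h'; lra.
have [n|l Hl] := @cauchy_limit R (fun n => (p n).1) 1 ler01.
  have [_ _ h _] := nextP (n, p n) (pos n).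
  by have := rad n; have := pos n.+1; move: h; rewrite /=; lra.
have inball n : normc (l - (p n).1) <= (p n).2.
  apply: (@ler_geometric _ _ _ (4 * 1)); exists n => N nN.
  rewrite (_ : l - _ = ((p N).1 - (p n).1) + (l - (p N).1)); last by ring.
  rewrite (le_trans (normcD _ _)) // lerD //.
  have := ball n (N - n)%N; rewrite subnKC // => h.
  by have := pos N; lra.
exists l; split.
  apply: Hs; rewrite normc_distC (le_lt_trans (inball 0%N)) //=.
  by rewrite (@le_lt_trans _ _ (s / 2)) ?ge_min ?lexx ?orbT // ltr_pdivrMr // ltr_pMr // ltr1n.
move=> m _; have [_ _ _ h] := nextP (m, p m) (pos m); apply: h.
rewrite normc_distC; exact: (inball m.+1).
Qed.

(** A countable dense intersection would become empty when its points, one by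
    one, are removed from the open sets. *)
Lemma dense_Gdelta_uncountable F : (forall m, open (F m) /\ dense (F m)) ->
  ~ countable (\bigcap_m F m).
Proof.
move=> HF /countable_injP[e einj]; set U := \bigcap_m F m in einj.
pose S m := [set z : C | ~ (U z /\ e z = m)].
have HS m : open (S m) /\ dense (S m).
  have [[v [Uv ev]]|noS] := pselect (exists v, U v /\ e v = m); last first.
    rewrite (_ : S m = setT); first by split; [exact: openT|move=> O O0 _; rewrite setIT].
    by rewrite -subTset => z _ zm; apply: noS; exists z.
  have SE z : S m z <-> z != v.
    split=> [Sz|zv [Uz ez]]; first by apply/eqP => zv; apply: Sz; rewrite zv.
    by move/eqP: zv; apply; apply: einj; rewrite ?inE // ez ev.
  split.
    apply/opencP => z /SE zv; exists (normc (z - v)).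
      by rewrite normc_gt0 subr_eq0.
    by move=> w zw; apply/SE; apply: contraTneq zw => ->; rewrite ltxx.
  move=> O [w Ow] /opencP/(_ w Ow)[r r0 Hr].
  have [wv|wv] := eqVneq w v; last by exists w; split=> //; apply/SE.
  have n2 : normc ((r / 2)%:C%C : C) = r / 2 by rewrite normc_real gtr0_norm ?divr_gt0.
  exists (w + (r / 2)%:C%C); split.
    apply: Hr; rewrite opprD addrA subrr sub0r normcN n2.
    by rewrite ltr_pdivrMr // ltr_pMr // ltr1n.
  apply/SE; rewrite wv -subr_eq0 addrAC subrr add0r -normc_gt0 n2 divr_gt0 //.
pose F' n := if odd n then S n./2 else F n./2.
have dF' m : open (F' m) /\ dense (F' m) by rewrite /F'; case: (odd m).
have T0 : [set: C] !=set0 by exists 0.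
have [l [_ Hl]] := baire_complex dF' T0 openT.
have Ul : U l.
  by move=> m _; have := Hl m.*2 I; rewrite /F' odd_double doubleK.
have := Hl (e l).*2.+1 I.
by rewrite /F' /= odd_double /= uphalf_double => h; apply: h.
Qed.

End Baire.

(** * Infinite type *)

Section InfiniteType.
Variables (R : realType) (rho : R).
Hypothesis rho_gt0 : 0 < rho.
Notation C := (R[i]^o).
Implicit Types (f : C -> C) (z w : C) (A : R).

Lemma small_coefs_closed f p A K : entire f -> open (~` small_coefs rho f p A K).
Proof.
move=> ef; apply/opencP => z /existsNP[n /not_implyP[Kn /not_implyP[pn]]].
move=> /negP; rewrite -ltNge => h.
have cn : {for z, continuous (taylor_coef f n : C -> C)}.
  exact: (entire_continuous (@taylor_coef_entire R f n ef)).
pose e := (normc (taylor_coef f n z) - coef_size rho A n) / 2.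
have e0 : 0 < e by rewrite divr_gt0 // subr_gt0.
have [r r0 H] := (continuouscP _ _).1 cn e e0; exists r => // w /H hw Hw.
have := Hw n Kn pn; have := normc_lerB (taylor_coef f n z) (taylor_coef f n w).
by move: hw; rewrite /e; lra.
Qed.

(** On a disc where the coefficients of one parity are small, Cauchy's estimate
    for their derivatives makes the coefficients of the other parity small too,
    so the type is finite. *)
Lemma small_coefs_nowhere_dense f p A K : entire f ->
  entire_type f rho = +oo%E -> 0 < A -> dense (~` small_coefs rho f p A K).
Proof.
move=> ef ft A0 O [z Oz] /opencP/(_ z Oz)[r r0 Hr].
apply: contrapT => HO.
have sub w : O w -> small_coefs rho f p A K w.
  by move=> Ow; apply: contrapT => h; apply: HO; exists w.
pose T := A / (expR 1 * rho) + 1.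
have AT : A / (expR 1 * rho) < T by rewrite ltrDl.
have T0 : 0 <= T.
  by rewrite (le_trans _ (ltW AT)) // divr_ge0 ?(ltW A0) // mulr_ge0 ?expR_ge0 // ltW.
suff gT : growth rho T f by have := growth_type T0 gT; rewrite ft.
apply: (consecutive_growth rho_gt0 ef A0 AT (z := z) (p := p)).
have r20 : 0 < r / 2 by rewrite divr_gt0.
have rr : r / 2 < r by rewrite ltr_pdivrMr // ltr_pMr // ltr1n.
exists (maxn K (Num.bound (r / 2)^-1)) => n; rewrite geq_max => /andP[Kn rn] pn.
split; first exact: sub.
have := @taylor_coef_estimate R (taylor_coef f n) z (r / 2) (coef_size rho A n) 1
  (@taylor_coef_entire R f n ef) r20.
rewrite taylor_coef_taylor1 // expr1 normcM normc_nat => h.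
have {}h : n.+1%:R * normc (taylor_coef f n.+1 z) * (r / 2) <= coef_size rho A n.
  apply: h => w wr; apply: sub => //; apply: Hr.
  by rewrite opprD addrA subrr sub0r normcN wr.
apply: le_trans h; rewrite mulrAC ler_peMl ?normc_ge0 //.
rewrite -ler_pdivrMr // mul1r (le_trans (ltW (archi_boundP _))) ?invr_ge0 ?(ltW r20) //.
by rewrite ler_nat leqW.
Qed.

(** The sets [small_coefs] grow with [A] and with the starting index, so that one
    sequence [m], with the parity of the coefficients in that of [m] and
    [A = m / 2 + 1], meets them all. *)
Lemma tau_parity_generic f : entire f -> entire_type f rho = +oo%E ->
  exists U : set C, [/\ dense U, Gdelta U, ~ countable U &
    forall z p, U z -> tau_parity rho f p z = +oo%E].
Proof.
move=> ef ft.
pose F m := ~` small_coefs rho f (odd m) m./2.+1%:R m./2.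
have HF m : open (F m) /\ dense (F m).
  by split; [exact: small_coefs_closed|exact: small_coefs_nowhere_dense].
exists (\bigcap_m F m); split.
- exact: baire_complex.
- by exists F => // m; have [] := HF m.
- exact: dense_Gdelta_uncountable.
move=> z p Uz; have er0 : 0 < expR 1 * rho :> R by rewrite mulr_gt0 ?expR_gt0.
apply/eqP; rewrite -leye_eq leNgt; apply/negP => lt.
have [u uE] : exists u : R, tau_parity rho f p z = u%:E.
  move: lt (tau_parity_ge0 rho_gt0 f p z).
  by case: (tau_parity rho f p z) => // u _ _; exists u.
have u0 : 0 <= u by have := tau_parity_ge0 rho_gt0 f p z; rewrite uE lee_fin.
have uer : 0 <= u * (expR 1 * rho) by rewrite mulr_ge0 // ltW.
pose M := Num.bound (u * (expR 1 * rho)).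
have uM : (tau_parity rho f p z < (M.+1%:R / (expR 1 * rho))%:E)%E.
  rewrite uE lte_fin ltr_pdivlMr // (lt_le_trans (archi_boundP uer)) //.
  by rewrite ler_nat.
have [K HK] := tau_parity_lt rho_gt0 (ltr0Sn R M) uM.
pose m := (p + (maxn M K).*2)%N.
have mp : odd m = p by rewrite oddD odd_double addbF oddb.
have m2 : m./2 = maxn M K by rewrite half_bit_double.
apply: (Uz m I); rewrite /= mp m2 => n; rewrite geq_max => /andP[Mn Kn] pn.
rewrite (le_trans (HK n Kn pn)) // coef_size_le // ler_nat ltnS.
exact: leq_maxl.
Qed.

End InfiniteType.

Theorem theorem2 (R : realType) (g : R[i]^o -> R[i]^o) (rho : R) (tau : \bar R)
    (g_entire : entire g)
    (rho_gt0 : 0 < rho)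
    (g_order : entire_order g = rho%:E)
    (g_type : entire_type g rho = tau) :
  ((tau < +oo)%E ->
     ae_area (fun z : R[i]^o => tau0 g rho z = tau /\ tau1 g rho z = tau)) /\
  (tau = +oo%E ->
     exists U : set R[i]^o,
       [/\ dense U, Gdelta U, ~ countable U &
         forall z, U z -> tau0 g rho z = +oo%E /\ tau1 g rho z = +oo%E]).
Proof.
split=> [tau_fin|tau_oo].
  have tau_ge0 : (0 <= tau)%E by rewrite -g_type; exact: order_type_ge0 g_order.
  have [t tE] : exists t : R, tau = t%:E.
    by move: tau_fin tau_ge0; case: (tau) => // t _ _; exists t.
  rewrite tE lee_fin in tau_ge0.
  have := tau_parity_ae rho_gt0 g_entire (etrans g_type tE) tau_ge0.
  apply: negligibleS => q; apply: contra_not => /= H.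
  by rewrite tE tau0_parity tau1_parity !H.
have [U [dU GU ncU HU]] := tau_parity_generic rho_gt0 g_entire (etrans g_type tau_oo).
exists U; split=> // z Uz.
by rewrite tau0_parity tau1_parity; split; exact: HU.
Qed.
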